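(* There is an absolute constant $c_0>0$ such that the following holds. Pick a regularization parameter $\lambda$ such that $n\lambda\ge12\pi M$. With probability at least $1-p^2\exp(-\frac{c_0}{M^2}n\lambda^2)$, $$\|\hat\Theta^s_c-\Theta^*\|_{\max}\le2M\lambda .$$ Moreover, assume that $n\gg d^2\log p$, and suppose $M$ is a fixed constant. Pick a regularization parameter $\lambda$ satisfying $\lambda=O\big((\log p/n)^{1/2}\big)$. Then $$\|\hat\Theta^s_c-\Theta^*\|_{\max}=O_P\Big(\sqrt{\frac{\log p}{n}}\Big).$$
   Context: Model and rank correlation: $X=(X_1,\dots,X_p)$ follows the nonparanormal model, i.e. there are (unknown) univariate monotone increasing functions $f_1,\dots,f_p$ such that $(f_1(X_1),\dots,f_p(X_p))\sim N_p(0,\Sigma^* )$, where $\Sigma^*=(\sigma^*_{ij})$ is positive definite with unit diagonal; $\Theta^*=(\theta^*_{ij})=(\Sigma^* )^{-1}$. One observes $n$ i.i.d. copies $\mathbf x_1,\dots,\mathbf x_n$ of $X$, $\mathbf x_l=(x_{l1},\dots,x_{lp})$. For each $i$ let $(r_{1i},\dots,r_{ni})$ be the ranks of $x_{1i},\dots,x_{ni}$; $\hat r_{ij}$ (Spearman's rank correlation) is the Pearson sample correlation of the rank vectors of variables $i$ and $j$; $\hat r^s_{ij}=2\sin(\frac{\pi}{6}\hat r_{ij})$ and $\hat{\mathbf R}^s=(\hat r^s_{ij})_{1\le i,j\le p}$. Rank-based CLIME with parameter $\lambda$: $\hat\Theta^s_c$ is a solution of $\min_\Theta\|\Theta\|_1$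 over $p\times p$ matrices subject to $\|\hat{\mathbf R}^s\Theta-\mathbf I\|_{\max}\le\lambda$, where $\|\Theta\|_1=\sum_{i,j}|\theta_{ij}|$ and $\|A\|_{\max}=\max_{i,j}|a_{ij}|$. $M=\|\Theta^*\|_{\ell_1}=\max_j\sum_i|\theta^*_{ij}|$ and $d=\max_k|\{j\ne k:\theta^*_{kj}\ne0\}|$. $a_n\gg b_n$ means $b_n/a_n\to0$.
   Formalization: In the second part, λ=O((log p/n)^{1/2}) is supplemented by λ ≥ C_0 M (log p/n)^{1/2} for all large n, with C_0 an absolute constant; without a lower bound on λ the claim fails (e.g. Θ*=I, p~n/10, λ=12π/n). *)

(* Defs.v *)
From HB Require Import structures.
From mathcomp Require Import all_boot all_order all_algebra.
From mathcomp Require Import all_classical all_reals all_analysis.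

Set Implicit Arguments.
Unset Strict Implicit.
Unset Printing Implicit Defensive.

Import Order.TTheory GRing.Theory Num.Theory.
Import numFieldNormedType.Exports.

Local Open Scope classical_set_scope.
Local Open Scope ring_scope.

(* Integral of a nonnegative function on R^n, as n iterated Lebesgue integrals
   (first coordinate outermost). *)
Fixpoint iterated_integral (R : realType) (n : nat) :
    (n.-tuple R -> \bar R) -> \bar R :=
  match n with
  | 0 => fun g => g [tuple]
  | m.+1 => fun g => (\int[lebesgue_measure]_(x in [set: R])
                        iterated_integral (fun y => g [tuple of x :: y]))%E
  end.

Definition pos_def (R : realType) (p : nat) (S : 'M[R]_p) : Prop :=
  S^T = S /\ forall v : 'rV[R]_p, v != 0 -> 0 < (v *m S *m v^T) 0 0.

Definition row_of_tuple (R : realType) (p : nat) (y : p.-tuple R) : 'rV[R]_p :=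
  \row_i tnth y i.

Definition gauss_pdf (R : realType) (p : nat) (S : 'M[R]_p) (y : p.-tuple R)
    : R :=
  expR (- (row_of_tuple y *m invmx S *m (row_of_tuple y)^T) 0 0 / 2)
    / Num.sqrt ((2 * pi) ^+ p * \det S).

(* [Y] has the N_p(0, S) distribution under [P]; only meant for [pos_def S]. *)
Definition gaussian_vector (R : realType) (d : measure_display)
    (T : measurableType d) (P : probability T R) (p : nat)
    (Y : T -> p.-tuple R) (S : 'M[R]_p) : Prop :=
  forall A : set (p.-tuple R), measurable A ->
    P (Y @^-1` A) = iterated_integral (fun y => (\1_A y * gauss_pdf S y)%:E).

(* [f i] is only required to be nondecreasing on the values taken by [X_i]: when
   [X_i] is, e.g., uniform on (0, 1), no nondecreasing function defined on the
   whole real line makes [f i (X_i)] normal. Weak monotonicity is enough: the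
   marginals of [X] have no atoms anyway. *)
Definition nonparanormal (R : realType) (d : measure_display)
    (T : measurableType d) (P : probability T R) (p : nat)
    (X : {RV P >-> p.-tuple R}) (S : 'M[R]_p) : Prop :=
  [/\ pos_def S,
      forall i, S i i = 1 &
      exists f : 'I_p -> R -> R,
        (forall i w w', tnth (X w) i <= tnth (X w') i ->
           f i (tnth (X w) i) <= f i (tnth (X w') i)) /\
        gaussian_vector P (fun w => [tuple f i (tnth (X w) i) | i < p]) S].

(* [B l := setT] gives the product rule for every subfamily. *)
Definition iid_copies (R : realType) (d : measure_display)
    (T : measurableType d) (P : probability T R) (p n : nat)
    (X : {RV P >-> p.-tuple R}) (x : 'I_n -> {RV P >-> p.-tuple R}) : Prop :=
  (forall l (B : set (p.-tuple R)), measurable B ->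
     distribution P (x l) B = distribution P X B) /\
  (forall B : 'I_n -> set (p.-tuple R), (forall l, measurable (B l)) ->
     P (\bigcap_(l in [set: 'I_n]) (x l @^-1` B l)) =
     (\prod_(l < n) P (x l @^-1` B l))%E).

Section rank_correlation.
Context {R : realType} {n p : nat}.

(* Row [l] of a data matrix is the [l]-th observation. In the model ties have
   probability zero, so that the treatment of ties is immaterial. *)
Definition rank_in_sample (D : 'M[R]_(n, p)) (l : 'I_n) (i : 'I_p) : nat :=
  #|[pred l' : 'I_n | (D l' i <= D l i)%R]|.

Definition sample_mean (u : 'I_n -> R) : R := (\sum_(l < n) u l) / n%:R.

Definition pearson (u v : 'I_n -> R) : R :=
  (\sum_(l < n) (u l - sample_mean u) * (v l - sample_mean v)) /
  Num.sqrt ((\sum_(l < n) (u l - sample_mean u) ^+ 2) *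
            (\sum_(l < n) (v l - sample_mean v) ^+ 2)).

Definition spearman (D : 'M[R]_(n, p)) (i j : 'I_p) : R :=
  pearson (fun l => (rank_in_sample D l i)%:R)
          (fun l => (rank_in_sample D l j)%:R).

Definition rank_corr_mx (D : 'M[R]_(n, p)) : 'M[R]_p :=
  \matrix_(i, j) (2 * sin (pi / 6 * spearman D i j)).

End rank_correlation.

Definition sum_norm (R : realType) (p : nat) (A : 'M[R]_p) : R :=
  \sum_i \sum_j `|A i j|.

Definition l1_norm (R : realType) (p : nat) (A : 'M[R]_p) : R :=
  \big[Num.max/0]_j \sum_i `|A i j|.

Definition max_degree (R : realType) (p : nat) (A : 'M[R]_p) : nat :=
  (\max_(k < p) #|[pred j : 'I_p | (j != k) && (A k j != 0%R)]|)%N.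

(* [mx_norm] is the entrywise maximum norm. *)
Definition clime_feasible (R : realType) (p : nat) (Rhat : 'M[R]_p) (lam : R)
    (Th : 'M[R]_p) : Prop :=
  mx_norm (Rhat *m Th - 1%:M) <= lam.

Definition clime_solution (R : realType) (p : nat) (Rhat : 'M[R]_p) (lam : R)
    (Th : 'M[R]_p) : Prop :=
  clime_feasible Rhat lam Th /\
  forall Th', clime_feasible Rhat lam Th' -> sum_norm Th <= sum_norm Th'.

Definition data_mx (R : realType) (d : measure_display)
    (T : measurableType d) (P : probability T R) (p n : nat)
    (x : 'I_n -> {RV P >-> p.-tuple R}) (w : T) : 'M[R]_(n, p) :=
  \matrix_(l, i) tnth (x l w) i.

(* An arbitrary, possibly non-measurable, selection of a solution. The program
   may be infeasible, in which case the estimate is unconstrained. *)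
Definition rank_clime (R : realType) (d : measure_display)
    (T : measurableType d) (P : probability T R) (p n : nat)
    (x : 'I_n -> {RV P >-> p.-tuple R}) (lam : R) (Th : T -> 'M[R]_p) : Prop :=
  forall w, let Rhat := rank_corr_mx (data_mx x w) in
    (exists Th0, clime_solution Rhat lam Th0) -> clime_solution Rhat lam (Th w).

(* Inner probability, since [E] need not be measurable. *)
Definition with_prob_at_least (R : realType) (d : measure_display)
    (T : measurableType d) (P : probability T R) (q : R) (E : set T) : Prop :=
  exists A : set T, [/\ measurable A, A `<=` E & (q%:E <= P A)%E].

(* Y_n = O_P(a_n), for [Y n] defined on its own probability space. *)
Definition stochastic_bigO (R : realType) (d : nat -> measure_display)
    (T : forall n, measurableType (d n)) (P : forall n, probability (T n) R)
    (Y : forall n, T n -> R) (a : nat -> R) : Prop :=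
  forall eps : R, 0 < eps -> exists2 K : R, 0 < K &
    \forall n \near \oo,
      with_prob_at_least (P n) (1 - eps) [set w | `|Y n w| <= K * `|a n|].

(* Main.v *)
Require Import Defs.
From HB Require Import structures.
From mathcomp Require Import all_boot all_order all_algebra.
From mathcomp Require Import all_classical all_reals all_analysis.
From mathcomp Require Import measurable_realfun.
From mathcomp Require Import ring lra.

Set Implicit Arguments.
Unset Strict Implicit.
Unset Printing Implicit Defensive.

Import Order.TTheory GRing.Theory Num.Theory.
Import numFieldNormedType.Exports.

Local Open Scope classical_set_scope.
Local Open Scope ring_scope.

(** The theorem combines a deterministic analysis of CLIME with a
concentration inequality for the entries of the rank correlation matrix.

Deterministic part. If the estimated correlation matrix is entrywise within
lam / M of the true one, then the true precision matrix is feasible. The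
program minimizes the entrywise sum of absolute values, and its constraint
couples no two columns, so that every column of a solution has minimal l1 norm
among the feasible ones; in particular the columns of the solution are no
larger than those of the truth, and the identity
Th - S^-1 = S^-1 ((Rhat Th - 1) - (Rhat - S) Th) gives the bound 2 M lam
([clime_error]).

Concentration. When there are no ties, the rank of an observation is a sum of
comparison indicators, so that Spearman's coefficient is, up to 12 / n, the
affine function 12 g - 3 of
g = n^-3 sum_(l, a, c) [x_a <= x_l] [x'_c <= x'_l] ([spearman_approx]).
Changing one observation changes g by at most 3 / n, so the bounded
differences inequality ([mcdiarmid]) gives exp(- c n t^2) tails around its
mean, and up to O(1 / n) this mean is kappa = E Phi(Z) Phi(Z') for the latent
Gaussian pair (Z, Z') of correlation r ([rank_stat_mean],
[bin_rank_mean_bounds]).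

The value of kappa. The Gaussian law is only available as an iterated integral
against the p-dimensional density, and the density is never marginalized.
Every expectation of a function of two coordinates is evaluated through the
change of variables of Cameron and Martin ([gaussE_shift]) along directions
that see these two coordinates only. Writing
Phi(z) Phi(z') as the integral over the quadrant s, t > 0 of
phi(z - s) phi(z' - t), the expectation of the integrand is a constant times
exp(- (s^2 - r s t + t^2) / (4 - r^2)) ([smoothedE]). The quotient of the
quadrant integral by the plane integral is elementary after the substitution
t = s x, and yields 2 sin(pi / 6 (12 kappa - 3)) = r ([gaussE_cdf],
[spearman_pearson_bridge]).

Discretization. The latent scale is cut into finitely many intervals of mass
at most 1 / N. Since the marginal transformations are monotone along the values
taken by the observations, these intervals pull back to intervals of the
observed scale ([obs_bin_latent]), hence to measurable events although the
transformations need not be measurable. Two observations in different bins are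
ordered as their bins, so, outside an event of probability at most
2 n^2 / N, the statistic g only depends on i.i.d. variables with values in a
finite set, and its analysis only involves finite sums. The resolution N is
arbitrary, so that this discretization costs an arbitrarily small probability
([rank_corr_concentration]).

Assembly. A union bound gives the probability 4 (p^2 - p) exp(- 2 c0 n t^2)
([rank_corr_mx_concentration]). It is turned into p^2 exp(- c0 n t^2) by giving
up half of the exponent. For the asymptotic part with p = p(n), the deviation
t is of the order of the rate, and exp(- 2 c0 n t^2) is a power of 1 / p, which
is small if p is large. If p is bounded by 1 / eps a different argument is
needed, since then exp(- 2 c0 n t^2) need not be small: with t a large multiple
of n^(-1/2) the true precision matrix may fail to be feasible, but the
estimated correlation matrix is invertible for large n, so that the program is
still feasible, and the error is at most 2 M (lam + M t)
([clime_error_robust]). *)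

(** * Iterated Lebesgue integrals *)

Section lebesgue_change_of_variable.
Context {R : realType}.
Notation mu := (@lebesgue_measure R).
Local Open Scope ereal_scope.

(** The pushforward of Lebesgue measure by a translation agrees with it on the
half-open intervals, which determine it; the change of variable follows. *)
Lemma ge0_integral_lebesgue_shift (f : R -> \bar R) (c : R) :
  measurable_fun [set: R] f -> (forall x, 0 <= f x) ->
  \int[mu]_x f (x + c)%R = \int[mu]_x f x.
Proof.
move=> mf f0.
pose sh := (fun x : measurableTypeR R => (x + c)%R : measurableTypeR R).
have msh : measurable_fun setT sh by exact: measurable_funD.
have := @ge0_integral_pushforward _ _ _ _ R sh msh mu setT f measurableT mf.
rewrite preimage_setT => /(_ (fun y _ => f0 y)) <-.
apply: eq_measure_integral => A mA _.
apply/esym/(@lebesgue_measure_unique R (pushforward mu sh)) => // _ [[a b]] _ <-.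
rewrite [RHS](_ : _ = mu `](a - c)%R, (b - c)%R]%classic); last first.
  by congr (mu _); apply/seteqP; split=> x /=; rewrite !in_itv /= /sh ltrBlDr lerBrDr.
rewrite !lebesgue_measure_itv /= !lte_fin ltrD2r.
by case: ifP => // _; rewrite -!EFinD; congr (_%:E); rewrite opprB addrA subrK.
Qed.

Lemma ge0_integral_lebesgue_opp (f : R -> \bar R) :
  measurable_fun [set: R] f -> (forall x, 0 <= f x) ->
  \int[mu]_x f (- x)%R = \int[mu]_x f x.
Proof.
move=> mf f0.
pose sh := (-%R : measurableTypeR R -> measurableTypeR R).
have msh : measurable_fun setT sh by exact: oppr_measurable.
have := @ge0_integral_pushforward _ _ _ _ R sh msh mu setT f measurableT mf.
rewrite preimage_setT => /(_ (fun y _ => f0 y)) <-.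
by apply: eq_measure_integral => A mA _; exact: lebesgue_measureN.
Qed.

(** Same argument as for translations, for the dilated measure scaled by [k]. *)
Lemma ge0_integral_lebesgue_scale (f : R -> \bar R) (k : R) : (0 < k)%R ->
  measurable_fun [set: R] f -> (forall x, 0 <= f x) ->
  k%:E * \int[mu]_x f (k * x)%R = \int[mu]_x f x.
Proof.
move=> k0 mf f0.
pose sh := (fun x : measurableTypeR R => (k * x)%R : measurableTypeR R).
have msh : measurable_fun setT sh by exact: measurable_funM.
have := @ge0_integral_pushforward _ _ _ _ R sh msh mu setT f measurableT mf.
rewrite preimage_setT => /(_ (fun y _ => f0 y)) <-.
have k0' : (0 <= k)%R by exact: ltW.
rewrite -(@ge0_integral_mscale _ _ _ (pushforward mu sh) _ measurableT (NngNum k0') f mf) //.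
apply: eq_measure_integral => A mA _.
apply/esym/(@lebesgue_measure_unique R (mscale (NngNum k0') (pushforward mu sh))) => // _ [[a b]] _ <-.
rewrite [RHS](_ : _ = k%:E * mu `](k^-1 * a)%R, (k^-1 * b)%R]%classic); last first.
  congr (_ * mu _); apply/seteqP; split=> x /=; rewrite !in_itv /= /sh;
    by rewrite ltr_pdivrMl // ler_pdivlMl.
rewrite !lebesgue_measure_itv /= !lte_fin ltr_pM2l ?invr_gt0 //.
case: ifP => _; last by rewrite mule0.
rewrite -!EFinD -EFinM; congr (_%:E).
by rewrite -mulrBr mulrA mulfV ?mul1r // gt_eqF.
Qed.

End lebesgue_change_of_variable.

Section iterated_integral.
Context {R : realType}.
Notation mu := (@lebesgue_measure R).
Local Open Scope ereal_scope.

Lemma iterated_integral_ge0 n (g : n.-tuple R -> \bar R) :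
  (forall y, 0 <= g y) -> 0 <= iterated_integral g.
Proof.
elim: n g => [|n IH] g g0 /=; first exact: g0.
by apply: integral_ge0 => x _; apply: IH => y.
Qed.

Lemma measurable_param_cons d (D : measurableType d) n :
  measurable_fun setT (fun x : (D * R) * n.-tuple R =>
     (x.1.1, [tuple of x.1.2 :: x.2]) : D * n.+1.-tuple R).
Proof.
apply: measurable_fun_pair.
  by apply: measurableT_comp.
apply: measurable_cons => //.
exact: measurableT_comp.
Qed.

(** The induction moves one coordinate at a time from the integration variable
into the parameter space, whence the arbitrary [D]. *)
Lemma measurable_iterated_integral d (D : measurableType d) n
    (h : D * n.-tuple R -> \bar R) :
  measurable_fun setT h -> (forall z, 0 <= h z) ->
  measurable_fun setT (fun x => iterated_integral (fun y => h (x, y))).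
Proof.
elim: n d D h => [|n IH] d D h mh h0 /=.
  by apply: measurableT_comp => //; exact: measurable_fun_pair.
have := IH _ _ (fun z : (D * measurableTypeR R) * n.-tuple R => h (z.1.1, [tuple of z.1.2 :: z.2])).
move=> /(_ (measurableT_comp mh (@measurable_param_cons _ D n)) (fun=> h0 _)) mF.
apply: (@measurable_fun_fubini_tonelli_F _ _ _ _ _ mu _ mF).
by move=> z; apply: iterated_integral_ge0.
Qed.

Lemma measurable_iterated_integral_cons n (g : n.+1.-tuple R -> \bar R) :
  measurable_fun setT g -> (forall y, 0 <= g y) ->
  measurable_fun [set: R] (fun x => iterated_integral (fun y : n.-tuple R => g [tuple of x :: y])).
Proof.
move=> mg g0.
apply: (@measurable_iterated_integral _ _ n (fun z : R * n.-tuple R => g [tuple of z.1 :: z.2])) => //.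
by apply: measurableT_comp => //; exact: measurable_cons.
Qed.

Lemma measurable_tuple_section n (g : n.+1.-tuple R -> \bar R) x :
  measurable_fun setT g -> measurable_fun setT (fun y : n.-tuple R => g [tuple of x :: y]).
Proof. by move=> mg; apply: measurableT_comp => //; exact: measurable_cons. Qed.

(** Exchange with an extra Lebesgue integral. It lets a kernel of total mass one
be inserted under a Gaussian expectation and integrated last. *)
Lemma iterated_integral_tonelli n (h : R * n.-tuple R -> \bar R) :
  measurable_fun setT h -> (forall z, 0 <= h z) ->
  iterated_integral (fun y => \int[mu]_x h (x, y)) =
  \int[mu]_x iterated_integral (fun y => h (x, y)).
Proof.
elim: n h => [//|n IH] h mh h0 /=.
have mF : measurable_fun setT (fun z : R * R =>
    iterated_integral (fun y : n.-tuple R => h (z.2, [tuple of z.1 :: y]))).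
  apply: (@measurable_iterated_integral _ _ n
      (fun z : (R * R) * n.-tuple R => h (z.1.2, [tuple of z.1.1 :: z.2]))) => //.
  apply: measurableT_comp => //; apply: measurable_fun_pair.
    exact: measurableT_comp.
  apply: measurable_cons => //; exact: measurableT_comp.
rewrite -(fubini_tonelli (m1 := mu) (m2 := mu) _ mF) /=; last by move=> z; exact: iterated_integral_ge0.
apply: eq_integral => z _.
rewrite (IH (fun u : R * n.-tuple R => h (u.1, [tuple of z :: u.2]))) //.
apply: measurableT_comp => //; apply: measurable_fun_pair => //.
exact: measurable_cons.
Qed.

Lemma iterated_integralD n (g h : n.-tuple R -> \bar R) :
  measurable_fun setT g -> measurable_fun setT h ->
  (forall y, 0 <= g y) -> (forall y, 0 <= h y) ->
  iterated_integral (fun y => g y + h y) = iterated_integral g + iterated_integral h.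
Proof.
elim: n g h => [//|n IH] g h mg mh g0 h0 /=.
rewrite -ge0_integralD //.
- apply: eq_integral => x _; apply: IH => //; exact: measurable_tuple_section.
- by move=> x _; exact: iterated_integral_ge0.
- exact: measurable_iterated_integral_cons.
- by move=> x _; exact: iterated_integral_ge0.
- exact: measurable_iterated_integral_cons.
Qed.

Lemma iterated_integralZ n (k : \bar R) (g : n.-tuple R -> \bar R) : 0 <= k ->
  measurable_fun setT g -> (forall y, 0 <= g y) ->
  iterated_integral (fun y => k * g y) = k * iterated_integral g.
Proof.
move=> k0; elim: n g => [//|n IH] g mg g0 /=.
rewrite -ge0_integralZl //.
- apply: eq_integral => x _; apply: IH => //; exact: measurable_tuple_section.
- exact: measurable_iterated_integral_cons.
- by move=> x _; exact: iterated_integral_ge0.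
Qed.

Lemma iterated_integral_le n (g h : n.-tuple R -> \bar R) :
  measurable_fun setT g -> measurable_fun setT h ->
  (forall y, 0 <= g y) -> (forall y, g y <= h y) ->
  iterated_integral g <= iterated_integral h.
Proof.
elim: n g h => [|n IH] g h mg mh g0 gh /=; first exact: gh.
have h0 y : 0 <= h y by exact: le_trans (gh y).
apply: ge0_le_integral => //.
- by move=> x _; exact: iterated_integral_ge0.
- exact: measurable_iterated_integral_cons.
- exact: measurable_iterated_integral_cons.
- by move=> x _; apply: IH => //; exact: measurable_tuple_section.
Qed.

Definition tuple_shift n (c : 'I_n -> R) (y : n.-tuple R) : n.-tuple R :=
  [tuple (tnth y k + c k)%R | k < n].

Lemma measurable_tuple_shift n (c : 'I_n -> R) : measurable_fun setT (tuple_shift c).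
Proof.
apply/measurable_fun_tnthP => i.
rewrite (_ : _ \o _ = (fun y => (tnth y i + c i)%R)); last first.
  by apply/funext => y /=; rewrite tnth_mktuple.
by apply: measurable_funD => //; exact: measurable_tnth.
Qed.

Lemma tuple_shift_cons n (c : 'I_n.+1 -> R) x (y : n.-tuple R) :
  tuple_shift c [tuple of x :: y] =
  [tuple of (x + c ord0)%R :: tuple_shift (c \o lift ord0) y].
Proof.
apply: eq_from_tnth => k; rewrite tnth_mktuple.
case: (unliftP ord0 k) => [l ->|->]; last by rewrite !tnth0.
by rewrite !tnthS tnth_mktuple.
Qed.

Lemma iterated_integral_shift n (c : 'I_n -> R) (g : n.-tuple R -> \bar R) :
  measurable_fun setT g -> (forall y, 0 <= g y) ->
  iterated_integral (g \o tuple_shift c) = iterated_integral g.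
Proof.
elim: n c g => [|n IH] c g mg g0 /=.
  by congr g; apply: eq_from_tnth => -[].
rewrite -[RHS](@ge0_integral_lebesgue_shift R _ (c ord0)); first last.
- by move=> x; exact: iterated_integral_ge0.
- exact: measurable_iterated_integral_cons.
apply: eq_integral => x _.
rewrite -(IH (c \o lift ord0) (fun y => g [tuple of (x + c ord0)%R :: y])) //.
  by congr iterated_integral; apply/funext => y /=; rewrite tuple_shift_cons.
exact: measurable_tuple_section.
Qed.

End iterated_integral.

(** * Gaussian expectations of functions of two coordinates *)

Section gaussian.
Context {R : realType} {p : nat} (S : 'M[R]_p) (hS : pos_def S).

Lemma pos_def_unitmx : S \in unitmx.
Proof.
rewrite -row_free_unit -kermx_eq0; apply/rowV0P => v /sub_kermxP vS.
apply/eqP/negPn/negP => v0; have [_ /(_ v v0)] := hS.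
by rewrite vS mul0mx mxE ltxx.
Qed.

Lemma measurable_gauss_pdf : measurable_fun setT (gauss_pdf S).
Proof.
apply: measurable_funM => //; apply: measurableT_comp => //.
apply: measurable_funM => //; apply: measurableT_comp => //.
rewrite [X in measurable_fun _ X](_ : _ = fun y : p.-tuple R =>
    \sum_k (\sum_l tnth y l * invmx S l k) * tnth y k); last first.
  apply/funext => y; rewrite !mxE; apply: eq_bigr => k _.
  by rewrite !mxE; congr (_ * _); apply: eq_bigr => l _; rewrite !mxE.
apply: measurable_sum => k; apply: measurable_funM; last exact: measurable_tnth.
apply: measurable_sum => l; apply: measurable_funM => //; exact: measurable_tnth.
Qed.

Lemma gauss_pdf_ge0 y : 0 <= gauss_pdf S y.
Proof. by rewrite divr_ge0 ?expR_ge0 ?sqrtr_ge0. Qed.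

(** Translating by [a S] is the Cameron-Martin direction of [a]: the quadratic
form produces the linear term [a y], in which [S] no longer appears. *)
Lemma gauss_pdf_shift (a : 'rV[R]_p) (y : p.-tuple R) :
  gauss_pdf S (tuple_shift (fun k => - (a *m S) 0 k) y) =
  gauss_pdf S y *
    expR ((a *m (row_of_tuple y)^T) 0 0 - (a *m S *m a^T) 0 0 / 2).
Proof.
have [SS _] := hS; have uS := pos_def_unitmx.
rewrite /gauss_pdf [RHS]mulrAC -expRD; congr (expR _ / _).
have -> : row_of_tuple (tuple_shift (fun k => - (a *m S) 0 k) y) =
    row_of_tuple y - a *m S.
  by apply/rowP => k; rewrite [RHS]mxE [X in _ = X + _]mxE [X in _ = _ + X]mxE mxE tnth_mktuple.
set r := row_of_tuple y; set Q := invmx S.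
have -> : (r - a *m S) *m Q *m (r - a *m S)^T =
    r *m Q *m r^T - a *m r^T - r *m a^T + a *m S *m a^T.
  rewrite linearB /= trmx_mul SS !mulmxBl !mulmxBr /Q mulmxK //.
  rewrite mulmxA mulmxKV // opprD opprK -!addrA; congr (_ + _).
  by rewrite addrCA !mulmxA.
have -> : r *m a^T = a *m r^T.
  by rewrite -[LHS]trmxK trmx_mul trmxK; apply/matrixP => u v; rewrite !mxE !ord1.
by rewrite !mxE; field.
Qed.

Local Open Scope ereal_scope.

Lemma cameron_martin (a : 'rV[R]_p) (g : p.-tuple R -> \bar R) :
  measurable_fun setT g -> (forall y, 0 <= g y) ->
  iterated_integral (fun y => g (tuple_shift (fun k => (a *m S)%R 0%R k) y) * (gauss_pdf S y)%:E) =
  iterated_integral (fun y => g y *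
    (gauss_pdf S y * expR ((a *m (row_of_tuple y)^T) 0 0 - (a *m S *m a^T) 0 0 / 2))%R%:E).
Proof.
move=> mg g0.
rewrite -(iterated_integral_shift (fun k => - (a *m S) 0 k)%R); last 2 first.
- apply: emeasurable_funM.
    by apply: measurableT_comp => //; exact: measurable_tuple_shift.
  by apply/measurable_EFinP; exact: measurable_gauss_pdf.
- by move=> y; rewrite mule_ge0 // lee_fin gauss_pdf_ge0.
congr iterated_integral; apply/funext => y /=; rewrite gauss_pdf_shift.
congr (g _ * _); apply: eq_from_tnth => k; rewrite !tnth_mktuple; lra.
Qed.

Variables (i j : 'I_p) (hii : S i i = 1%R) (hjj : S j j = 1%R).

(** [E h(Y_i, Y_j)] for [Y] of law N(0, S), without the two-dimensional
marginal: the whole density is kept under the integral. *)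
Definition gaussE (h : R * R -> \bar R) : \bar R :=
  iterated_integral (fun y : p.-tuple R => h (tnth y i, tnth y j) * (gauss_pdf S y)%:E).

Lemma measurable_tnth_pair : measurable_fun setT (fun y : p.-tuple R => (tnth y i, tnth y j)).
Proof. by apply: measurable_fun_pair; exact: measurable_tnth. Qed.

Lemma measurable_gaussE_integrand (h : R * R -> \bar R) : measurable_fun setT h ->
  measurable_fun setT (fun y : p.-tuple R => h (tnth y i, tnth y j) * (gauss_pdf S y)%:E).
Proof.
move=> mh; apply: emeasurable_funM.
  by apply: measurableT_comp => //; exact: measurable_tnth_pair.
by apply/measurable_EFinP; exact: measurable_gauss_pdf.
Qed.

Lemma gaussE_integrand_ge0 (h : R * R -> \bar R) : (forall z, 0 <= h z) ->
  forall y : p.-tuple R, 0 <= h (tnth y i, tnth y j) * (gauss_pdf S y)%:E.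
Proof. by move=> h0 y; rewrite mule_ge0 // lee_fin gauss_pdf_ge0. Qed.

Lemma gaussE_ge0 (h : R * R -> \bar R) : (forall z, 0 <= h z) -> 0 <= gaussE h.
Proof. by move=> h0; apply: iterated_integral_ge0; exact: gaussE_integrand_ge0. Qed.

Lemma gaussED (g h : R * R -> \bar R) :
  measurable_fun setT g -> measurable_fun setT h ->
  (forall y, 0 <= g y) -> (forall y, 0 <= h y) ->
  gaussE (fun z => g z + h z) = gaussE g + gaussE h.
Proof.
move=> mg mh g0 h0; rewrite /gaussE -iterated_integralD.
- by congr iterated_integral; apply/funext => y; rewrite ge0_muleDl.
- exact: measurable_gaussE_integrand.
- exact: measurable_gaussE_integrand.
- exact: gaussE_integrand_ge0.
- exact: gaussE_integrand_ge0.
Qed.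

Lemma gaussEZ (k : \bar R) (g : R * R -> \bar R) : 0 <= k ->
  measurable_fun setT g -> (forall y, 0 <= g y) ->
  gaussE (fun z => k * g z) = k * gaussE g.
Proof.
move=> k0 mg g0; rewrite /gaussE -iterated_integralZ //.
- by congr iterated_integral; apply/funext => y; rewrite muleA.
- exact: measurable_gaussE_integrand.
- exact: gaussE_integrand_ge0.
Qed.

Lemma gaussE_le (g h : R * R -> \bar R) :
  measurable_fun setT g -> measurable_fun setT h ->
  (forall y, 0 <= g y) -> (forall y, g y <= h y) ->
  gaussE g <= gaussE h.
Proof.
move=> mg mh g0 gh; apply: iterated_integral_le.
- exact: measurable_gaussE_integrand.
- exact: measurable_gaussE_integrand.
- exact: gaussE_integrand_ge0.
- by move=> y; rewrite lee_wpmul2r // lee_fin gauss_pdf_ge0.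
Qed.

Lemma gaussE_tonelli (h : R * (R * R) -> \bar R) :
  measurable_fun setT h -> (forall z, 0 <= h z) ->
  gaussE (fun z => \int[lebesgue_measure]_x h (x, z)) =
  \int[lebesgue_measure]_x gaussE (fun z => h (x, z)).
Proof.
move=> mh h0; rewrite /gaussE.
rewrite -(iterated_integral_tonelli (h := fun u : R * p.-tuple R =>
    h (u.1, (tnth u.2 i, tnth u.2 j)) * (gauss_pdf S u.2)%:E)).
- congr iterated_integral; apply/funext => y /=.
  rewrite ge0_integralZr //.
    by apply: measurableT_comp => //; exact: measurable_fun_pair.
  by rewrite lee_fin gauss_pdf_ge0.
- apply: emeasurable_funM.
    apply: measurableT_comp => //; apply: measurable_fun_pair => //.
    by apply: (measurableT_comp measurable_tnth_pair).
  apply/measurable_EFinP; exact: (measurableT_comp measurable_gauss_pdf).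
- by move=> z; rewrite mule_ge0 // lee_fin gauss_pdf_ge0.
Qed.

(** For a direction [a] supported on [i] and [j], the Cameron-Martin factor only
depends on the coordinates [i] and [j]. All values of
Gaussian expectations below come from this identity and from the total
mass. *)
Lemma gaussE_shift (h : R * R -> \bar R) (a b : R) :
  measurable_fun setT h -> (forall z, 0 <= h z) ->
  gaussE (fun z => h (z.1 + (a + b * S i j), z.2 + (a * S i j + b))%R) =
  gaussE (fun z => h z *
    (expR (a * z.1 + b * z.2 - (a ^+ 2 + 2 * a * b * S i j + b ^+ 2) / 2))%:E).
Proof.
move=> mh h0; have [SS _] := hS.
have Sji : S j i = S i j by rewrite -[in LHS]SS mxE.
pose u : 'rV[R]_p := (a *: delta_mx 0 i + b *: delta_mx 0 j)%R.
have uS k : (u *m S) 0%R k = (a * S i k + b * S j k)%R.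
  by rewrite /u mulmxDl -!scalemxAl -!rowE !mxE.
have uv (v : 'rV[R]_p) : (u *m v^T) 0%R 0%R = (a * v 0 i + b * v 0 j)%R.
  by rewrite /u mulmxDl -!scalemxAl -!rowE !mxE.
have := @cameron_martin u (fun y => h (tnth y i, tnth y j)).
move=> /(_ (measurableT_comp mh measurable_tnth_pair) (fun=> h0 _)) E.
rewrite /gaussE.
transitivity (iterated_integral
   (fun y => h (tnth (tuple_shift (fun k => (u *m S)%R 0%R k) y) i,
     tnth (tuple_shift (fun k => (u *m S)%R 0%R k) y) j) * (gauss_pdf S y)%:E)).
  congr iterated_integral; apply/funext => y; rewrite !tnth_mktuple /= !uS Sji hii hjj !mulr1 //.
rewrite E; congr iterated_integral; apply/funext => y.
rewrite -muleA -EFinM; congr (_ * (_)%:E); rewrite mulrC; congr (expR _ * _)%R.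
have rE k : row_of_tuple y 0%R k = tnth y k by rewrite mxE.
rewrite uv !rE /=; congr (_ - _ / _)%R.
have -> : (u *m S *m u^T)%R 0%R 0%R = (u *m (u *m S)^T)%R 0%R 0%R.
  by rewrite trmx_mul SS mulmxA.
by rewrite uv !uS hii hjj Sji; ring.
Qed.

End gaussian.

(** * The Gaussian quadrant integral *)

Section quadrant.
Context {R : realType}.
Notation mu := (@lebesgue_measure R).

(** Up to a constant, the expectation of [phi(Z - s) phi(Z' - t)] for a
Gaussian pair of correlation [r]: a centred Gaussian of covariance
[[2, r], [r, 2]] in (s, t). *)
Definition quad_exp (r : R) (s t : R) : R :=
  expR (- ((s ^+ 2 - r * s * t + t ^+ 2) / (4 - r ^+ 2))).

Lemma quad_exp_ge0 r s t : 0 <= quad_exp r s t.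
Proof. exact: expR_ge0. Qed.

Lemma measurable_quad_exp r : measurable_fun setT (fun z : R * R => quad_exp r z.1 z.2).
Proof.
apply: measurableT_comp => //; apply: measurableT_comp => //.
apply: measurable_funM => //; apply: measurable_funD; last exact: measurable_funX.
apply: measurable_funB; first exact: measurable_funX.
by apply: measurable_funM => //; exact: measurable_funM.
Qed.

Lemma measurable_quad_expr r s : measurable_fun [set: R] (quad_exp r s).
Proof. exact: (measurableT_comp (measurable_quad_exp r) (pair1_measurable s)). Qed.

Lemma quad_expN r s t : quad_exp r s (- t) = quad_exp (- r) s t.
Proof. by rewrite /quad_exp !sqrrN mulrN !mulNr. Qed.

Lemma quad_expNN r s t : quad_exp r (- s) (- t) = quad_exp r s t.
Proof. by rewrite quad_expN /quad_exp !sqrrN mulrNN. Qed.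

Definition step : R -> R := \1_`]0, +oo[.

Lemma stepE x : step x = (0 < x)%R%:R.
Proof. by rewrite /step indicE (_ : (x \in _) = (0 < x)%R) // mem_setE in_itv /= andbT. Qed.

Lemma step_ge0 x : 0 <= step x. Proof. by rewrite stepE ler0n. Qed.

Lemma measurable_step : measurable_fun setT step.
Proof. exact: measurable_indic. Qed.

Local Open Scope ereal_scope.

Lemma integral_step (f : R -> R) : measurable_fun setT f ->
  \int[mu]_x (step x * f x)%:E = \int[mu]_(x in `[0%R, +oo[) (f x)%:E.
Proof.
move=> mf; rewrite -integral_itv_obnd_cbnd; last first.
  exact/measurable_funTS/measurable_EFinP.
rewrite [RHS]integral_mkcond epatch_indic; apply: eq_integral => x _.
by rewrite mulrC EFinM.
Qed.

(** The line is the positive half-line and the reflection of the nonnegative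
one; the point 0 is negligible. *)
Lemma integral_split_sign (f : R -> \bar R) : measurable_fun setT f -> (forall x, 0 <= f x) ->
  \int[mu]_x f x =
  \int[mu]_x ((step x)%:E * f x) + \int[mu]_x ((step x)%:E * f (- x)%R).
Proof.
move=> mf f0; have mh := measurable_step.
have mE : measurable_fun setT (fun x : R => (step x)%:E) by exact/measurable_EFinP.
have hE x : 0 <= (step x)%:E by rewrite lee_fin step_ge0.
have mfN : measurable_fun [set: R] (fun x => f (- x)%R) by exact: measurableT_comp.
have -> : \int[mu]_x ((step x)%:E * f (- x)%R) = \int[mu]_x (f (- x)%R * (\1_`[0, +oo[%classic x)%:E).
  transitivity (\int[mu]_(x in `]0%R, +oo[) f (- x)%R).
    rewrite [RHS]integral_mkcond epatch_indic; apply: eq_integral => x _.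
    by rewrite muleC.
  rewrite integral_itv_obnd_cbnd; last exact: measurable_funTS.
  by rewrite [LHS]integral_mkcond epatch_indic.
rewrite -[X in _ + X]ge0_integral_lebesgue_opp; last 2 first.
- apply: emeasurable_funM => //.
  exact/measurable_EFinP/measurable_indic.
- by move=> x; rewrite mule_ge0 // lee_fin.
rewrite -ge0_integralD //; last 4 first.
- by move=> x _; rewrite mule_ge0.
- exact: emeasurable_funM.
- by move=> x _; rewrite mule_ge0 // lee_fin.
- apply: emeasurable_funM; first exact: (measurableT_comp mfN).
  apply/measurable_EFinP.
  apply: (measurableT_comp (f := (\1_`[0, +oo[ : R -> R)%R)) => //.
apply: eq_integral => x _; rewrite opprK.
rewrite stepE indicE (_ : (_ \in _) = (0 <= - x)%R); last by rewrite mem_setE in_itv /= andbT.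
by rewrite oppr_ge0; case: (ltP 0%R x) => _; rewrite /= ?(mule0, mul0e, mul1e, mule1, adde0, add0e).
Qed.

Definition quadrant (r : R) : \bar R :=
  \int[mu]_s \int[mu]_t (step s * step t * quad_exp r s t)%:E.

(** The primitive is [- exp(- q s^2) / (2 q)]; the factor [s] is the Jacobian of
the substitution [t = s x]. *)
Lemma integral_radial (q : R) : (0 < q)%R ->
  \int[mu]_(s in `[0%R, +oo[) (s * expR (- (q * s ^+ 2)))%:E = ((2 * q)^-1)%:E.
Proof.
move=> q0.
pose F (s : R) : R := (- (2 * q)^-1 * expR (- (q * s ^+ 2)))%R.
have dF (x : R) : is_derive x (1 : R)%R F (x * expR (- (q * x ^+ 2)))%R.
  rewrite /F; apply: is_derive_eq.
  rewrite /GRing.scale /=.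
  have q0' : (q != 0)%R by rewrite gt_eqF.
  by field.
have cF (x : R) : {for x, continuous F}.
  by apply: differentiable_continuous; apply/derivable1_diffP; apply: ex_derive.
rewrite (@ge0_continuous_FTC2y _ _ F 0%R 0%R).
- by rewrite /F expr0n /= mulr0 oppr0 expR0 mulr1 -EFinB sub0r opprK.
- by move=> x x0; rewrite mulr_ge0 // expR_ge0.
- apply: continuous_subspaceT => x.
  apply: (@differentiable_continuous _ R^o R^o); apply/derivable1_diffP; apply: ex_derive.
- rewrite /F -[X in _ --> X](mulr0 (- (2 * q)^-1)%R).
  apply: cvgM; first exact: cvg_cst.
  apply: (cvg_comp (fun x => q * x ^+ 2)%R (fun x => expR (- x))); last exact: cvgr_expR.
  by apply: gt0_cvgMry => //; exact: cvgr_expr2.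
- by move=> x x0; exact: ex_derive.
- by apply: cvg_at_right_filter; exact: cF.
- by move=> x _; rewrite derive1E; exact: derive_val.
Qed.

(** Completing the square, the form is [d^2 + (x - r / 2)^2]. *)
Lemma quad_pos (r d x : R) : (0 < d -> d ^+ 2 = 1 - (r / 2) ^+ 2 -> 0 < 1 - r * x + x ^+ 2)%R.
Proof.
move=> d0 hd.
have -> : (1 - r * x + x ^+ 2 = d ^+ 2 + (x - r / 2) ^+ 2)%R by rewrite hd; field.
by rewrite ltr_pwDl ?sqr_ge0 // exprn_gt0.
Qed.

Lemma continuous_quad_inv (r d : R) : (0 < d)%R -> (d ^+ 2 = 1 - (r / 2) ^+ 2)%R ->
  continuous (fun x : R => (1 - r * x + x ^+ 2)^-1 : R)%R.
Proof.
move=> d0 hd x; apply: cvgV; first by rewrite gt_eqF // (quad_pos _ d0 hd).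
have : {for x, continuous (fun x0 : R => 1 - r * x0 + x0 ^+ 2 : R)%R}.
  by apply: (@differentiable_continuous _ R^o R^o); apply/derivable1_diffP; apply: ex_derive.
exact.
Qed.

(** The primitive is an arctangent, of argument [(x - r / 2) / d]. *)
Lemma integral_rational (r d : R) : (0 < d)%R -> (d ^+ 2 = 1 - (r / 2) ^+ 2)%R ->
  \int[mu]_(x in `[0%R, +oo[) ((1 - r * x + x ^+ 2)^-1)%:E =
  ((pi / 2 + atan (r / 2 / d)) / d)%:E.
Proof.
move=> d0 hd.
have q0 x := quad_pos x d0 hd.
have d0' : (d != 0)%R by rewrite gt_eqF.
pose F (x : R) : R := (d^-1 * atan (d^-1 * (x - r / 2)))%R.
have dF (x : R) : is_derive x (1 : R)%R F (1 - r * x + x ^+ 2)^-1%R.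
  rewrite /F; apply: is_derive_eq.
  rewrite /GRing.scale /=.
  have q0' := lt0r_neq0 (q0 x).
  have E : (1 - r * x + x ^+ 2 = d ^+ 2 * (1 + (d^-1 * (x - r / 2)) ^+ 2))%R.
    by rewrite mulrDr mulr1 exprMn mulrA -exprMn mulfV // expr1n mul1r hd; field.
  rewrite E in q0' *.
  move: q0'; rewrite mulf_eq0 negb_or => /andP[_ q1].
  set w := (1 + _ ^+ 2)%R in q1 *.
  rewrite subr0 !mulr1.
  by field; rewrite q1.
have cF (x : R) : {for x, continuous F}.
  by apply: differentiable_continuous; apply/derivable1_diffP; apply: ex_derive.
rewrite (@ge0_continuous_FTC2y _ _ F 0%R (d^-1 * (pi / 2))%R).
- rewrite /F -EFinB; congr (_%:E); rewrite sub0r mulrN atanN.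
  by rewrite mulrN opprK -mulrDr mulrC (mulrC d^-1 (r / 2))%R.
- by move=> x x0; rewrite invr_ge0 ltW.
- apply: continuous_subspaceT; exact: continuous_quad_inv d0 hd.
- apply: cvgM; first exact: cvg_cst.
  apply: (cvg_comp (fun x => d^-1 * (x - r / 2))%R); last exact: cvgy_atan.
  by apply: gt0_cvgMry; [rewrite invr_gt0|exact: cvg_addrr].
- by move=> x x0; exact: ex_derive.
- by apply: cvg_at_right_filter; exact: cF.
- by move=> x _; rewrite derive1E; exact: derive_val.
Qed.

(** In the coordinates [(s, x)] with [t = s x] the exponent is [s^2] times a
function of [x], so the [s]-integral is [integral_radial] and leaves the
rational function of [integral_rational]. *)
Lemma quadrantE (r d : R) : (0 < d)%R -> (d ^+ 2 = 1 - (r / 2) ^+ 2)%R ->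
  quadrant r = (2 * d * (pi / 2 + atan (r / 2 / d)))%:E.
Proof.
move=> d0 hd.
have q0 x := quad_pos x d0 hd.
have mh := measurable_step.
have k0 : (0 < 4 - r ^+ 2)%R.
  have -> : (4 - r ^+ 2 = 4 * d ^+ 2)%R by rewrite hd; field.
  by rewrite mulr_gt0 // exprn_gt0.
pose q x := ((1 - r * x + x ^+ 2) / (4 - r ^+ 2))%R.
have q1 x : (0 < q x)%R by rewrite divr_gt0.
pose k (s x : R) := (s * expR (- (q x * s ^+ 2)))%R.
have mq : measurable_fun [set: R] (fun x => 1 - r * x + x ^+ 2)%R.
  apply: measurable_funD; last exact: measurable_funX.
  by apply: measurable_funB => //; exact: measurable_funM.
have mk : measurable_fun setT (fun z : R * R => (step z.1 * step z.2 * k z.1 z.2)%:E).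
  apply/measurable_EFinP; apply: measurable_funM.
    by apply: measurable_funM; apply: (measurableT_comp mh).
  apply: measurable_funM => //.
  apply: measurableT_comp => //; apply: measurableT_comp => //.
  apply: measurable_funM; last exact: measurable_funX.
  apply: measurable_funM => //; exact: (measurableT_comp mq).
have kstep z : (0 <= step z.1 * step z.2 * k z.1 z.2)%R.
  rewrite !stepE /k; case: (ltP 0%R z.1) => /= h1; last by rewrite !mul0r.
  by rewrite !mulr_ge0 ?expR_ge0 // ltW.
transitivity (\int[mu]_s \int[mu]_x (step s * step x * k s x)%:E).
  apply: eq_integral => s _.
  have [s0|s0] := ltP 0%R s; last first.
    by apply: eq_integral => t _; rewrite stepE ltNge s0 !mul0r.
  rewrite -(ge0_integral_lebesgue_scale s0); last 2 first.
  - apply/measurable_EFinP; apply: measurable_funM; last exact: measurable_quad_expr.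
    by apply: measurable_funM.
  - by move=> x; rewrite lee_fin !mulr_ge0 ?step_ge0 ?quad_exp_ge0.
  rewrite -ge0_integralZl; [ |exact: measurableT| | |by rewrite lee_fin ltW]; last first.
  - by move=> x _; rewrite lee_fin !mulr_ge0 ?step_ge0 ?quad_exp_ge0.
  - apply/measurable_EFinP; apply: measurable_funM.
      apply: measurable_funM => //; apply: (measurableT_comp mh).
      exact: measurable_funM.
    apply: (measurableT_comp (measurable_quad_expr r s)).
    exact: measurable_funM.
  apply: eq_integral => x _; rewrite -EFinM; congr _%:E.
  have -> : step (s * x) = step x by rewrite !stepE pmulr_rgt0.
  have -> : quad_exp r s (s * x) = expR (- (q x * s ^+ 2)).
    congr (expR (- _)); rewrite /q [RHS]mulrAC; congr (_ / _)%R.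
    by ring.
  by rewrite /k; ring.
have k0E z : 0 <= (step z.1 * step z.2 * k z.1 z.2)%:E by rewrite lee_fin.
have /= -> := fubini_tonelli (m1 := mu) (m2 := mu) _ mk k0E.
have mr : measurable_fun [set: R] (fun x => (1 - r * x + x ^+ 2)^-1)%R.
  by apply: continuous_measurable_fun; exact: continuous_quad_inv d0 hd.
transitivity (\int[mu]_x (((4 - r ^+ 2) / 2)%:E * (step x * (1 - r * x + x ^+ 2)^-1)%:E)).
  apply: eq_integral => x _.
  transitivity ((step x)%:E * \int[mu]_s (step s * k s x)%:E).
    rewrite -ge0_integralZl ?lee_fin ?step_ge0 //.
    + by apply: eq_integral => s _; rewrite -EFinM; congr _%:E; rewrite [RHS]mulrCA [RHS]mulrA.
    + apply/measurable_EFinP; apply: measurable_funM => //.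
      apply: measurable_funM => //; apply: measurableT_comp => //.
      apply: measurableT_comp => //; apply: measurable_funM => //; exact: measurable_funX.
    + move=> s _; rewrite /= !stepE lee_fin /k.
      case: (ltP 0%R s) => /= h1; last by rewrite !mul0r.
      by rewrite mul1r mulr_ge0 ?expR_ge0 // ltW.
  rewrite integral_step; last first.
    apply: measurable_funM => //; apply: measurableT_comp => //.
    apply: measurableT_comp => //; apply: measurable_funM => //; exact: measurable_funX.
  rewrite integral_radial //.
  rewrite -!EFinM; congr _%:E.
  have := lt0r_neq0 (q0 x); have := lt0r_neq0 k0 => a0 b0; rewrite /q; field.
  by rewrite a0 b0.
rewrite ge0_integralZl //; last 3 first.
- by apply/measurable_EFinP; exact: measurable_funM.
- by move=> x _; rewrite lee_fin mulr_ge0 ?step_ge0 // invr_ge0 ltW.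
- by rewrite lee_fin divr_ge0 // ltW.
rewrite integral_step // (integral_rational d0 hd) -EFinM; congr _%:E.
have -> : (4 - r ^+ 2 = 4 * d ^+ 2)%R by rewrite hd; field.
by have d0' := lt0r_neq0 d0; field.
Qed.

(** The plane consists of two quadrants of parameter [r] and two of parameter
[- r], whose arctangents cancel. *)
Lemma integral_quad_exp (r d : R) : (0 < d)%R -> (d ^+ 2 = 1 - (r / 2) ^+ 2)%R ->
  \int[mu]_s \int[mu]_t (quad_exp r s t)%:E = (4 * d * pi)%:E.
Proof.
move=> d0 hd.
have hdN : (d ^+ 2 = 1 - (- r / 2) ^+ 2)%R by rewrite mulNr sqrrN.
have mh := measurable_step.
have mQ a : measurable_fun setT (fun z : R * R => (step z.2 * quad_exp a z.1 z.2)%:E).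
  apply/measurable_EFinP/measurable_funM; last exact: measurable_quad_exp.
  exact: (measurableT_comp mh).
have Q0 a z : 0 <= (step z.2 * quad_exp a z.1 z.2)%:E.
  by rewrite lee_fin mulr_ge0 ?step_ge0 ?quad_exp_ge0.
pose f a (s : R) := \int[mu]_t (step t * quad_exp a s t)%:E.
have mf a : measurable_fun setT (f a).
  exact: (measurable_fun_fubini_tonelli_F (m2 := mu) _ (mQ a)).
have f0 a s : 0 <= f a s by apply: integral_ge0 => t _; exact: (Q0 a (s, t)).
have ff a s : f a (- s)%R = f (- a)%R s.
  by apply: eq_integral => t _; rewrite -quad_expN -[in RHS](quad_expNN a s) !opprK.
have E1 s : \int[mu]_t (quad_exp r s t)%:E = f r s + f (- r)%R s.
  rewrite integral_split_sign.
  - rewrite /f; congr (_ + _); apply: eq_integral => t _; by rewrite EFinM // quad_expN.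
  - by apply/measurable_EFinP; exact: measurable_quad_expr.
  - by move=> t; rewrite lee_fin quad_exp_ge0.
under eq_integral do rewrite E1.
rewrite ge0_integralD //; [|exact: mf|exact: mf].
have E2 a : \int[mu]_s ((step s)%:E * f a s) = quadrant a.
  apply: eq_integral => s _; rewrite /f -ge0_integralZl //.
  - by apply: eq_integral => t _; rewrite -EFinM mulrA.
  - apply/measurable_EFinP/measurable_funM => //; exact: measurable_quad_expr.
  - by move=> t _; exact: (Q0 a (s, t)).
  - by rewrite lee_fin step_ge0.
have E3 a : \int[mu]_s f a s = quadrant a + quadrant (- a)%R.
  rewrite integral_split_sign // E2; congr (_ + _); rewrite -E2.
  by apply: eq_integral => s _; rewrite ff.
rewrite !E3 // opprK !(quadrantE d0) // -!EFinD; congr _%:E.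
by rewrite !mulNr atanN; field.
Qed.

End quadrant.

(** * The mean of the product of two normal distribution functions *)

Section std_pdf.
Context {R : realType}.
Notation mu := (@lebesgue_measure R).

Definition std_pdf (x : R) : R := normal_pdf 0 1 x.

Lemma std_pdfE x : std_pdf x = normal_peak 1 * expR (- (x ^+ 2 / 2)).
Proof.
rewrite /std_pdf normal_pdfE ?oner_neq0 //; congr (_ * expR _).
by rewrite subr0 expr1n mulNr.
Qed.

Lemma std_pdf_ge0 x : 0 <= std_pdf x. Proof. exact: normal_pdf_ge0. Qed.

Lemma measurable_std_pdf : measurable_fun setT std_pdf.
Proof. exact: measurable_normal_pdf. Qed.

(** The density is bounded by 1, so an interval of length 1 / N has mass at most
1 / N. *)
Lemma std_pdf_le1 x : std_pdf x <= 1.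
Proof.
apply: le_trans (normal_pdf_ub 0 x (oner_neq0 R)) _.
have p2 : 1 <= pi *+ 2 :> R by have := pi_ge2 R; rewrite -mulr_natr; lra.
rewrite /normal_peak expr1n mul1r invf_le1 ?sqrtr_gt0 ?(lt_le_trans _ p2) //.
by rewrite -[leLHS]sqrtr1 ler_sqrt // (le_trans _ p2).
Qed.

Lemma std_pdfD x a : std_pdf (x + a) = std_pdf x * expR (- (a * x + a ^+ 2 / 2)).
Proof. by rewrite !std_pdfE -[RHS]mulrA -expRD; congr (_ * expR _); field. Qed.

Lemma std_pdfN x : std_pdf (- x) = std_pdf x.
Proof. by rewrite !std_pdfE sqrrN. Qed.

Local Open Scope ereal_scope.

Lemma integral_std_pdf_shift a : \int[mu]_x (std_pdf (a + x))%:E = 1.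
Proof.
under eq_integral do rewrite addrC.
rewrite (@ge0_integral_lebesgue_shift R (EFin \o std_pdf)).
- exact: integral_normal_pdf.
- by apply/measurable_EFinP; exact: measurable_std_pdf.
- by move=> x; rewrite lee_fin std_pdf_ge0.
Qed.

End std_pdf.

Section gauss_marginal.
Context {R : realType} {p : nat} (S : 'M[R]_p) (hS : pos_def S).
Variables (i j : 'I_p) (hii : S i i = 1) (hjj : S j j = 1).
Hypothesis mass1 : iterated_integral (fun y : p.-tuple R => (gauss_pdf S y)%:E) = 1%E.
Notation mu := (@lebesgue_measure R).
Notation E := (gaussE S i j).
Local Open Scope ereal_scope.

Lemma gaussE_cst (c : \bar R) : 0 <= c -> E (fun=> c) = c.
Proof.
move=> c0.
transitivity (c * E (fun=> 1)).
  rewrite -gaussEZ //.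
  by congr gaussE; apply/funext => z; rewrite mule1.
rewrite /gaussE.
transitivity (c * iterated_integral (fun y : p.-tuple R => (gauss_pdf S y)%:E)).
  by congr (_ * iterated_integral _); apply/funext => y; rewrite mul1e.
by rewrite mass1 mule1.
Qed.

(** A coordinate is standard normal. Insert [1 = int phi(z_i - x) dx] and
exchange the integrals. The Cameron-Martin translation by [x] in the direction
[i] turns [g(z_i) phi(z_i - x)] into [(g phi)(z_i + x)], whose integral over
[x] does not depend on [z_i]. *)
Lemma gaussE_marginal (g : R -> \bar R) : measurable_fun setT g -> (forall x, 0 <= g x) ->
  E (fun z => g z.1) = \int[mu]_x (g x * (std_pdf x)%:E).
Proof.
move=> mg g0.
have mphi := @measurable_std_pdf R.
have mw : measurable_fun setT (fun u : R * (R * R) => g u.2.1 * (std_pdf (u.2.1 - u.1))%:E).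
  apply: emeasurable_funM; first by apply: (measurableT_comp mg); exact: measurableT_comp.
  apply/measurable_EFinP/(measurableT_comp mphi)/measurable_funB => //.
  exact: measurableT_comp.
have mv : measurable_fun setT (fun u : R * (R * R) => g (u.2.1 + u.1)%R * (std_pdf (u.2.1 + u.1))%:E).
  have ma : measurable_fun setT (fun u : R * (R * R) => u.2.1 + u.1)%R.
    by apply: measurable_funD => //; exact: measurableT_comp.
  by apply: emeasurable_funM; [exact: (measurableT_comp mg)|apply/measurable_EFinP/(measurableT_comp mphi)].
have mgp : measurable_fun setT (fun x => g x * (std_pdf x)%:E).
  by apply: emeasurable_funM => //; exact/measurable_EFinP.
have gp0 x : 0 <= g x * (std_pdf x)%:E by rewrite mule_ge0 // lee_fin std_pdf_ge0.
transitivity (E (fun z => \int[mu]_x (g z.1 * (std_pdf (z.1 - x))%:E))).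
  congr gaussE; apply/funext => z.
  rewrite ge0_integralZl //.
  - under eq_integral do rewrite -std_pdfN opprB addrC.
    by rewrite integral_std_pdf_shift mule1.
  - apply/measurable_EFinP/(measurableT_comp mphi); exact: measurable_funB.
  - by move=> x _; rewrite lee_fin std_pdf_ge0.
rewrite (gaussE_tonelli S i j mw) /=; last by move=> u; rewrite mule_ge0 // lee_fin std_pdf_ge0.
transitivity (\int[mu]_x E (fun z => g (z.1 + x)%R * (std_pdf (z.1 + x))%:E)).
  apply: eq_integral => x _.
  have := @gaussE_shift _ _ S hS i j hii hjj (fun z => g z.1 * (std_pdf z.1)%:E) x 0%R.
  have m1 : measurable_fun setT (fun z : R * R => g z.1 * (std_pdf z.1)%:E) by exact: (measurableT_comp mgp).
  move=> /(_ m1 (fun z => gp0 z.1)) /= H.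
  transitivity (E (fun z => g (z.1 + (x + 0 * S i j))%R * (std_pdf (z.1 + (x + 0 * S i j)))%:E)); last first.
    by rewrite mul0r addr0.
  rewrite H; congr gaussE; apply/funext => z; rewrite -muleA -EFinM; congr (_ * _%:E).
  by rewrite std_pdfD; congr (_ * expR _)%R; field.
rewrite -(gaussE_tonelli S i j mv); last by move=> u; exact: gp0.
rewrite -[RHS]gaussE_cst; last by apply: integral_ge0 => x _.
congr gaussE; apply/funext => z /=.
under eq_integral do rewrite addrC.
by rewrite (@ge0_integral_lebesgue_shift R (fun x => g x * (std_pdf x)%:E)).
Qed.

Notation r := (S i j).

Definition smoothed (s t : R) : \bar R :=
  E (fun z => (std_pdf (z.1 - s) * std_pdf (z.2 - t))%:E).

Lemma measurable_std_pdf2 (a b : R) :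
  measurable_fun setT (fun z : R * R => (std_pdf (z.1 + a) * std_pdf (z.2 + b))%:E).
Proof.
have mphi := @measurable_std_pdf R.
apply/measurable_EFinP; apply: measurable_funM.
  by apply: (measurableT_comp mphi); exact: measurable_funD.
by apply: (measurableT_comp mphi); exact: measurable_funD.
Qed.

(** Choose [(a, b)] with [(2 a + b r, a r + 2 b) = (s, t)], a system of
determinant [4 - r^2]. A Cameron-Martin translation along [(a, b)] accounts for
[(a + b r, a r + b)] of the shift [(s, t)]; the remaining shift [(a, b)] of the
two factors [phi] produces an exponential that cancels the Cameron-Martin
factor. Only [exp] of the quadratic form in [(s, t)] remains. *)
Lemma smoothedE (d : R) : (0 < d)%R -> (d ^+ 2 = 1 - (r / 2) ^+ 2)%R -> forall s t,
  smoothed s t = smoothed 0%R 0%R * (quad_exp r s t)%:E.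
Proof.
move=> d0 hd s' t'; rewrite -quad_expNN /smoothed oppr0.
move: (- s')%R (- t')%R => s t {s' t'}.
have k0 : (4 - r ^+ 2 != 0)%R.
  have -> : (4 - r ^+ 2 = 4 * d ^+ 2)%R by rewrite hd; field.
  by rewrite mulf_neq0 // expf_neq0 // gt_eqF.
pose a := ((2 * s - r * t) / (4 - r ^+ 2))%R.
pose b := ((2 * t - r * s) / (4 - r ^+ 2))%R.
have sE : (s = a + b * r + a)%R by rewrite /a /b; field.
have tE : (t = a * r + b + b)%R by rewrite /a /b; field.
pose X := ((s ^+ 2 - r * s * t + t ^+ 2) / (4 - r ^+ 2))%R.
have XE : (X = (a * s + b * t) / 2)%R by rewrite /X /a /b; field.
have h0 (z : R * R) : 0 <= (std_pdf (z.1 + (a + b * r)) * std_pdf (z.2 + (a * r + b)))%:E.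
  by rewrite lee_fin mulr_ge0 ?std_pdf_ge0.
have := @gaussE_shift _ _ S hS i j hii hjj _ (- a)%R (- b)%R (measurable_std_pdf2 _ _) h0.
rewrite /= => H.
transitivity ((expR (- X))%:E * E (fun z => (std_pdf (z.1 + 0) * std_pdf (z.2 + 0))%:E)); last by rewrite muleC.
have -> : E (fun z => (std_pdf (z.1 + 0) * std_pdf (z.2 + 0))%:E) =
   (expR X)%:E * E (fun z => (std_pdf (z.1 + s) * std_pdf (z.2 + t))%:E).
  rewrite -gaussEZ ?lee_fin ?expR_ge0 //; last 2 first.
  - exact: measurable_std_pdf2.
  - by move=> z; rewrite lee_fin mulr_ge0 ?std_pdf_ge0.
  transitivity (E (fun z =>
    (std_pdf (z.1 + (- a + - b * r) + (a + b * r)) *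
      std_pdf (z.2 + (- a * r + - b) + (a * r + b)))%:E)).
    congr gaussE; apply/funext => z.
    by congr (std_pdf _ * std_pdf _)%:E%R; ring.
  rewrite H; congr gaussE; apply/funext => z.
  rewrite -!EFinM; congr _%:E.
  have -> : std_pdf (z.1 + s) = (std_pdf (z.1 + (a + b * r)) *
      expR (- (a * (z.1 + (a + b * r)) + a ^+ 2 / 2)))%R.
    by rewrite -std_pdfD -addrA -sE.
  have -> : std_pdf (z.2 + t) = (std_pdf (z.2 + (a * r + b)) *
      expR (- (b * (z.2 + (a * r + b)) + b ^+ 2 / 2)))%R.
    by rewrite -std_pdfD -addrA -tE.
  rewrite [in RHS]mulrACA [RHS]mulrCA -!expRD XE; congr (_ * expR _)%R.
  by rewrite {1}sE {1}tE; field.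
by rewrite muleA -EFinM -expRD addNr expR0 mul1e.
Qed.

Lemma gaussE_smoothed (w : R * R -> R) : measurable_fun setT w -> (forall z, 0 <= w z)%R ->
  E (fun z => \int[mu]_s \int[mu]_t (w (s, t) * (std_pdf (z.1 - s) * std_pdf (z.2 - t)))%:E) =
  \int[mu]_s \int[mu]_t ((w (s, t))%:E * smoothed s t).
Proof.
move=> mw w0.
have mphi := @measurable_std_pdf R.
pose k (u : (R * (R * R)) * R) := (w (u.1.1, u.2) * (std_pdf (u.1.2.1 - u.1.1) * std_pdf (u.1.2.2 - u.2)))%:E.
have m1 : measurable_fun setT (fun u : (R * (R * R)) * R => u.1.1) by exact: measurableT_comp.
have m2 : measurable_fun setT (fun u : (R * (R * R)) * R => u.1.2) by exact: measurableT_comp.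
have mk : measurable_fun setT k.
  apply/measurable_EFinP; apply: measurable_funM.
    by apply: (measurableT_comp mw); exact: measurable_fun_pair.
  apply: measurable_funM; apply: (measurableT_comp mphi); apply: measurable_funB => //.
    exact: (measurableT_comp measurable_fst).
  exact: (measurableT_comp measurable_snd).
have k0 u : 0 <= k u by rewrite lee_fin !mulr_ge0 ?std_pdf_ge0.
rewrite (gaussE_tonelli S i j (h := fun u => \int[mu]_t k (u, t))); last 2 first.
- exact: (measurable_fun_fubini_tonelli_F (m2 := mu) _ mk k0).
- by move=> z; apply: integral_ge0 => t _.
apply: eq_integral => s _ /=.
rewrite (gaussE_tonelli S i j (h := fun u => k ((s, u.2), u.1))) //; last first.
  apply: (measurableT_comp mk); apply: measurable_fun_pair => //.
  exact: measurable_fun_pair.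
apply: eq_integral => t _ /=; rewrite /smoothed -gaussEZ ?lee_fin //.
  exact: measurable_std_pdf2.
by move=> z; rewrite lee_fin mulr_ge0 ?std_pdf_ge0.
Qed.

Lemma integral_prodE (f g : R -> R) :
  measurable_fun setT f -> measurable_fun setT g ->
  (forall x, 0 <= f x)%R -> (forall x, 0 <= g x)%R ->
  (\int[mu]_s (f s)%:E) * (\int[mu]_t (g t)%:E) = \int[mu]_s \int[mu]_t (f s * g t)%:E.
Proof.
move=> mf mg f0 g0; rewrite -ge0_integralZr //; last 3 first.
- exact/measurable_EFinP.
- by move=> x _; rewrite lee_fin.
- by apply: integral_ge0 => x _; rewrite lee_fin.
apply: eq_integral => s _; rewrite -ge0_integralZl ?lee_fin //.
- exact/measurable_EFinP.
- by move=> x _; rewrite lee_fin.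
Qed.

Lemma measurable_std_pdfB (z : R) : measurable_fun [set: R] (fun x => std_pdf (z - x)).
Proof. by apply: (measurableT_comp measurable_std_pdf); exact: measurable_funB. Qed.

Definition std_cdf (z : R) : \bar R := \int[mu]_x (\1_`]-oo, z[%classic x * std_pdf x)%:E.

Lemma std_cdfE z : std_cdf z = \int[mu]_s (step s * std_pdf (z - s))%:E.
Proof.
have mphi := @measurable_std_pdf R.
rewrite /std_cdf.
have m1 : measurable_fun [set: R] (fun x : R => (\1_`]-oo, z[%classic x * std_pdf x)%:E).
  apply/measurable_EFinP; apply: measurable_funM => //; exact: measurable_indic.
have p1 x : 0 <= (\1_`]-oo, z[%classic x * std_pdf x)%:E by rewrite lee_fin mulr_ge0 ?std_pdf_ge0.
rewrite -(ge0_integral_lebesgue_shift z m1 p1).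
rewrite -ge0_integral_lebesgue_opp; last 2 first.
- by move: m1 => /measurableT_comp; apply; exact: measurable_funD.
- by move=> x; exact: p1.
apply: eq_integral => s _; congr _%:E.
rewrite stepE indicE (_ : (_ \in _) = (0 < s)%R) 1?addrC //.
by rewrite mem_setE in_itv /= ltrBlDr ltrDl.
Qed.

(** Both 1 and [Phi(z) Phi(z')] are integrals of [phi(z - s) phi(z' - t)], over
the plane and over a quadrant. Taking expectations, both are the same constant
times an integral of [quad_exp], so the constant drops out of the quotient. *)
Lemma gaussE_cdf (d : R) : (0 < d)%R -> (d ^+ 2 = 1 - (r / 2) ^+ 2)%R ->
  E (fun z => std_cdf z.1 * std_cdf z.2) =
  ((pi / 2 + atan (r / 2 / d)) / (2 * pi))%:E.
Proof.
move=> d0 hd.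
have mphi := @measurable_std_pdf R.
have mh := @measurable_step R.
have G0 : 0 <= smoothed 0%R 0%R.
  by apply: gaussE_ge0 => z; rewrite lee_fin mulr_ge0 ?std_pdf_ge0.
have key (w : R * R -> R) : measurable_fun setT w -> (forall z, 0 <= w z)%R ->
    \int[mu]_s \int[mu]_t ((w (s, t))%:E * smoothed s t) =
    smoothed 0%R 0%R * \int[mu]_s \int[mu]_t (w (s, t) * quad_exp r s t)%:E.
  move=> mw w0.
  have mq : measurable_fun setT (fun z => (w z * quad_exp r z.1 z.2)%:E).
    by apply/measurable_EFinP; apply: measurable_funM => //; exact: measurable_quad_exp.
  have q0 z : 0 <= (w z * quad_exp r z.1 z.2)%:E by rewrite lee_fin mulr_ge0 ?quad_exp_ge0.
  rewrite -ge0_integralZl //; last 2 first.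
  - exact: (measurable_fun_fubini_tonelli_F (m2 := mu) _ mq q0).
  - by move=> s _; apply: integral_ge0 => t _; exact: (q0 (s, t)).
  apply: eq_integral => s _; rewrite -ge0_integralZl //; last first.
    exact: (measurableT_comp mq (pair1_measurable s)).
  by apply: eq_integral => t _; rewrite (smoothedE d0 hd) EFinM muleCA.
have H1 : 1 = smoothed 0%R 0%R * (4 * d * pi)%:E.
  rewrite -(integral_quad_exp d0 hd).
  have := key (fun=> 1%R) (measurable_cst _) (fun=> ler01).
  have := gaussE_smoothed (w := fun=> 1%R) (measurable_cst _) (fun=> ler01).
  move=> /= <- K.
  under [in RHS]eq_integral do under eq_integral do rewrite -[quad_exp _ _ _]mul1r.
  rewrite -K -[LHS]gaussE_cst //; congr gaussE; apply/funext => z.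
  have I1 u : \int[mu]_t (std_pdf (u - t))%:E = 1.
    under eq_integral do rewrite -std_pdfN opprB addrC.
    by rewrite integral_std_pdf_shift.
  rewrite -[LHS]mule1 -{1}(I1 z.1) -(I1 z.2) integral_prodE.
  - by apply: eq_integral => u _; apply: eq_integral => t _; rewrite mul1r.
  - exact: measurable_std_pdfB.
  - exact: measurable_std_pdfB.
  - by move=> x; exact: std_pdf_ge0.
  - by move=> x; exact: std_pdf_ge0.
have H2 : E (fun z => std_cdf z.1 * std_cdf z.2) = smoothed 0%R 0%R * quadrant r.
  have mw : measurable_fun setT (fun z : R * R => step z.1 * step z.2)%R.
    by apply: measurable_funM; exact: (measurableT_comp mh).
  have w0 (z : R * R) : (0 <= step z.1 * step z.2)%R by rewrite mulr_ge0 ?step_ge0.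
  rewrite /quadrant; have /= <- := key _ mw w0; have /= <- := gaussE_smoothed mw w0.
  congr gaussE; apply/funext => z.
  rewrite !std_cdfE integral_prodE.
  - by apply: eq_integral => u _; apply: eq_integral => t _; rewrite mulrACA.
  - by apply: measurable_funM => //; exact: measurable_std_pdfB.
  - by apply: measurable_funM => //; exact: measurable_std_pdfB.
  - by move=> x; rewrite mulr_ge0 ?step_ge0 ?std_pdf_ge0.
  - by move=> x; rewrite mulr_ge0 ?step_ge0 ?std_pdf_ge0.
rewrite H2 (quadrantE d0 hd).
move: G0 H1; case: (smoothed _ _) => [g| |] // _.
  move=> /eqP; rewrite -EFinM eqe => /eqP H1; rewrite -EFinM; congr _%:E.
  have pi0 : (pi != 0 :> R)%R by rewrite gt_eqF // pi_gt0.
  have d0' := lt0r_neq0 d0.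
  have -> : (g = (4 * d * pi)^-1)%R.
    by apply: (@mulIf _ (4 * d * pi)%R); rewrite ?mulf_neq0 // -H1 mulVf // !mulf_neq0.
  move: (atan _) => A; move: pi pi0 => c c0.
  by field; rewrite c0 d0'.
rewrite gt0_mulye ?lte_fin ?mulr_gt0 ?pi_gt0 //.
Qed.

End gauss_marginal.

(** * Bounded differences on finite product spaces *)

Section finite_product.
Context {R : realType} {B : finType} (q : B -> R).
Hypotheses (q0 : forall b, 0 <= q b) (q1 : \sum_b q b = 1).

Definition prod_mass n (t : n.-tuple B) : R := \prod_(l < n) q (tnth t l).

Definition prod_mean n (f : n.-tuple B -> R) : R := \sum_(t : n.-tuple B) prod_mass t * f t.

Lemma prod_mass_ge0 n (t : n.-tuple B) : 0 <= prod_mass t.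
Proof. by apply: prodr_ge0 => l _. Qed.

Lemma prod_mean_cons n (f : n.+1.-tuple B -> R) :
  prod_mean f = \sum_b q b * prod_mean (fun t : n.-tuple B => f [tuple of b :: t]).
Proof.
rewrite /prod_mean.
under [RHS]eq_bigr do rewrite mulr_sumr.
rewrite pair_big /= (reindex (fun u : B * n.-tuple B => [tuple of u.1 :: u.2])) /=.
  apply: eq_bigr => -[b t] _ /=; rewrite mulrA; congr (_ * _).
  rewrite /prod_mass big_ord_recl tnth0; congr (_ * _).
  by apply: eq_bigr => l _; rewrite tnthS.
exists (fun t => (thead t, [tuple of behead t])) => [[b t]|t] _ /=.
  by congr (_, _); apply: val_inj.
by rewrite -tuple_eta.
Qed.

Lemma prod_mean_prod n (F : 'I_n -> B -> R) :
  prod_mean (fun t => \prod_l F l (tnth t l)) = \prod_l \sum_b q b * F l b.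
Proof.
elim: n F => [|n IH] F.
  rewrite /prod_mean big_ord0 (big_pred1 [tuple]); last by move=> t; apply/esym/eqP; exact: tuple0.
  by rewrite /prod_mass !big_ord0 mulr1.
rewrite prod_mean_cons big_ord_recl mulr_suml; apply: eq_bigr => b _.
rewrite -mulrA -IH /prod_mean; congr (_ * _); rewrite mulr_sumr; apply: eq_bigr => t _.
rewrite big_ord_recl tnth0 mulrCA; congr (_ * (_ * _)).
by apply: eq_bigr => l _; rewrite tnthS.
Qed.

Lemma prod_mean1 n : prod_mean (fun _ : n.-tuple B => 1) = 1.
Proof.
transitivity (\prod_(l < n) \sum_b q b * 1).
  by rewrite -prod_mean_prod; congr prod_mean; apply/funext => t; rewrite big1.
by rewrite big1 // => l _; rewrite -[RHS]q1; apply: eq_bigr => b _; rewrite mulr1.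
Qed.

Lemma prod_mean_le n (f g : n.-tuple B -> R) : (forall t, f t <= g t) -> prod_mean f <= prod_mean g.
Proof. by move=> fg; apply: ler_sum => t _; rewrite ler_wpM2l ?prod_mass_ge0. Qed.

Lemma prod_meanZ n k (f : n.-tuple B -> R) : prod_mean (fun t => k * f t) = k * prod_mean f.
Proof. by rewrite /prod_mean mulr_sumr; apply: eq_bigr => t _; rewrite mulrCA. Qed.

Lemma prod_mean_sum n (I : Type) (s : seq I) (P : pred I) (f : I -> n.-tuple B -> R) :
  prod_mean (fun t => \sum_(i <- s | P i) f i t) = \sum_(i <- s | P i) prod_mean (f i).
Proof.
rewrite /prod_mean exchange_big /=; apply: eq_bigr => t _; by rewrite mulr_sumr.
Qed.

Lemma prod_meanB n (f g : n.-tuple B -> R) : prod_mean (fun t => f t - g t) = prod_mean f - prod_mean g.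
Proof. by rewrite /prod_mean -sumrB; apply: eq_bigr => t _; rewrite mulrBr. Qed.

Lemma prod_mean_cst n k : prod_mean (fun _ : n.-tuple B => k) = k.
Proof. by rewrite -[RHS]mulr1 -(prod_mean1 n) -prod_meanZ; congr prod_mean; apply/funext => t; rewrite mulr1. Qed.

Lemma prod_mean_dist n (f g : n.-tuple B -> R) c :
  (forall t, `|f t - g t| <= c) -> `|prod_mean f - prod_mean g| <= c.
Proof.
move=> fg; rewrite -prod_meanB -(prod_mean_cst n c).
apply: le_trans (ler_norm_sum _ _ _) _; apply: ler_sum => t _.
by rewrite normrM ger0_norm ?prod_mass_ge0 // ler_wpM2l ?prod_mass_ge0.
Qed.

(** A second order bound on the exponential takes the place of Hoeffding's lemma;
its limited range is harmless since only small multiples of the centred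
function are exponentiated. *)
Lemma expR_le_quad (y : R) : y <= 1 / 2 -> expR y <= 1 + y + 2 * y ^+ 2.
Proof.
move=> y2.
have h : 0 < 1 - y by lra.
have e : (1 - y) * expR y <= 1.
  rewrite -[leRHS](divff (lt0r_neq0 (expR_gt0 y))) [leRHS]mulrC.
  by rewrite ler_pM2r ?expR_gt0 // -expRN; exact: expR_ge1Dx.
rewrite -(ler_pM2l h); apply: le_trans e _.
by have := sqr_ge0 y; nra.
Qed.

Definition bounded_diff n (f : n.-tuple B -> R) c := forall (t t' : n.-tuple B) (l : 'I_n),
  (forall k, k != l -> tnth t k = tnth t' k) -> `|f t - f t'| <= c.

(** Induction on the number of coordinates. Given the first coordinate, the
function still has bounded differences; the conditional mean, as a function of
this coordinate, is centred and bounded by [c], hence contributes a factor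
[exp(2 c^2)]. *)
Lemma mcdiarmid_mgf n (f : n.-tuple B -> R) c : 0 <= c <= 1 / 2 -> bounded_diff f c ->
  prod_mean (fun t => expR (f t - prod_mean f)) <= expR (2 * n%:R * c ^+ 2).
Proof.
move=> /andP[c0 c2]; elim: n f => [|n IH] f fc.
  rewrite mulr0 mul0r expR0 -(prod_mean1 0); apply: prod_mean_le => t.
  rewrite -[leRHS]expR0 ler_expR subr_le0 -(prod_mean_cst 0 (f t)).
  by apply: prod_mean_le => t'; rewrite (tuple0 t) (tuple0 t').
pose f_ b (t : n.-tuple B) := f [tuple of b :: t].
have f_c b : bounded_diff (f_ b) c.
  move=> t t' l tt'; apply: (fc _ _ (lift ord0 l)) => k.
  case: (unliftP ord0 k) => [m ->|->] km; last by rewrite !tnth0.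
  by rewrite !tnthS tt' //; apply: contraNneq km => ->.
pose d b := prod_mean (f_ b) - prod_mean f.
have Ef : prod_mean f = \sum_b q b * prod_mean (f_ b) by rewrite prod_mean_cons.
have dE b : d b = \sum_b' q b' * (prod_mean (f_ b) - prod_mean (f_ b')).
  under eq_bigr do rewrite mulrBr.
  by rewrite sumrB -mulr_suml q1 mul1r -Ef.
have dc b : `|d b| <= c.
  rewrite dE -[leRHS]mul1r -q1 mulr_suml.
  apply: le_trans (ler_norm_sum _ _ _) _; apply: ler_sum => b' _.
  rewrite normrM ger0_norm // ler_wpM2l //; apply: prod_mean_dist => t.
  apply: (fc _ _ ord0) => k; case: (unliftP ord0 k) => [m ->|->]; last by rewrite eqxx.
  by rewrite !tnthS.
have sd : \sum_b q b * d b = 0.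
  under eq_bigr do rewrite mulrBr.
  by rewrite sumrB -Ef -mulr_suml q1 mul1r subrr.
rewrite prod_mean_cons.
apply: (@le_trans _ _ (\sum_b q b * (expR (d b) * expR (2 * n%:R * c ^+ 2)))).
  apply: ler_sum => b _; rewrite ler_wpM2l //.
  apply: le_trans (ler_wpM2l (expR_ge0 _) (IH _ (f_c b))).
  rewrite -prod_meanZ; apply: prod_mean_le => t; rewrite -expRD ler_expR /d /f_; lra.
under eq_bigr do rewrite mulrA.
have -> : 2 * n.+1%:R * c ^+ 2 = 2 * c ^+ 2 + 2 * n%:R * c ^+ 2 by rewrite -natr1; ring.
rewrite -mulr_suml expRD ler_wpM2r ?expR_ge0 //.
apply: (@le_trans _ _ (\sum_b q b * (1 + d b + 2 * c ^+ 2))).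
  apply: ler_sum => b _; rewrite ler_wpM2l //.
  apply: le_trans (expR_le_quad _) _.
    by apply: le_trans (le_trans (ler_norm _) (dc b)) c2.
  by rewrite lerD2l ler_wpM2l // -[leLHS]real_normK ?num_real // ler_sqr ?nnegrE.
rewrite (eq_bigr (fun b => q b + q b * d b + q b * (2 * c ^+ 2))); last by move=> b _; ring.
by rewrite !big_split /= q1 sd addr0 -mulr_suml q1 mul1r expR_ge1Dx.
Qed.

(** Exponential Markov inequality at [s = a / (4 n c^2)], the optimal point for
the bound of [mcdiarmid_mgf]; the condition on [a] is [s c <= 1 / 2]. *)
Lemma mcdiarmid_upper n (f : n.-tuple B -> R) c a : (0 < n)%N -> 0 < c -> 0 <= a <= 2 * n%:R * c ->
  bounded_diff f c ->
  \sum_(t | a <= f t - prod_mean f) prod_mass t <= expR (- (a ^+ 2 / (8 * n%:R * c ^+ 2))).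
Proof.
move=> n0 c0 /andP[a0 ac] fc.
have n0' : 0 < n%:R :> R by rewrite ltr0n.
pose s := a / (4 * n%:R * c ^+ 2).
have s0 : 0 <= s by rewrite divr_ge0 // mulr_ge0 ?mulr_ge0 ?exprn_ge0 // ltW.
have sc : 0 <= s * c <= 1 / 2.
  rewrite mulr_ge0 ?(ltW c0) //=.
  have -> : s * c = a / (4 * n%:R * c) by rewrite /s; field; rewrite !gt_eqF.
  by rewrite ler_pdivrMr ?mulr_gt0 //; lra.
have sf : bounded_diff (fun t => s * f t) (s * c).
  by move=> t t' l tt'; rewrite -mulrBr normrM ger0_norm // ler_wpM2l // (fc _ _ l).
have := mcdiarmid_mgf sc sf; rewrite prod_meanZ => H.
have -> : - (a ^+ 2 / (8 * n%:R * c ^+ 2)) = - (s * a) + 2 * n%:R * (s * c) ^+ 2.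
  by rewrite /s; field; rewrite !gt_eqF.
rewrite expRD -ler_pdivrMl ?expR_gt0 // -expRN opprK.
apply: le_trans H; rewrite mulr_sumr /prod_mean [leRHS](bigID (fun t => a <= f t - prod_mean f)) /=.
rewrite -[leLHS]addr0; apply: lerD.
  apply: ler_sum => t at_; rewrite mulrC ler_wpM2l ?prod_mass_ge0 // ler_expR.
  by rewrite -mulrBr ler_wpM2l.
by apply: sumr_ge0 => t _; rewrite mulr_ge0 ?prod_mass_ge0 ?expR_ge0.
Qed.

Lemma mcdiarmid n (f : n.-tuple B -> R) c a : (0 < n)%N -> 0 < c -> 0 <= a <= 2 * n%:R * c ->
  bounded_diff f c ->
  \sum_(t | a <= `|f t - prod_mean f|) prod_mass t <= 2 * expR (- (a ^+ 2 / (8 * n%:R * c ^+ 2))).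
Proof.
move=> n0 c0 ac fc.
have fNc : bounded_diff (fun t => - f t) c.
  by move=> t t' l tt'; rewrite -opprD normrN (fc _ _ l).
have := lerD (mcdiarmid_upper n0 c0 ac fc) (mcdiarmid_upper n0 c0 ac fNc).
have -> : prod_mean (fun t => - f t) = - prod_mean f.
  by rewrite -mulN1r -prod_meanZ; congr prod_mean; apply/funext => t; rewrite mulN1r.
have -> : 2 * expR (- (a ^+ 2 / (8 * n%:R * c ^+ 2))) = expR (- (a ^+ 2 / (8 * n%:R * c ^+ 2))) +
  expR (- (a ^+ 2 / (8 * n%:R * c ^+ 2))) by rewrite mulr_natl mulr2n.
apply: le_trans.
rewrite [leRHS]addrC (bigID (fun t => a <= f t - prod_mean f)) /= addrC; apply: lerD.
  rewrite [leRHS](bigID (fun t => a <= f t - prod_mean f)) /= ler_wpDl //.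
    by apply: sumr_ge0 => t _; exact: prod_mass_ge0.
  rewrite le_eqVlt; apply/orP; left; apply/eqP; apply: eq_bigl => t.
  rewrite -opprD; case: (leP a (f t - prod_mean f)) => h; rewrite ?andbF //= !andbT.
  by rewrite ler_normr leNgt h.
rewrite [leRHS](bigID (fun t => a <= `|f t - prod_mean f|)) /= ler_wpDr //.
  by apply: sumr_ge0 => t _; exact: prod_mass_ge0.
by rewrite le_eqVlt; apply/orP; left; apply/eqP; apply: eq_bigl => t; rewrite andbC.
Qed.

(** Decompose [h] over the values taken at the three distinct coordinates: each
term is a product of functions of single coordinates. *)
Lemma prod_mean3 n (l a c : 'I_n) (h : B -> B -> B -> R) : l != a -> l != c -> a != c ->
  prod_mean (fun t => h (tnth t l) (tnth t a) (tnth t c)) =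
  \sum_b \sum_b1 \sum_b2 q b * q b1 * q b2 * h b b1 b2.
Proof.
move=> la lc ac.
have [al cl ca] : [/\ a != l, c != l & c != a] by rewrite ![_ == l]eq_sym [c == a]eq_sym.
pose F b b1 b2 (k : 'I_n) (x : B) : R :=
  if k == l then (x == b)%:R else if k == a then (x == b1)%:R else if k == c then (x == b2)%:R else 1.
have FE b b1 b2 t : \prod_k F b b1 b2 k (tnth t k) = (tnth t l == b)%:R * (tnth t a == b1)%:R * (tnth t c == b2)%:R.
  rewrite (bigD1 l) //= (bigD1 a al) /= (bigD1 c) /=; last by rewrite cl ca.
  rewrite big1 /F; last by move=> k /andP[/andP[/negbTE-> /negbTE->] /negbTE->].
  by rewrite !eqxx (negbTE al) (negbTE cl) (negbTE ca) mulr1 mulrA.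
have GE b b1 b2 : \prod_k \sum_x q x * F b b1 b2 k x = q b * q b1 * q b2.
  have sq (y : B) : \sum_x q x * (x == y)%:R = q y.
    by rewrite (bigD1 y) //= eqxx mulr1 big1 ?addr0 // => x /negbTE->; rewrite mulr0.
  rewrite (bigD1 l) //= (bigD1 a al) /= (bigD1 c) /=; last by rewrite cl ca.
  rewrite [X in _ * (_ * (_ * X))]big1; last first.
    move=> k /andP[/andP[/negbTE kl /negbTE ka] /negbTE kc].
    by rewrite /F kl ka kc; under eq_bigr do rewrite mulr1.
  rewrite /F !eqxx (negbTE al) (negbTE cl) (negbTE ca) mulr1.
  by rewrite !sq mulrA.
transitivity (prod_mean (fun t => \sum_b \sum_b1 \sum_b2 h b b1 b2 * \prod_k F b b1 b2 k (tnth t k))).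
  congr prod_mean; apply/funext => t.
  rewrite (bigD1 (tnth t l)) //= [X in _ + X]big1 ?addr0; last first.
    move=> b bl; rewrite big1 // => b1 _; rewrite big1 // => b2 _.
    by rewrite FE eq_sym (negbTE bl) !mul0r mulr0.
  rewrite (bigD1 (tnth t a)) //= [X in _ + X]big1 ?addr0; last first.
    by move=> b bl; rewrite big1 // => b2 _; rewrite FE [tnth t a == b]eq_sym (negbTE bl) mulr0 mul0r mulr0.
  rewrite (bigD1 (tnth t c)) //= [X in _ + X]big1 ?addr0; last first.
    by move=> b bl; rewrite FE [tnth t c == b]eq_sym (negbTE bl) !mulr0.
  by rewrite FE !eqxx !mulr1.
rewrite prod_mean_sum; apply: eq_bigr => b _; rewrite prod_mean_sum; apply: eq_bigr => b1 _.
rewrite prod_mean_sum; apply: eq_bigr => b2 _; rewrite prod_meanZ prod_mean_prod GE mulrC //.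
Qed.

(** By independence the probability of a collision is [sum_c P(g = c)^2], which
is at most [max_c P(g = c)]. *)
Lemma prod_mean_collision {C : finType} (g : B -> C) (eps : R) n (l a : 'I_n) :
  (forall c, \sum_b q b * (g b == c)%:R <= eps) -> l != a ->
  prod_mean (fun t => (g (tnth t l) == g (tnth t a))%:R) <= eps.
Proof.
move=> ge la.
have al : a != l by rewrite eq_sym.
pose F c (k : 'I_n) (b : B) : R := if (k == l) || (k == a) then (g b == c)%:R else 1.
have -> : (fun t : n.-tuple B => (g (tnth t l) == g (tnth t a))%:R) =
    (fun t => \sum_c \prod_k F c k (tnth t k)) :> (_ -> R).
  apply/funext => t.
  have FE c : \prod_k F c k (tnth t k) = (g (tnth t l) == c)%:R * (g (tnth t a) == c)%:R.
    rewrite (bigD1 l) //= (bigD1 a al) /= [X in _ * (_ * X)]big1.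
      by rewrite mulr1 /F !eqxx orbT.
    by move=> k /andP[/negbTE kl /negbTE ka]; rewrite /F kl ka.
  under eq_bigr do rewrite FE.
  rewrite (bigD1 (g (tnth t l))) //= eqxx mul1r big1 ?addr0 1?eq_sym //.
  by move=> c; rewrite eq_sym => /negbTE->; rewrite mul0r.
rewrite prod_mean_sum.
have GE c : prod_mean (fun t => \prod_k F c k (tnth t k)) = (\sum_b q b * (g b == c)%:R) ^+ 2.
  rewrite prod_mean_prod (bigD1 l) //= (bigD1 a al) /= [X in _ * (_ * X)]big1.
    by rewrite mulr1 /F !eqxx orbT.
  by move=> k /andP[/negbTE kl /negbTE ka]; rewrite /F kl ka; under eq_bigr do rewrite mulr1.
under eq_bigr do rewrite GE.
apply: (@le_trans _ _ (\sum_c eps * \sum_b q b * (g b == c)%:R)).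
  apply: ler_sum => c _; rewrite expr2 ler_wpM2r // sumr_ge0 // => b _.
  by rewrite mulr_ge0.
rewrite -mulr_sumr exchange_big /= (eq_bigr q) ?q1 ?mulr1 // => b _.
rewrite -mulr_sumr (bigD1 (g b)) //= eqxx big1 ?addr0 ?mulr1 //.
by move=> c; rewrite eq_sym => /negbTE->.
Qed.

Variables (e1 e2 : rel B).

(** When [e1] and [e2] compare two coordinates of the observations, the inner
sums over [a] and [c] are the two ranks of observation [l], so this is
[n^-3 sum_l rank_l rank'_l]. *)
Definition rank_stat n (t : n.-tuple B) : R :=
  (\sum_l \sum_a \sum_c (e1 (tnth t a) (tnth t l))%:R * (e2 (tnth t c) (tnth t l))%:R) / n%:R ^+ 3.

(** The mean of a term of [rank_stat] at three distinct observations. *)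
Definition rank_mean : R :=
  \sum_b \sum_b1 \sum_b2 q b * q b1 * q b2 * ((e1 b1 b)%:R * (e2 b2 b)%:R).

Lemma sum_cst_ord n (x : R) : \sum_(l < n) x = n%:R * x.
Proof. by rewrite sumr_const card_ord mulr_natl. Qed.

Lemma sum_eq_ord n (m : 'I_n) : \sum_(l < n) (l == m)%:R = 1 :> R.
Proof. by rewrite (bigD1 m) //= eqxx big1 ?addr0 // => k /negbTE->. Qed.

(** Counts the triples that involve a given index, which are those that feel a
change of the corresponding observation. *)
Lemma sum3_coincidence n (m : 'I_n) :
  \sum_(l < n) \sum_(a < n) \sum_(c < n) ((l == m)%:R + (a == m)%:R + (c == m)%:R : R) = 3 * n%:R ^+ 2.
Proof.
rewrite (eq_bigr (fun l : 'I_n => n%:R * n%:R * (l == m)%:R + n%:R * 2)).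
  rewrite big_split /= -mulr_sumr sum_eq_ord !sum_cst_ord.
  by move: (n%:R : R) => N; ring.
move=> l _; rewrite (eq_bigr (fun a : 'I_n => n%:R * ((l == m)%:R + (a == m)%:R) + 1)).
  rewrite big_split /= -mulr_sumr big_split /= sum_eq_ord !sum_cst_ord.
  by move: ((l == m)%:R : R) (n%:R : R) => x N; ring.
by move=> a _; rewrite big_split /= sum_eq_ord !sum_cst_ord.
Qed.

Lemma indic_mul_dist (x y x' y' : bool) : `|x%:R * y%:R - x'%:R * y'%:R| <= 1 :> R.
Proof.
by case: x; case: y; case: x'; case: y';
  rewrite ?(mulr0, mul0r, mulr1, subrr, subr0, sub0r, normrN, normr1, normr0, ler01, lexx).
Qed.

Lemma rank_stat_bounded_diff n : (0 < n)%N -> bounded_diff (@rank_stat n) (3 / n%:R).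
Proof.
move=> n0 t t' m tt'.
have n0' : 0 < n%:R :> R by rewrite ltr0n.
rewrite -mulrBl normrM [X in _ * X]ger0_norm ?invr_ge0 ?exprn_ge0 ?ler0n //.
rewrite ler_pdivrMr ?exprn_gt0 //.
have -> : 3 / n%:R * n%:R ^+ 3 = 3 * n%:R ^+ 2 :> R by field; rewrite gt_eqF.
rewrite -(sum3_coincidence m) -sumrB; apply: le_trans (ler_norm_sum _ _ _) _.
apply: ler_sum => l _; rewrite -sumrB; apply: le_trans (ler_norm_sum _ _ _) _.
apply: ler_sum => a _; rewrite -sumrB; apply: le_trans (ler_norm_sum _ _ _) _.
apply: ler_sum => c _.
have [->|lm] := eqVneq l m.
  by apply: le_trans (indic_mul_dist _ _ _ _) _; rewrite -addrA lerDl addr_ge0 ?ler0n.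
have [->|am] := eqVneq a m.
  by apply: le_trans (indic_mul_dist _ _ _ _) _; rewrite add0r lerDl ler0n.
have [->|cm] := eqVneq c m.
  by apply: le_trans (indic_mul_dist _ _ _ _) _; rewrite !add0r.
by rewrite !tt' // subrr normr0 !addr0.
Qed.

Lemma rank_mean_itv : 0 <= rank_mean <= 1.
Proof.
apply/andP; split.
  by do 3 (apply: sumr_ge0 => ? _); rewrite !mulr_ge0 ?ler0n.
apply: (@le_trans _ _ (\sum_b \sum_b1 \sum_b2 q b * q b1 * q b2)).
  do 3 (apply: ler_sum => ? _); apply: ler_piMr; first by rewrite !mulr_ge0.
  by rewrite -natrM lern1 mulnb leq_b1.
under eq_bigr => b _ do under eq_bigr => b1 _ do rewrite -mulr_sumr q1 mulr1.
by under eq_bigr => b _ do rewrite -mulr_sumr q1 mulr1; rewrite q1.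
Qed.

(** The terms of [rank_stat] with three distinct indices have mean [rank_mean];
there are at most [3 n^2] other terms. *)
Lemma rank_stat_mean n : (0 < n)%N -> `|prod_mean (@rank_stat n) - rank_mean| <= 3 / n%:R.
Proof.
move=> n0.
have n0' : 0 < n%:R :> R by rewrite ltr0n.
have -> : prod_mean (@rank_stat n) = (\sum_l \sum_a \sum_c
   prod_mean (fun t : n.-tuple B => (e1 (tnth t a) (tnth t l))%:R * (e2 (tnth t c) (tnth t l))%:R)) / n%:R ^+ 3.
  rewrite mulrC; under eq_bigr => l _.
    under eq_bigr => a _ do rewrite -prod_mean_sum.
    rewrite -prod_mean_sum; over.
  rewrite -prod_mean_sum -prod_meanZ; congr prod_mean; apply/funext => t; by rewrite mulrC.
have -> : rank_mean = (\sum_(l < n) \sum_(a < n) \sum_(c < n) rank_mean) / n%:R ^+ 3.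
  rewrite !sum_cst_ord; field; by rewrite gt_eqF.
rewrite -mulrBl normrM [X in _ * X]ger0_norm ?invr_ge0 ?exprn_ge0 ?ler0n //.
rewrite ler_pdivrMr ?exprn_gt0 //.
have -> : 3 / n%:R * n%:R ^+ 3 = 3 * n%:R ^+ 2 :> R by field; rewrite gt_eqF.
apply: (@le_trans _ _ (\sum_(l < n) \sum_(a < n) \sum_(c < n) ((l == a)%:R + (l == c)%:R + (a == c)%:R))).
  rewrite -sumrB; apply: le_trans (ler_norm_sum _ _ _) _.
  apply: ler_sum => l _; rewrite -sumrB; apply: le_trans (ler_norm_sum _ _ _) _.
  apply: ler_sum => a _; rewrite -sumrB; apply: le_trans (ler_norm_sum _ _ _) _.
  apply: ler_sum => c _.
  have D : `|prod_mean (fun t : n.-tuple B => (e1 (tnth t a) (tnth t l))%:R * (e2 (tnth t c) (tnth t l))%:R) - rank_mean| <= 1.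
    have /andP[m0 m1] := rank_mean_itv.
    have E0 : 0 <= prod_mean (fun t : n.-tuple B => (e1 (tnth t a) (tnth t l))%:R * (e2 (tnth t c) (tnth t l))%:R).
      by rewrite -(prod_mean_cst n 0); apply: prod_mean_le => t; rewrite -natrM ler0n.
    have E1 : prod_mean (fun t : n.-tuple B => (e1 (tnth t a) (tnth t l))%:R * (e2 (tnth t c) (tnth t l))%:R) <= 1.
      by rewrite -[leRHS](prod_mean_cst n 1); apply: prod_mean_le => t; rewrite -natrM lern1 mulnb leq_b1.
    by rewrite ler_norml; lra.
  have [la|la] := eqVneq l a.
    by apply: le_trans D _; rewrite -addrA lerDl addr_ge0 ?ler0n.
  have [lc|lc] := eqVneq l c.
    by apply: le_trans D _; rewrite add0r lerDl ler0n.
  have [ac|ac] := eqVneq a c.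
    by apply: le_trans D _; rewrite !add0r.
  by rewrite (prod_mean3 (fun b b1 b2 => (e1 b1 b)%:R * (e2 b2 b)%:R) la lc ac) /rank_mean subrr normr0 !addr0.
have s1 (l : 'I_n) : \sum_(a < n) (l == a)%:R = 1 :> R.
  by under eq_bigr do rewrite eq_sym; exact: sum_eq_ord.
rewrite le_eqVlt; apply/orP; left; apply/eqP.
rewrite (eq_bigr (fun l : 'I_n => n%:R * 3)); first by rewrite !sum_cst_ord; move: (n%:R : R) => N; ring.
move=> l _; rewrite (eq_bigr (fun a : 'I_n => n%:R * (l == a)%:R + 2)).
  by rewrite big_split /= -mulr_sumr s1 !sum_cst_ord; move: (n%:R : R) => N; ring.
by move=> a _; rewrite !big_split /= !s1 !sum_cst_ord -addrA.
Qed.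

End finite_product.

(** * Ranks and Spearman correlation *)

Section trig.
Context {R : realType}.

Lemma sin_lipschitz (a b : R) : `|sin a - sin b| <= `|a - b|.
Proof.
wlog ab : a b / a <= b.
  by move=> W; have [/W//|/ltW/W] := leP a b; rewrite distrC [X in _ <= X]distrC.
have dS x : is_derive x (1 : R) (@sin R) (cos x) by exact: is_derive_sin.
have dS' x : x \in `]a, b[%R -> is_derive x (1 : R) (@sin R) (cos x) by move=> _; exact: dS.
have cS : {within `[a, b], continuous (@sin R)}.
  by apply: continuous_subspaceT => x; exact: continuous_sin.
have [c _ E] := MVT_segment ab dS' cS.
rewrite distrC [X in _ <= X]distrC E normrM ler_piMl //.
by rewrite ler_norml cos_geN1 cos_le1.
Qed.

(** By the double angle formula, [sin (pi / 6) = cos (2 pi / 6)] gives a quadratic equation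
with a single positive root. *)
Lemma sin_pi6 : 2 * sin (pi / 6) = 1 :> R.
Proof.
have p0 := pi_gt0 R.
have s0 : 0 < sin (pi / 6 : R) by apply: sin_gt0_pihalf; lra.
have : sin (pi / 6 : R) = cos ((pi / 6) *+ 2).
  by rewrite -cosBpihalf -cosN; congr cos; rewrite -mulr_natr; field.
rewrite cos_mulr2n cos2sin2 => E.
have : (2 * sin (pi / 6) - 1) * (sin (pi / 6) + 1) = 0 :> R.
  by move: E; rewrite -mulr_natr; set s := sin _; lra.
by move=> /eqP; rewrite mulf_eq0 => /orP[/eqP|/eqP]; lra.
Qed.

End trig.

Section ranks.
Context {R : realType} {n p : nat} (D : 'M[R]_(n, p)).
Notation rk := (rank_in_sample D).

Definition distinct_col (i : 'I_p) := forall l l' : 'I_n, D l i = D l' i -> l = l'.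

Lemma rank_gt0 l i : (0 < rk l i)%N.
Proof. by apply/card_gt0P; exists l; rewrite inE. Qed.

Lemma rank_le l i : (rk l i <= n)%N.
Proof. by rewrite -[leqRHS]card_ord max_card. Qed.

Lemma rank_inj i : distinct_col i -> injective (fun l => rk l i).
Proof.
move=> di l l' E; apply: di; apply/eqP/negPn/negP => /eqP/eqP ll'.
wlog lt : l l' E ll' / D l i < D l' i.
  move=> W; have [|/ltW|] := ltgtP (D l i) (D l' i).
  - exact: W.
  - move=> h; apply: (W l' l) => //; rewrite 1?eq_sym // lt_neqAle h andbT eq_sym //.
  - by move=> h; rewrite h eqxx in ll'.
suff : (rk l i < rk l' i)%N by rewrite E ltnn.
apply: proper_card; apply/properP; split.
  by apply/fintype.subsetP => m; rewrite !inE => /le_trans; apply; exact: ltW.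
by exists l'; rewrite !inE ?lexx // -ltNge.
Qed.

(** Without ties the ranks are a permutation of 1, ..., n. *)
Lemma sum_rank i (F : nat -> R) : distinct_col i ->
  \sum_l F (rk l i) = \sum_(k < n) F k.+1.
Proof.
move=> di.
have rP l : ((rk l i).-1 < n)%N by rewrite prednK ?rank_gt0 ?rank_le.
rewrite [RHS](reindex_inj (h := fun l => Ordinal (rP l))) /=.
  by apply: eq_bigr => l _; rewrite prednK ?rank_gt0.
move=> l l' [E]; apply: (rank_inj di).
by rewrite -(prednK (rank_gt0 l i)) E prednK ?rank_gt0.
Qed.

Lemma sum_first_nat m : \sum_(k < m) k.+1%:R = m%:R * (m%:R + 1) / 2 :> R.
Proof.
elim: m => [|m IH]; first by rewrite big_ord0 !mul0r.
by rewrite big_ord_recr /= IH -natr1; field.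
Qed.

Lemma sum_first_squares m : \sum_(k < m) k.+1%:R ^+ 2 = m%:R * (m%:R + 1) * (2 * m%:R + 1) / 6 :> R.
Proof.
elim: m => [|m IH]; first by rewrite big_ord0 !mul0r.
by rewrite big_ord_recr /= IH -natr1; field.
Qed.

Hypothesis n2 : (1 < n)%N.
Let N : R := n%:R.
Let N2 : 2 <= N. Proof. by rewrite /N ler_nat. Qed.

Definition rank_fun i := fun l : 'I_n => (rk l i)%:R : R.

Lemma mean_rank i : distinct_col i -> sample_mean (rank_fun i) = (N + 1) / 2.
Proof.
move=> di; rewrite /sample_mean /rank_fun (sum_rank (fun k => k%:R) di) sum_first_nat -/N.
by field; rewrite gt_eqF //; have := N2; lra.
Qed.

Lemma rank_cov i j : distinct_col i -> distinct_col j ->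
  \sum_l (rank_fun i l - sample_mean (rank_fun i)) * (rank_fun j l - sample_mean (rank_fun j)) =
  \sum_l rank_fun i l * rank_fun j l - N * (N + 1) ^+ 2 / 4.
Proof.
move=> di dj; rewrite !mean_rank //.
rewrite (eq_bigr (fun l => rank_fun i l * rank_fun j l + - ((N + 1) / 2) * rank_fun i l +
    - ((N + 1) / 2) * rank_fun j l + (N + 1) ^+ 2 / 4)); last first.
  by move=> l _; field.
rewrite !big_split /= -!mulr_sumr (sum_rank (fun k => k%:R) di) (sum_rank (fun k => k%:R) dj) sum_first_nat.
rewrite sum_cst_ord -/N.
by move: (\sum_(i0 < n) _) => s; field.
Qed.

Lemma rank_var i : distinct_col i ->
  \sum_l (rank_fun i l - sample_mean (rank_fun i)) ^+ 2 = N * (N ^+ 2 - 1) / 12.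
Proof.
move=> di; have := rank_cov di di.
under eq_bigr do rewrite -expr2; move=> ->.
under eq_bigr do rewrite -expr2.
by rewrite (sum_rank (fun k => k%:R ^+ 2) di) sum_first_squares -/N; field.
Qed.

Lemma spearman_distinct i j : distinct_col i -> distinct_col j ->
  spearman D i j =
  (\sum_l rank_fun i l * rank_fun j l - N * (N + 1) ^+ 2 / 4) / (N * (N ^+ 2 - 1) / 12).
Proof.
move=> di dj; rewrite /spearman /pearson -/(rank_fun i) -/(rank_fun j) rank_cov // !rank_var //.
rewrite -expr2 sqrtr_sqr ger0_norm //.
by have := N2 => h; rewrite divr_ge0 // mulr_ge0 //; nra.
Qed.

Lemma rank_corr_mx_diag i : distinct_col i -> rank_corr_mx D i i = 1.
Proof.
move=> di; rewrite mxE spearman_distinct //.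
under eq_bigr do rewrite -expr2.
rewrite (sum_rank (fun k => k%:R ^+ 2) di) sum_first_squares -/N.
set X := (X in pi / 6 * X).
suff -> : X = 1 by rewrite mulr1 sin_pi6.
rewrite /X; have := N2 => h.
have h1 : N != 0 by rewrite gt_eqF //; lra.
have h2 : N ^+ 2 - 1 != 0 by rewrite gt_eqF //; nra.
by field; rewrite h1 h2.
Qed.

(** The mean and the variance of the ranks are explicit, so Spearman's
coefficient is affine in [g], with coefficients within [O(1 / n)] of 12 and
-3. *)
Lemma spearman_approx i j (g : R) : distinct_col i -> distinct_col j ->
  \sum_l rank_fun i l * rank_fun j l = N ^+ 3 * g -> 0 <= g <= 1 ->
  `|spearman D i j - (12 * g - 3)| <= 12 / N.
Proof.
move=> di dj E /andP[g0 g1]; rewrite spearman_distinct // E; have := N2 => h.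
have h1 : N != 0 by rewrite gt_eqF //; lra.
have h2 : N ^+ 2 - 1 != 0 by rewrite gt_eqF //; nra.
have h3 : 0 < N ^+ 2 - 1 by nra.
have -> : (N ^+ 3 * g - N * (N + 1) ^+ 2 / 4) / (N * (N ^+ 2 - 1) / 12) - (12 * g - 3) =
   (12 * g - 6 * (N + 1)) / (N ^+ 2 - 1).
  by field; rewrite h1 h2.
rewrite normrM [X in _ * X]gtr0_norm ?invr_gt0 // ler_pdivrMr //.
rewrite mulrAC ler_pdivlMr; last lra.
rewrite -[X in _ * X <= _]gtr0_norm -?normrM; last lra.
by rewrite ler_norml; apply/andP; split; nra.
Qed.

Lemma rank_corr_mx_le2 i j : `|rank_corr_mx D i j| <= 2.
Proof.
rewrite mxE normrM gtr0_norm // -[leRHS]mulr1 ler_wpM2l //.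
by rewrite ler_norml sin_geN1 sin_le1.
Qed.

Lemma rank_sum_stat {B : finType} (e1 e2 : rel B) (t : n.-tuple B) i j :
  (forall l l', (D l' i <= D l i) = e1 (tnth t l') (tnth t l)) ->
  (forall l l', (D l' j <= D l j) = e2 (tnth t l') (tnth t l)) ->
  \sum_l rank_fun i l * rank_fun j l = N ^+ 3 * rank_stat e1 e2 t.
Proof.
move=> h1 h2; have := N2 => h.
rewrite /rank_stat [RHS]mulrC divfK; last by rewrite expf_neq0 // gt_eqF //; rewrite /N in h; lra.
apply: eq_bigr => l _; rewrite /rank_fun.
have rE k : (rk l k)%:R = \sum_a ((D a k <= D l k)%R)%:R :> R.
  by rewrite /rank_in_sample -sum1_card natr_sum big_mkcond /=; apply: eq_bigr => a _; rewrite inE; case: (_ <= _).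
rewrite !rE mulr_suml; apply: eq_bigr => a _; rewrite mulr_sumr; apply: eq_bigr => c _.
by rewrite h1 h2.
Qed.

End ranks.

(** * Bins of the standard normal distribution *)

Section bins.
Context {R : realType}.
Notation mu := (@lebesgue_measure R).
Variable N : nat.
Hypothesis N0 : (0 < N)%N.

Definition num_thresholds := (2 * N * N).+1.
(** The grid of step [1 / N] from [- N] to [N]. *)
Definition threshold (k : nat) : R := k%:R / N%:R - N%:R.

Definition latent_bin_nat (y : R) : nat := #|[pred k : 'I_num_thresholds | threshold k < y]|.
Lemma latent_bin_lt y : (latent_bin_nat y < num_thresholds.+1)%N.
Proof. by rewrite ltnS -[leqRHS]card_ord max_card. Qed.
Definition latent_bin (y : R) : 'I_num_thresholds.+1 := Ordinal (latent_bin_lt y).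

Lemma threshold_le k k' : (k <= k')%N -> threshold k <= threshold k'.
Proof. by move=> kk; rewrite lerD2r ler_wpM2r ?invr_ge0 ?ler0n // ler_nat. Qed.

Lemma latent_bin_mono x y : x <= y -> (latent_bin x <= latent_bin y)%N.
Proof.
move=> xy; apply: subset_leq_card; apply/fintype.subsetP => k; rewrite !inE => h.
exact: lt_le_trans h xy.
Qed.

(** The thresholds are increasing, so those below [y] are the first ones. *)
Lemma latent_binP y (k : 'I_num_thresholds) : (threshold k < y) = (k < latent_bin y)%N.
Proof.
have cE m : (m <= num_thresholds)%N -> #|[pred l : 'I_num_thresholds | (l < m)%N]| = m.
  move=> mn; have wi : injective (widen_ord mn) by move=> u v [] /val_inj.
  rewrite -[RHS]card_ord -(fintype.card_image wi).
  apply: eq_card => l; rewrite inE; apply/idP/fintype.imageP => [lm|[u _ ->]] /=; last exact: ltn_ord.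
  by exists (Ordinal lm) => //; exact: val_inj.
apply/idP/idP => h.
  rewrite /= /latent_bin_nat -[leqLHS](cE k.+1) //.
  apply: subset_leq_card; apply/fintype.subsetP => l; rewrite !inE ltnS => lk.
  by apply: le_lt_trans h; exact: threshold_le.
rewrite ltNge; apply/negP => yk; move: h; rewrite ltnNge /= => /negP; apply.
rewrite /latent_bin_nat -[leqRHS](cE k); last exact/ltnW/ltn_ord.
apply: subset_leq_card; apply/fintype.subsetP => l; rewrite !inE => ly.
by rewrite ltnNge; apply/negP => /threshold_le kl; have := lt_le_trans ly (le_trans yk kl); rewrite ltxx.
Qed.

Lemma measurable_latent_bin_le (c : nat) : measurable [set y | (latent_bin y <= c)%N].
Proof.
apply: is_interval_measurable => x y /= xc yc z /andP[_ zy].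
exact: leq_trans (latent_bin_mono zy) yc.
Qed.

Lemma measurable_latent_bin_eq (c : 'I_num_thresholds.+1) : measurable [set y | latent_bin y = c].
Proof.
apply: is_interval_measurable => x y /= xc yc z /andP[xz zy].
apply/val_inj/eqP; rewrite eqn_leq -{1}yc -{1}xc.
by rewrite (latent_bin_mono zy) (latent_bin_mono xz).
Qed.

Local Open Scope ereal_scope.

Definition bin_mass (c : 'I_num_thresholds.+1) : \bar R :=
  \int[mu]_x ((latent_bin x == c)%:R * std_pdf x)%:E.

Definition bin_cdf (c : 'I_num_thresholds.+1) : \bar R :=
  \int[mu]_x ((latent_bin x <= c)%N%:R * std_pdf x)%:E.

Lemma indic_bool (P : R -> bool) : (fun x => (P x)%:R : R) = \1_[set x | P x].
Proof. by apply/funext => x; rewrite indicE mem_setE. Qed.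

Lemma measurable_bool (P : R -> bool) : measurable [set x | P x] ->
  measurable_fun setT (fun x => (P x)%:R : R).
Proof. by move=> mP; rewrite indic_bool; exact: measurable_indic. Qed.

Lemma measurable_bool_pdf (P : R -> bool) : measurable [set x | P x] ->
  measurable_fun setT (fun x => ((P x)%:R * std_pdf x)%:E).
Proof.
move=> mP; apply/measurable_EFinP; apply: measurable_funM; first exact: measurable_bool.
exact: measurable_std_pdf.
Qed.

Lemma measurable_latent_bin_eqb c : measurable [set y | latent_bin y == c].
Proof. by rewrite (_ : [set y | latent_bin y == c] = [set y | latent_bin y = c]); [exact: measurable_latent_bin_eq|apply/seteqP; split => y /eqP]. Qed.

Lemma bool_pdf_le (P Q : R -> bool) : measurable [set x | P x] -> measurable [set x | Q x] ->
  (forall x, P x -> Q x) ->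
  \int[mu]_x ((P x)%:R * std_pdf x)%:E <= \int[mu]_x ((Q x)%:R * std_pdf x)%:E.
Proof.
move=> mP mQ PQ; apply: ge0_le_integral => //.
- by move=> x _; rewrite lee_fin mulr_ge0 ?std_pdf_ge0.
- exact: measurable_bool_pdf.
- exact: measurable_bool_pdf.
move=> x _; rewrite lee_fin ler_wpM2r ?std_pdf_ge0 // ler_nat.
by move: (PQ x); case: (P x) => // ->.
Qed.

Lemma measurable_ge (L : R) : measurable [set x : R | (L <= x)%R].
Proof.
rewrite (_ : [set x | _] = `[L, +oo[%classic) //.
by apply/seteqP; split => x /=; rewrite in_itv /= andbT.
Qed.

(** On [x >= L], [phi(x) <= (x / L) phi(x)], and [x phi(x)] has an explicit
primitive. *)
Lemma std_tail (L : R) : (0 < L)%R ->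
  \int[mu]_x ((L <= x)%R%:R * std_pdf x)%:E <= (L^-1)%:E.
Proof.
move=> L0.
have mL := measurable_ge L.
have mk : measurable_fun [set: R] (fun x => x * expR (- (2^-1 * x ^+ 2)))%R.
  apply: measurable_funM => //; apply: measurableT_comp => //; apply: measurableT_comp => //.
  apply: measurable_funM => //; exact: measurable_funX.
have mk' : measurable_fun [set: R] (fun x => (step x * (x * expR (- (2^-1 * x ^+ 2))))%:E).
  by apply/measurable_EFinP; apply: measurable_funM => //; exact: measurable_step.
have k0 x : 0 <= (step x * (x * expR (- (2^-1 * x ^+ 2))))%:E.
  rewrite lee_fin stepE; case: (ltP 0%R x) => x0; last by rewrite mul0r.
  by rewrite mul1r mulr_ge0 ?expR_ge0 // ltW.
have p1 : (normal_peak 1 <= 1 :> R)%R.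
  by have := std_pdf_le1 (0 : R); rewrite std_pdfE expr0n /= mul0r oppr0 expR0 mulr1.
apply: (@le_trans _ _ (\int[mu]_x (L^-1%:E * (step x * (x * expR (- (2^-1 * x ^+ 2))))%:E))).
  apply: ge0_le_integral => //.
  - by move=> x _; rewrite lee_fin mulr_ge0 ?std_pdf_ge0.
  - exact: measurable_bool_pdf.
  - exact: measurable_funeM.
  move=> x _; have [Lx|Lx] := leP L x; last by rewrite mul0r mule_ge0 // lee_fin invr_ge0 ltW.
  have x0 : (0 < x)%R by exact: lt_le_trans Lx.
  rewrite -EFinM lee_fin stepE x0 !mul1r mulrA -[leLHS]mul1r ler_pM ?std_pdf_ge0 //.
    by rewrite mulrC ler_pdivlMr // mul1r.
  by rewrite std_pdfE [(2^-1 * _)%R]mulrC ler_piMl ?expR_ge0.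
rewrite ge0_integralZl ?lee_fin ?invr_ge0 ?(ltW L0) //.
rewrite integral_step // integral_radial ?invr_gt0 // mulfV // invr1 mule1 //.
Qed.

Lemma measurable_itv_bool (a b : R) : measurable [set x : R | (a < x <= b)%R].
Proof.
by rewrite (_ : [set x | _] = `]a, b]%classic) //; apply/seteqP; split => x /=; rewrite in_itv.
Qed.

Lemma std_pdf_itv_le (a b : R) : (a <= b)%R ->
  \int[mu]_x ((a < x <= b)%R%:R * std_pdf x)%:E <= (b - a)%:E.
Proof.
move=> ab.
have -> : (b - a)%:E = mu `]a, b]%classic.
  rewrite lebesgue_measure_itv /= lte_fin; move: ab; rewrite le_eqVlt => /orP[/eqP->|h].
    by rewrite ltxx subrr.
  by rewrite h EFinB.
rewrite -[leRHS](mul1e) -[1]/(1%:E) -integral_cst //.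
rewrite [leRHS]integral_mkcond; apply: ge0_le_integral => //.
- by move=> x _; rewrite lee_fin mulr_ge0 ?std_pdf_ge0.
- by apply: measurable_bool_pdf; exact: measurable_itv_bool.
- by apply/(measurable_restrictT _ _).1 => //; exact: measurable_cst.
move=> x _; rewrite /patch mem_setE in_itv /=.
case: ifP => _; first by rewrite mul1r lee_fin std_pdf_le1.
by rewrite mul0r.
Qed.

(** Inner bins have length [1 / N], and the two outer ones are tails beyond
[N]. *)
Lemma bin_mass_le c : bin_mass c <= (N%:R^-1)%:E.
Proof.
have N0' : (0 < N%:R :> R)%R by rewrite ltr0n.
have mc := measurable_latent_bin_eqb c.
have [c0|c0] := posnP c.
  have k0 : (0 < num_thresholds)%N by [].
  have mN : measurable [set x : R | (x <= - N%:R)%R].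
    rewrite (_ : [set x | _] = `]-oo, (- N%:R)%R]%classic) //.
  apply: (@le_trans _ _ (\int[mu]_x ((x <= - N%:R)%R%:R * std_pdf x)%:E)).
    apply: bool_pdf_le => // x /eqP E.
    have := latent_binP x (Ordinal k0); rewrite E c0 /= /threshold mul0r sub0r.
    by case: ltP.
  rewrite -ge0_integral_lebesgue_opp.
  - under eq_integral do rewrite std_pdfN lerN2.
    exact: std_tail.
  - exact: measurable_bool_pdf.
  - by move=> x; rewrite lee_fin mulr_ge0 ?std_pdf_ge0.
have [cm|cm] := ltnP c num_thresholds.
  have c1 : (c.-1 < num_thresholds)%N by apply: leq_ltn_trans cm; exact: leq_pred.
  apply: (@le_trans _ _ (\int[mu]_x ((threshold c.-1 < x <= threshold c)%R%:R * std_pdf x)%:E)).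
    apply: bool_pdf_le => //; first exact: measurable_itv_bool.
    move=> x /eqP E; have := latent_binP x (Ordinal c1); have := latent_binP x (Ordinal cm).
    by rewrite E /= ltnn prednK // leqnn => /negbT; rewrite -leNgt => -> ->.
  apply: le_trans (std_pdf_itv_le _) _; first by apply: threshold_le; exact: leq_pred.
  rewrite lee_fin /threshold -{1}(prednK c0) -natr1.
  rewrite le_eqVlt; apply/orP; left; apply/eqP.
  by move: (c.-1%:R : R) => u; field; rewrite gt_eqF.
have c1 : (2 * N * N < num_thresholds)%N by [].
apply: le_trans (std_tail N0'); apply: bool_pdf_le => //; first exact: measurable_ge.
move=> x /eqP E; have := latent_binP x (Ordinal c1); rewrite E /= (leq_trans _ cm) // => /ltW.
congr (_ <= _)%R; rewrite /threshold !natrM.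
by field; rewrite gt_eqF.
Qed.

Lemma bin_cdf_ge y : std_cdf y <= bin_cdf (latent_bin y).
Proof.
have -> : std_cdf y = \int[mu]_x ((x < y)%R%:R * std_pdf x)%:E.
  by apply: eq_integral => x _; rewrite indicE mem_setE in_itv.
apply: bool_pdf_le; [|exact: measurable_latent_bin_le|].
  rewrite (_ : [set x | _] = `]-oo, y[%classic) //.
by move=> x /ltW; exact: latent_bin_mono.
Qed.

Lemma bin_cdf_le y : bin_cdf (latent_bin y) <= std_cdf y + (N%:R^-1)%:E.
Proof.
have my : measurable [set x : R | (x < y)%R].
  rewrite (_ : [set x | _] = `]-oo, y[%classic) //.
have mc := measurable_latent_bin_eqb (latent_bin y).
have -> : std_cdf y = \int[mu]_x ((x < y)%R%:R * std_pdf x)%:E.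
  by apply: eq_integral => x _; rewrite indicE mem_setE in_itv.
apply: le_trans (leeD2l _ (bin_mass_le (latent_bin y))).
rewrite -ge0_integralD //; first last.
- exact: measurable_bool_pdf.
- by move=> x _; rewrite lee_fin mulr_ge0 ?std_pdf_ge0.
- exact: measurable_bool_pdf.
- by move=> x _; rewrite lee_fin mulr_ge0 ?std_pdf_ge0.
apply: ge0_le_integral => //.
- by move=> x _; rewrite lee_fin mulr_ge0 ?std_pdf_ge0.
- by apply: measurable_bool_pdf; exact: measurable_latent_bin_le.
- by apply: emeasurable_funD; exact: measurable_bool_pdf.
move=> x _; rewrite -EFinD lee_fin -mulrDl ler_wpM2r ?std_pdf_ge0 // -natrD ler_nat.
have [xy|yx] := ltP x y; first by rewrite (leq_trans (leq_b1 _)) // leq_addr.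
rewrite add0n -val_eqE /= eqn_leq; have := latent_bin_mono yx; rewrite /= => ->.
by rewrite andbT.
Qed.

End bins.

(** * The law of the binned sample *)

Section binned_law.
Context {R : realType} {n p : nat} {d : measure_display} {T : measurableType d}
  {P : probability T R} {S : 'M[R]_p} {X : {RV P >-> p.-tuple R}}
  {x : 'I_n -> {RV P >-> p.-tuple R}} {f : 'I_p -> R -> R}.
Hypotheses (hS : pos_def S) (hdiag : forall i, S i i = 1)
  (hf : forall i w w', tnth (X w) i <= tnth (X w') i ->
           f i (tnth (X w) i) <= f i (tnth (X w') i))
  (hg : gaussian_vector P (fun w => [tuple f i (tnth (X w) i) | i < p]) S)
  (hx : iid_copies X x).
Variables (N : nat) (N0 : (0 < N)%N).
Notation latent_bin := (@latent_bin R N).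
Notation bin := ('I_(num_thresholds N).+1).
Notation bcdf := (@bin_cdf R N).

(** The total mass of the density is read off the law of the transformed
observation. *)
Lemma gauss_mass1 : iterated_integral (fun y : p.-tuple R => (gauss_pdf S y)%:E) = 1%E.
Proof.
have := hg measurableT; rewrite preimage_setT probability_setT => ->.
by congr iterated_integral; apply/funext => y; rewrite indicT mul1r.
Qed.

(** The points of the observed scale below some attained value whose transform
is at most the threshold. Being a lower set of the line, it is measurable
whatever the transformation is off the attained values. *)
Definition lower_closure (i : 'I_p) (k : 'I_(num_thresholds N)) : set R :=
  [set u | exists2 w, u <= tnth (X w) i & f i (tnth (X w) i) <= threshold N k].

Definition obs_bin_nat i (u : R) : nat := #|[pred k | u \notin lower_closure i k]|.
Lemma obs_bin_lt i u : (obs_bin_nat i u < (num_thresholds N).+1)%N.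
Proof. by rewrite ltnS -[leqRHS]card_ord max_card. Qed.
Definition obs_bin i (u : R) : bin := Ordinal (obs_bin_lt i u).

(** Monotonicity of the transformation along attained values makes the two
scales give the same bin to every observation. *)
Lemma obs_bin_latent i w : obs_bin i (tnth (X w) i) = latent_bin (f i (tnth (X w) i)).
Proof.
apply: val_inj => /=; apply: eq_card => k; rewrite !inE ltNge; congr (~~ _).
apply/idP/idP => [/set_mem[w' ww' h]|h]; first by apply: le_trans h; exact: hf.
by apply/mem_set; exists w.
Qed.

Lemma obs_bin_mono i u v : u <= v -> (obs_bin i u <= obs_bin i v)%N.
Proof.
move=> uv; apply: subset_leq_card; apply/fintype.subsetP => k; rewrite !inE.
apply: contra => /set_mem[w vw h]; apply/mem_set; exists w => //.
exact: le_trans vw.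
Qed.

Variables (i j : 'I_p).

Definition tuple_bin (y : p.-tuple R) : bin * bin := (obs_bin i (tnth y i), obs_bin j (tnth y j)).

Lemma measurable_obs_bin k c : measurable [set u | obs_bin k u = c].
Proof.
apply: is_interval_measurable => u v /= uc vc z /andP[uz zv].
apply/val_inj/eqP; rewrite eqn_leq -{1}vc -{1}uc.
by rewrite (obs_bin_mono _ uz) (obs_bin_mono _ zv).
Qed.

Lemma measurable_tuple_bin b : measurable [set y | tuple_bin y = b].
Proof.
rewrite (_ : [set y | _] = (fun y => tnth y i) @^-1` [set u | obs_bin i u = b.1] `&`
    (fun y => tnth y j) @^-1` [set u | obs_bin j u = b.2]); last first.
  by apply/seteqP; split => y /=; rewrite /tuple_bin; [move=> <-|case: b => b1 b2 /= [-> ->]].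
apply: measurableI.
  by rewrite -[X in measurable X]setTI; apply: measurable_tnth => //; exact: measurable_obs_bin.
by rewrite -[X in measurable X]setTI; apply: measurable_tnth => //; exact: measurable_obs_bin.
Qed.

Definition bin_law (b : bin * bin) : R := fine (distribution P X [set y | tuple_bin y = b]).

Lemma bin_law_ge0 b : 0 <= bin_law b.
Proof. by rewrite fine_ge0. Qed.

Lemma bin_lawE b : distribution P X [set y | tuple_bin y = b] = (bin_law b)%:E.
Proof. by rewrite fineK // fin_num_measure //; exact: measurable_tuple_bin. Qed.

Local Open Scope ereal_scope.
Notation E := (gaussE S i j).

Definition latent_bins (z : R * R) : bin * bin := (latent_bin z.1, latent_bin z.2).

Lemma measurable_latent_bins_eq b : measurable [set z | latent_bins z = b].
Proof.
rewrite (_ : [set y | _] = fst @^-1` [set u | latent_bin u = b.1] `&`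
    snd @^-1` [set u | latent_bin u = b.2]); last first.
  by apply/seteqP; split => y /=; rewrite /latent_bins; [move=> <-|case: b => b1 b2 /= [-> ->]].
apply: measurableI.
  by rewrite -[X in measurable X]setTI; apply: measurable_fst => //; exact: measurable_latent_bin_eq.
by rewrite -[X in measurable X]setTI; apply: measurable_snd => //; exact: measurable_latent_bin_eq.
Qed.

Lemma measurable_latent_bins_indic b : measurable_fun setT (fun z : R * R => (latent_bins z == b)%:R : R).
Proof.
rewrite (_ : (fun z => _) = \1_[set z | latent_bins z = b]).
  by apply: measurable_indic; exact: measurable_latent_bins_eq.
apply/funext => z; rewrite indicE; congr ((nat_of_bool _)%:R); apply/idP/idP.
  by move=> /eqP h; exact/mem_set.
by move=> /set_mem /= ->.
Qed.

Lemma measurable_latent_bins (F : bin * bin -> \bar R) : measurable_fun setT (fun z => F (latent_bins z)).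
Proof.
move=> _ Y mY; rewrite setTI.
rewrite (_ : _ @^-1` Y = \bigcup_(b in [set b | Y (F b)]) [set z | latent_bins z = b]).
  by apply: fin_bigcup_measurable => [|b _]; [exact: finite_finset|exact: measurable_latent_bins_eq].
by apply/seteqP; split => z /=; [exists (latent_bins z)|case=> b Yb /= e; rewrite e].
Qed.

(** Bins of the observed scale are bins of the latent scale, where the law is
Gaussian. *)
Lemma bin_law_gaussE b : (bin_law b)%:E = E (fun z => (latent_bins z == b)%:R%:E).
Proof.
rewrite -bin_lawE /distribution /pushforward /=.
pose A : set (p.-tuple R) := [set y | latent_bins (tnth y i, tnth y j) = b].
have mA : measurable A.
  rewrite (_ : A = (fun y => (tnth y i, tnth y j)) @^-1` [set z | latent_bins z = b]) //.
  rewrite -[X in measurable X]setTI; apply: measurable_tnth_pair => //.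
  exact: measurable_latent_bins_eq.
rewrite (_ : X @^-1` _ = (fun w => [tuple f i (tnth (X w) i) | i < p]) @^-1` A); last first.
  by apply/seteqP; split => w; rewrite /= /A /tuple_bin /latent_bins /= !tnth_mktuple !obs_bin_latent.
rewrite hg //; congr iterated_integral; apply/funext => y.
rewrite -EFinM; congr (_ * _)%:E%R; rewrite indicE; congr ((nat_of_bool _)%:R); apply/idP/idP.
  by move=> /set_mem /= h; exact/eqP.
by move=> /eqP h; exact/mem_set.
Qed.

Lemma gaussE_sum (I : finType) (h : I -> R * R -> \bar R) :
  (forall k, measurable_fun setT (h k)) -> (forall k z, 0 <= h k z) ->
  E (fun z => \sum_k h k z) = \sum_k E (h k).
Proof.
move=> mh h0; elim: (index_enum I) => [|a s IH].
  rewrite big_nil -[RHS](gaussE_cst i j gauss_mass1 (lexx 0)); congr gaussE.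
  by apply/funext => z; rewrite big_nil.
rewrite big_cons -IH -gaussED //.
- by congr gaussE; apply/funext => z; rewrite big_cons.
- exact: emeasurable_sum.
- by move=> z; apply: sume_ge0.
Qed.

Lemma sum_bin_law (F : bin * bin -> R) : (forall b, 0 <= F b)%R ->
  (\sum_b bin_law b * F b)%:E = E (fun z => (F (latent_bins z))%:E).
Proof.
move=> F0.
transitivity (E (fun z => \sum_b (F b)%:E * ((latent_bins z == b)%:R)%:E)).
  rewrite gaussE_sum.
  - rewrite -sumEFin; apply: eq_bigr => b _; rewrite gaussEZ ?lee_fin //.
    + by rewrite -bin_law_gaussE -EFinM mulrC.
    + by apply/measurable_EFinP; exact: measurable_latent_bins_indic.
  - move=> b; apply: measurable_funeM; apply/measurable_EFinP; exact: measurable_latent_bins_indic.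
  - by move=> b z; rewrite mule_ge0 // lee_fin ?ler0n.
congr gaussE; apply/funext => z; rewrite (bigD1 (latent_bins z)) //= eqxx mule1 big1 ?adde0 //.
by move=> b; rewrite eq_sym => /negbTE->; rewrite mule0.
Qed.

Lemma bin_law_sum1 : (\sum_b bin_law b = 1)%R.
Proof.
apply: EFin_inj; rewrite -[RHS](gaussE_cst i j gauss_mass1 lee01).
rewrite -(sum_bin_law (F := fun=> 1%R)) // => *; congr _%:E.
by apply: eq_bigr => b _; rewrite mulr1.
Qed.

Lemma gaussE_fst (Q : R -> bool) : measurable [set u | Q u] ->
  E (fun z => (Q z.1)%:R%:E) = \int[lebesgue_measure]_u ((Q u)%:R * std_pdf u)%:E.
Proof.
move=> mQ; rewrite (gaussE_marginal hS (hdiag i) (hdiag j) gauss_mass1 (g := fun u => (Q u)%:R%:E)) //.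
by apply/measurable_EFinP; exact: measurable_bool.
Qed.

Lemma gaussE_snd (Q : R -> bool) : measurable [set u | Q u] ->
  E (fun z => (Q z.2)%:R%:E) = \int[lebesgue_measure]_u ((Q u)%:R * std_pdf u)%:E.
Proof.
move=> mQ.
rewrite -(gaussE_marginal hS (hdiag j) (hdiag i) gauss_mass1 (g := fun u => (Q u)%:R%:E)) //.
by apply/measurable_EFinP; exact: measurable_bool.
Qed.

Lemma bin_law_cdf_fst (c : bin) : (\sum_b bin_law b * (b.1 <= c)%N%:R)%:E = bcdf c.
Proof.
rewrite sum_bin_law //.
exact: (gaussE_fst (Q := fun u => (latent_bin u <= c)%N) (measurable_latent_bin_le N c)).
Qed.

Lemma bin_law_cdf_snd (c : bin) : (\sum_b bin_law b * (b.2 <= c)%N%:R)%:E = bcdf c.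
Proof.
rewrite sum_bin_law //.
exact: (gaussE_snd (Q := fun u => (latent_bin u <= c)%N) (measurable_latent_bin_le N c)).
Qed.

Lemma bin_law_mass_fst (c : bin) : (\sum_b bin_law b * (b.1 == c)%:R <= N%:R^-1)%R.
Proof.
rewrite -lee_fin sum_bin_law //; apply: le_trans (bin_mass_le N0 c).
by rewrite (gaussE_fst (Q := fun u => latent_bin u == c) (measurable_latent_bin_eqb c)).
Qed.

Lemma bin_law_mass_snd (c : bin) : (\sum_b bin_law b * (b.2 == c)%:R <= N%:R^-1)%R.
Proof.
rewrite -lee_fin sum_bin_law //; apply: le_trans (bin_mass_le N0 c).
by rewrite (gaussE_snd (Q := fun u => latent_bin u == c) (measurable_latent_bin_eqb c)).
Qed.

Definition fst_le : rel (bin * bin) := fun b' b => (b'.1 <= b.1)%N.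
Definition snd_le : rel (bin * bin) := fun b' b => (b'.2 <= b.2)%N.

Lemma measurable_std_cdf : measurable_fun setT (@std_cdf R).
Proof.
have mk : measurable_fun setT (fun z : R * R => (step z.2 * std_pdf (z.1 - z.2))%:E).
  apply/measurable_EFinP; apply: measurable_funM; first exact: (measurableT_comp measurable_step).
  by apply: (measurableT_comp measurable_std_pdf); exact: measurable_funB.
have := measurable_fun_fubini_tonelli_F (m2 := lebesgue_measure) _ mk.
rewrite (_ : fubini_F _ _ = std_cdf); last by apply/funext => z; rewrite std_cdfE.
by apply => z; rewrite lee_fin mulr_ge0 ?step_ge0 ?std_pdf_ge0.
Qed.

Lemma std_cdf_ge0 (z : R) : 0 <= std_cdf z.
Proof. by apply: integral_ge0 => u _; rewrite lee_fin mulr_ge0 ?std_pdf_ge0. Qed.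

Lemma std_cdf_le1 (z : R) : std_cdf z <= 1.
Proof.
apply: le_trans (bin_cdf_ge N z) _; rewrite -bin_law_cdf_fst lee_fin -[leRHS]bin_law_sum1.
apply: ler_sum => b _; by rewrite ler_piMr ?bin_law_ge0 // lern1 leq_b1.
Qed.

(** Given the first observation, the other two are independent, each contributing
a distribution function. *)
Lemma bin_rank_meanE : (rank_mean bin_law fst_le snd_le)%:E =
  E (fun z => bcdf (latent_bin z.1) * bcdf (latent_bin z.2)).
Proof.
pose Q1 (c : bin) := (\sum_b bin_law b * (b.1 <= c)%N%:R)%R.
pose Q2 (c : bin) := (\sum_b bin_law b * (b.2 <= c)%N%:R)%R.
have -> : rank_mean bin_law fst_le snd_le = (\sum_b bin_law b * (Q1 b.1 * Q2 b.2))%R.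
  apply: eq_bigr => b _; rewrite /Q1 /Q2 mulr_suml mulr_sumr; apply: eq_bigr => b1 _.
  rewrite mulrCA mulr_sumr mulr_sumr.
  by apply: eq_bigr => b2 _; rewrite /fst_le /snd_le; ring.
rewrite sum_bin_law; last first.
  by move=> b; rewrite mulr_ge0 // sumr_ge0 // => b' _; rewrite mulr_ge0 ?bin_law_ge0.
congr gaussE; apply/funext => z /=.
by rewrite EFinM /Q1 /Q2 bin_law_cdf_fst bin_law_cdf_snd.
Qed.

(** Rounding [z] up to the end of its bin increases the distribution function by
at most the mass [1 / N] of the bin. *)
Lemma bin_rank_mean_bounds :
  E (fun z => std_cdf z.1 * std_cdf z.2) <= (rank_mean bin_law fst_le snd_le)%:E /\
  (rank_mean bin_law fst_le snd_le)%:E <= E (fun z => std_cdf z.1 * std_cdf z.2) + (3 / N%:R)%:E.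
Proof.
have m2 : measurable_fun setT (fun z : R * R => std_cdf z.1 * std_cdf z.2).
  by apply: emeasurable_funM; exact: (measurableT_comp measurable_std_cdf).
have mB : measurable_fun setT (fun z : R * R => bcdf (latent_bin z.1) * bcdf (latent_bin z.2)).
  exact: (measurable_latent_bins (fun b => bcdf b.1 * bcdf b.2)).
have c0 (z : R * R) : 0 <= std_cdf z.1 * std_cdf z.2 by rewrite mule_ge0 ?std_cdf_ge0.
have N0' : (0 < N%:R :> R)%R by rewrite ltr0n.
have N1 : (N%:R^-1 <= 1 :> R)%R by rewrite invf_le1 // ler1n.
rewrite bin_rank_meanE; split.
  apply: gaussE_le => // z; apply: lee_pmul; rewrite ?std_cdf_ge0 ?bin_cdf_ge //.
rewrite -{1}(gaussE_cst i j gauss_mass1 (c := (3 / N%:R)%:E)); last by rewrite lee_fin divr_ge0.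
rewrite -gaussED //.
apply: gaussE_le => //.
- exact: emeasurable_funD.
- by move=> z; rewrite mule_ge0 // (le_trans (std_cdf_ge0 _) (bin_cdf_ge N _)).
move=> [u v] /=.
have := bin_cdf_le N0 u; have := bin_cdf_le N0 v.
have := bin_cdf_ge N u; have := bin_cdf_ge N v.
have := std_cdf_le1 u; have := std_cdf_le1 v; have := std_cdf_ge0 u; have := std_cdf_ge0 v.
rewrite -!bin_law_cdf_fst.
case: (std_cdf u) => [a| |] //; case: (std_cdf v) => [b| |] //.
rewrite -!EFinM => b0 a0 b1 a1 bB aA Bb Aa.
change (b%:E + (N%:R^-1)%:E) with (b + N%:R^-1)%:E in Bb.
change (a%:E + (N%:R^-1)%:E) with (a + N%:R^-1)%:E in Aa.
change ((a * b)%:E + (3 / N%:R)%:E) with (a * b + 3 / N%:R)%:E.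
move: b0 a0 b1 a1 bB aA Bb Aa; rewrite !lee_fin.
move: (\sum__ _)%R (\sum__ _)%R => B A.
move: (N%:R^-1)%R N1 N0' => e e1 e0' b0 a0 b1 a1 bB aA Bb Aa.
nra.
Qed.

Local Close Scope ereal_scope.

Lemma collision_fst (l a : 'I_n) : l != a ->
  prod_mean bin_law (fun t : n.-tuple (bin * bin) => ((tnth t l).1 == (tnth t a).1)%:R) <= N%:R^-1.
Proof.
by move=> la; have := prod_mean_collision bin_law_ge0 bin_law_sum1 (g := fun b : bin * bin => b.1) bin_law_mass_fst la.
Qed.

Lemma collision_snd (l a : 'I_n) : l != a ->
  prod_mean bin_law (fun t : n.-tuple (bin * bin) => ((tnth t l).2 == (tnth t a).2)%:R) <= N%:R^-1.
Proof.
by move=> la; have := prod_mean_collision bin_law_ge0 bin_law_sum1 (g := fun b : bin * bin => b.2) bin_law_mass_snd la.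
Qed.

Definition sample_bins (w : T) : n.-tuple (bin * bin) := [tuple tuple_bin (x l w) | l < n].

Lemma measurable_sample_bins t : measurable [set w | sample_bins w = t].
Proof.
rewrite (_ : [set w | _] = \bigcap_(l in [set: 'I_n]) (x l @^-1` [set y | tuple_bin y = tnth t l])).
  apply: fin_bigcap_measurable => [|l _]; first exact: finite_finset.
  rewrite -[X in measurable X]setTI; apply: measurable_funP => //; exact: measurable_tuple_bin.
apply/seteqP; split => w /=.
  by move=> <- l _ /=; rewrite tnth_mktuple.
by move=> h; apply: eq_from_tnth => l; rewrite tnth_mktuple; exact: h.
Qed.

Lemma sample_bins_law t : P [set w | sample_bins w = t] = (prod_mass bin_law t)%:E.
Proof.
rewrite (_ : [set w | _] = \bigcap_(l in [set: 'I_n]) (x l @^-1` [set y | tuple_bin y = tnth t l])); last first.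
  apply/seteqP; split => w /=.
    by move=> <- l _ /=; rewrite tnth_mktuple.
  by move=> h; apply: eq_from_tnth => l; rewrite tnth_mktuple; exact: h.
have [h1 ->] := hx; last by move=> l; exact: measurable_tuple_bin.
rewrite /prod_mass -prodEFin; apply: eq_bigr => l _.
by rewrite -bin_lawE -(h1 l) //; exact: measurable_tuple_bin.
Qed.

(** Transfers to the probability space the estimates on the finite product
space. *)
Lemma sample_bins_event (G : pred (n.-tuple (bin * bin))) :
  measurable [set w | G (sample_bins w)] /\
  (P [set w | G (sample_bins w)] <= (\sum_(t | G t) prod_mass bin_law t)%:E)%E.
Proof.
have E : [set w | G (sample_bins w)] = \bigcup_(t in [set t | G t]) [set w | sample_bins w = t].
  by apply/seteqP; split => w /=; [exists (sample_bins w)|case=> t Gt /= e; rewrite e].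
have fG : finite_set [set t | G t] by exact: finite_finset.
split.
  by rewrite E; apply: fin_bigcup_measurable => // t _; exact: measurable_sample_bins.
have mt t : [set t | G t] t -> measurable [set w | sample_bins w = t].
  by move=> _; exact: measurable_sample_bins.
have mE : measurable (\bigcup_(t in [set t | G t]) [set w | sample_bins w = t]).
  exact: fin_bigcup_measurable.
rewrite E; apply: le_trans (content_sub_fsum P fG mt mE (@subset_refl _ _)) _.
rewrite (fsbigE [seq t <- index_enum _ | G t]).
- rewrite big_filter_cond -sumEFin le_eqVlt; apply/orP; left; apply/eqP.
  apply: eq_big => [t|t _]; last exact: sample_bins_law.
  by rewrite mem_setE andbb.
- by rewrite filter_uniq // index_enum_uniq.
- by move=> t /=; rewrite mem_filter => /andP[].
- by move=> t Gt; rewrite mem_filter Gt mem_index_enum.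
Qed.

End binned_law.

(** * Concentration of the rank correlations *)

Section arcsine_law.
Context {R : realType}.

Lemma exists_nat_gt (z : R) : exists2 N, (0 < N)%N & z < N%:R.
Proof.
exists (Num.bound `|z|).+1 => //.
apply: le_lt_trans (ler_norm z) _; apply: lt_trans (archi_boundP (normr_ge0 z)) _.
by rewrite ltr_nat.
Qed.

Lemma sin_atan (u : R) : sin (atan u) = u / Num.sqrt (1 + u ^+ 2).
Proof.
have c0 : cos (atan u) != 0 by rewrite cos_atan invr_neq0 // gt_eqF // sqrtr_gt0 ltr_pwDl // sqr_ge0.
by rewrite -cos_atan -[X in _ = X * _]atanK /tan divfK.
Qed.

(** [gaussE_cdf] turns the argument of the sine into the arctangent of
[(r / 2) / sqrt (1 - (r / 2)^2)], which is the arcsine of [r / 2]. *)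
Lemma spearman_pearson_bridge (r d : R) : 0 < d -> d ^+ 2 = 1 - (r / 2) ^+ 2 ->
  2 * sin (pi / 6 * (12 * ((pi / 2 + atan (r / 2 / d)) / (2 * pi)) - 3)) = r.
Proof.
move=> d0 hd; have p0 := pi_gt0 R.
have -> : pi / 6 * (12 * ((pi / 2 + atan (r / 2 / d)) / (2 * pi)) - 3) = atan (r / 2 / d).
  by move: (atan _) => A; move: pi p0 => c c0; field; rewrite gt_eqF.
rewrite sin_atan.
have -> : 1 + (r / 2 / d) ^+ 2 = (d^-1) ^+ 2.
  have d0' : d ^+ 2 != 0 by rewrite expf_neq0 // gt_eqF.
  apply: (mulIf d0'); rewrite mulrDl -!exprMn mul1r divfK; last by rewrite gt_eqF.
  by rewrite mulVf ?gt_eqF // expr1n hd subrK.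
by rewrite sqrtr_sqr ger0_norm ?invr_ge0 ?(ltW d0) // invrK; field; rewrite gt_eqF.
Qed.

(** Test positive definiteness on [e_i + e_j] and [e_i - e_j]. *)
Lemma pos_def_corr_lt1 (p : nat) (S : 'M[R]_p) (i j : 'I_p) :
  pos_def S -> (forall i, S i i = 1) -> i != j -> `|S i j| < 1.
Proof.
move=> [SS hS] hd ij.
have Sji : S j i = S i j by rewrite -[in LHS]SS mxE.
have H (s : R) : s ^+ 2 = 1 -> 0 < 2 + 2 * s * S i j.
  move=> s2; pose v : 'rV[R]_p := delta_mx 0 i + s *: delta_mx 0 j.
  have v0 : v != 0.
    apply/eqP => /rowP/(_ i); rewrite !mxE !eqxx /= (negbTE ij) mulr0 addr0 => /eqP.
    by rewrite oner_eq0.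
  have := hS v v0.
  have -> : (v *m S *m v^T) 0 0 = 2 + 2 * s * S i j; last by [].
  have vS k : (v *m S) 0 k = S i k + s * S j k.
    by rewrite /v mulmxDl -scalemxAl -!rowE !mxE.
  have vT (u : 'rV[R]_p) : (u *m v^T) 0 0 = u 0 i + s * u 0 j.
    rewrite /v linearD linearZ /= mulmxDr -scalemxAr !trmx_delta -!colE !mxE //.
  by rewrite vT !vS !hd Sji; lra.
have := H 1; have := H (-1); rewrite sqrrN expr1n => /(_ erefl) h1 /(_ erefl) h2.
by rewrite ltr_norml; lra.
Qed.

End arcsine_law.

Lemma rank_stat_itv {R : realType} {B : finType} (e1 e2 : rel B) n (t : n.-tuple B) :
  (0 < n)%N -> 0 <= (rank_stat e1 e2 t : R) <= 1.
Proof.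
move=> n0; have n0' : 0 < n%:R :> R by rewrite ltr0n.
rewrite /rank_stat divr_ge0 ?exprn_ge0 ?ler0n //=; last first.
  by do 3 (apply: sumr_ge0 => ? _); rewrite mulr_ge0.
rewrite ler_pdivrMr ?exprn_gt0 // mul1r.
apply: (@le_trans _ _ (\sum_(l < n) \sum_(a < n) \sum_(c < n) (1 : R))).
  do 3 (apply: ler_sum => ? _); by rewrite -natrM lern1 mulnb leq_b1.
by rewrite !sum_cst_ord mulr1 !exprS expr0 mulr1.
Qed.

Section pair_concentration.
Context {R : realType} {n p : nat} {d : measure_display} {T : measurableType d}
  {P : probability T R} {S : 'M[R]_p} {X : {RV P >-> p.-tuple R}}
  {x : 'I_n -> {RV P >-> p.-tuple R}} {f : 'I_p -> R -> R}.
Hypotheses (hS : pos_def S) (hdiag : forall i, S i i = 1)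
  (hf : forall i w w', tnth (X w) i <= tnth (X w') i ->
           f i (tnth (X w) i) <= f i (tnth (X w') i))
  (hg : gaussian_vector P (fun w => [tuple f i (tnth (X w) i) | i < p]) S)
  (hx : iid_copies X x).

Definition has_collision {B C : finType} (t : n.-tuple (B * C)) : bool :=
  [exists u : 'I_n * 'I_n, (u.1 != u.2) &&
    (((tnth t u.1).1 == (tnth t u.2).1) || ((tnth t u.1).2 == (tnth t u.2).2))].

Section fixed_N.
Variables (N : nat) (N0 : (0 < N)%N) (i j : 'I_p).
Notation bin := ('I_(num_thresholds N).+1).
Notation q := (@bin_law R p d T P X f N i j).
Notation sb := (@sample_bins R n p d T P X x f N i j).

Lemma collision_mass :
  \sum_(t : n.-tuple (bin * bin) | has_collision t) prod_mass q t <= 2 * n%:R ^+ 2 / N%:R.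
Proof.
apply: (@le_trans _ _ (prod_mean q (fun t : n.-tuple (bin * bin) =>
   \sum_(u : 'I_n * 'I_n | u.1 != u.2) (((tnth t u.1).1 == (tnth t u.2).1)%:R +
      ((tnth t u.1).2 == (tnth t u.2).2)%:R)))).
  rewrite big_mkcond; apply: ler_sum => t _; case: ifPn => [/existsP[u /andP[u12 h]]|_].
    rewrite ler_peMr ?prod_mass_ge0 //; first exact: bin_law_ge0.
    rewrite (bigD1 u) //= -[leLHS]addr0; apply: lerD.
      by case/orP: h => ->; rewrite ?lerDl ?lerDr ler0n.
    by apply: sumr_ge0 => v _; rewrite addr_ge0 ?ler0n.
  rewrite mulr_ge0 ?prod_mass_ge0 //; first exact: bin_law_ge0.
  by apply: sumr_ge0 => v _; rewrite addr_ge0 ?ler0n.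
rewrite prod_mean_sum.
apply: (@le_trans _ _ (\sum_(u : 'I_n * 'I_n) (2 / N%:R))).
  rewrite [leLHS]big_mkcond; apply: ler_sum => u _; case: ifPn => u12; last by rewrite divr_ge0.
  have -> : 2 / N%:R = N%:R^-1 + N%:R^-1 :> R by rewrite mulr_natl mulr2n.
  have -> : prod_mean q (fun t : n.-tuple (bin * bin) => ((tnth t u.1).1 == (tnth t u.2).1)%:R +
      ((tnth t u.1).2 == (tnth t u.2).2)%:R) =
    prod_mean q (fun t : n.-tuple (bin * bin) => ((tnth t u.1).1 == (tnth t u.2).1)%:R) +
    prod_mean q (fun t : n.-tuple (bin * bin) => ((tnth t u.1).2 == (tnth t u.2).2)%:R).
    by rewrite /prod_mean -big_split /=; apply: eq_bigr => t _; rewrite mulrDr.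
  apply: lerD; [exact: (collision_fst hS hdiag hf hg N0 _ _ u12)|exact: (collision_snd hS hdiag hf hg N0 _ _ u12)].
by rewrite sumr_const card_prod card_ord -[leLHS]mulr_natl natrM; rewrite le_eqVlt; apply/orP; left; apply/eqP; ring.
Qed.

(** The bin is a monotone function of the observation, so observations in
different bins compare as their bins do. *)
Lemma order_of_bins w : ~~ has_collision (sb w) -> forall l l',
  (data_mx x w l' i <= data_mx x w l i) = fst_le (tnth (sb w) l') (tnth (sb w) l) /\
  (data_mx x w l' j <= data_mx x w l j) = snd_le (tnth (sb w) l') (tnth (sb w) l).
Proof.
move=> nc l l'; rewrite /fst_le /snd_le /sample_bins !tnth_mktuple /tuple_bin /= !mxE.
have nc' k k' : k != k' ->
   (tnth (sb w) k).1 != (tnth (sb w) k').1 /\ (tnth (sb w) k).2 != (tnth (sb w) k').2.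
  move=> kk'; move: nc; rewrite negb_exists => /forallP/(_ (k, k')).
  by rewrite /= kk' /= negb_or => /andP.
have [->|ll] := eqVneq l l'; first by rewrite !lexx !leqnn.
have [n1 n2] := nc' _ _ ll.
rewrite /sample_bins !tnth_mktuple /tuple_bin /= in n1 n2.
split; apply/idP/idP => [|h]; try exact: obs_bin_mono.
  rewrite leNgt; apply/negP => /ltW/(obs_bin_mono (X:=X) (f:=f) N i) h'.
  by move/negP: n1; apply; rewrite -val_eqE eqn_leq h h'.
rewrite leNgt; apply/negP => /ltW/(obs_bin_mono (X:=X) (f:=f) N j) h'.
by move/negP: n2; apply; rewrite -val_eqE eqn_leq h h'.
Qed.

Lemma no_collision_distinct w : ~~ has_collision (sb w) ->
  distinct_col (data_mx x w) i /\ distinct_col (data_mx x w) j.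
Proof.
move=> nc; split => l l' E; apply/eqP/negPn/negP => ll;
  move: nc; rewrite negb_exists => /forallP/(_ (l, l'));
  rewrite /= ll /= negb_or /sample_bins !tnth_mktuple /tuple_bin /=;
  move: E; rewrite !mxE => ->; by rewrite eqxx ?andbF.
Qed.

End fixed_N.

(** Ties force collisions; the same variable can be taken twice in the pair. *)
Lemma distinct_col_whp (i : 'I_p) (eta : R) : 0 < eta ->
  exists A : set T, [/\ measurable A, (P (~` A) <= eta%:E)%E &
    forall w, A w -> distinct_col (data_mx x w) i].
Proof.
move=> e0.
have [N N0 HN] := exists_nat_gt (2 * n%:R ^+ 2 / eta).
have Ne : 2 * n%:R ^+ 2 / N%:R <= eta.
  by rewrite ler_pdivrMr ?ltr0n // -ler_pdivrMl // mulrC; exact: ltW.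
have [mB PB] := sample_bins_event (N:=N) (f:=f) hx i i has_collision.
exists (~` [set w | has_collision (sample_bins (X:=X) (f:=f) (x:=x) N i i w)]); split.
- exact: measurableC.
- rewrite setCK; apply: le_trans PB _; rewrite lee_fin.
  by apply: le_trans (collision_mass N0 i i) Ne.
- by move=> w /negP /no_collision_distinct[].
Qed.

(** With [kappa] the value of [gaussE_cdf], Spearman's coefficient differs from
[12 kappa - 3] by at most 12 times the deviation of [rank_stat] from its mean,
plus [O(1 / n)]; the map [2 sin (pi / 6 .)] is [pi / 3]-Lipschitz. The
[O(1 / n)] terms are absorbed by assuming [n t^2] large: otherwise the
probability bound exceeds 1. The term [eta] pays for the discretization. *)
Lemma rank_corr_concentration (i j : 'I_p) (t eta : R) : i != j -> (1 < n)%N -> 0 <= t -> 0 < eta ->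
  exists A : set T, [/\ measurable A,
    (P (~` A) <= (4 * expR (- (n%:R * t ^+ 2 / (72 * 32 ^+ 2))) + eta)%:E)%E &
    forall w, A w -> `|rank_corr_mx (data_mx x w) i j - S i j| <= t].
Proof.
move=> ij n2 t0 e0.
have n0 : (0 < n)%N by exact: ltnW.
have n0' : 0 < n%:R :> R by rewrite ltr0n.
have r1 := pos_def_corr_lt1 hS hdiag ij.
set r := S i j in r1 *.
have [t3|t3] := leP 3 t.
  exists setT; split => //.
    by rewrite setCT measure0 lee_fin addr_ge0 ?(ltW e0) // mulr_ge0 ?expR_ge0.
  move=> w _; apply: le_trans t3; apply: le_trans (ler_normB _ _) _.
  by have := rank_corr_mx_le2 (data_mx x w) i j; lra.
(* 4 exp(- 672 / (72 * 32^2)) > 1 *)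
have [nt|nt] := ltP (n%:R * t ^+ 2) 672.
  exists set0; split => //.
  rewrite setC0 probability_setT lee_fin.
  have := expR_ge1Dx (- (n%:R * t ^+ 2 / (72 * 32 ^+ 2))); lra.
have nt1 : 224 <= n%:R * t.
  have : n%:R * t ^+ 2 <= n%:R * t * 3 by rewrite -[leRHS]mulrA ler_wpM2l ?(ltW n0') // expr2 ler_wpM2l // ltW.
  by move=> h; lra.
have [m m0 Hm] := exists_nat_gt (2 * n%:R ^+ 2 / eta).
pose N := (m + n)%N.
have N0 : (0 < N)%N by rewrite addn_gt0 m0.
have N0' : 0 < N%:R :> R by rewrite ltr0n.
have nN : n%:R <= N%:R :> R by rewrite ler_nat leq_addl.
have Ne : 2 * n%:R ^+ 2 / N%:R <= eta.
  rewrite ler_pdivrMr // -ler_pdivrMl // mulrC; apply/ltW/(lt_le_trans Hm).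
  by rewrite ler_nat leq_addr.
pose bin := 'I_(num_thresholds N).+1.
pose q := bin_law (P:=P) (X:=X) (f:=f) (N:=N) i j.
pose stat := @rank_stat R _ (fst_le (N:=N)) (snd_le (N:=N)) n.
(* 32 = (4 / 3) * 24, where pi <= 4 is used and the O(1 / n) terms double the main term *)
pose a := t / 32.
pose G (s : n.-tuple (bin * bin)) := (a <= `|stat s - prod_mean q stat|) || has_collision s.
have [mB PB] := sample_bins_event (N:=N) (f:=f) hx i j G.
have q0 b : 0 <= q b by exact: bin_law_ge0.
have q1 : \sum_b q b = 1 by exact: (bin_law_sum1 hf hg N i j).
exists (~` [set w | G (sample_bins (X:=X) (f:=f) (x:=x) N i j w)]); split.
- exact: measurableC.
- rewrite setCK; apply: le_trans PB _; rewrite lee_fin.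
  apply: (@le_trans _ _ (\sum_(s | a <= `|stat s - prod_mean q stat|) prod_mass q s +
      \sum_(s | has_collision s) prod_mass q s)).
    rewrite [leLHS]big_mkcond [X in _ <= X + _]big_mkcond [X in _ <= _ + X]big_mkcond -big_split /=.
    apply: ler_sum => s _; rewrite /G; have := prod_mass_ge0 q0 s.
    by case: (a <= _); case: (has_collision s) => //= h; rewrite ?addr0 ?add0r ?lerDl.
  apply: lerD; last by apply: le_trans Ne; exact: collision_mass.
  have c0 : 0 < 3 / n%:R :> R by rewrite divr_gt0.
  have ac : 0 <= a <= 2 * n%:R * (3 / n%:R).
    have -> : 2 * n%:R * (3 / n%:R) = 6 :> R by field; rewrite gt_eqF.
    by rewrite /a; lra.
  have := mcdiarmid q0 q1 n0 c0 ac (rank_stat_bounded_diff _ _ n0).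
  move=> /(_ (fst_le (N:=N)) (snd_le (N:=N))) /le_trans; apply.
  have -> : a ^+ 2 / (8 * n%:R * (3 / n%:R) ^+ 2) = n%:R * t ^+ 2 / (72 * 32 ^+ 2).
    by rewrite /a; field; rewrite gt_eqF.
  by rewrite ler_wpM2r ?expR_ge0 // ler_nat.
move=> w /negP; rewrite /G negb_or -ltNge => /andP[dev nc].
have [di dj] := no_collision_distinct nc.
set s := sample_bins _ _ _ w in dev nc.
pose D := data_mx x w.
have g01 : 0 <= stat s <= 1 by exact: rank_stat_itv.
have st := rank_sum_stat n2 (fun l l' => (order_of_bins nc l l').1) (fun l l' => (order_of_bins nc l l').2).
have sa := spearman_approx n2 di dj st g01.
have sm := rank_stat_mean q0 q1 (fst_le (N:=N)) (snd_le (N:=N)) n0.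
pose dd := Num.sqrt (1 - (r / 2) ^+ 2).
have r2 : 0 < 1 - (r / 2) ^+ 2.
  move: r1; rewrite ltr_norml => /andP[]; nra.
have d0 : 0 < dd by rewrite sqrtr_gt0.
have d2 : dd ^+ 2 = 1 - (r / 2) ^+ 2 by rewrite sqr_sqrtr // ltW.
pose kappa := (pi / 2 + atan (r / 2 / dd)) / (2 * pi).
have [] := bin_rank_mean_bounds hS hdiag hf hg N0 i j.
rewrite (gaussE_cdf hS (hdiag i) (hdiag j) (gauss_mass1 hg) d0 d2) -/kappa.
rewrite lee_fin => k1; change (kappa%:E + (3 / N%:R)%:E)%E with (kappa + 3 / N%:R)%:E.
rewrite lee_fin => k2.
have nN' : 3 / N%:R <= 3 / n%:R :> R by rewrite ler_wpM2l // lef_pV2 ?posrE.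
rewrite mxE -(spearman_pearson_bridge d0 d2) -/kappa -mulrBr normrM gtr0_norm //.
have p4 : pi <= 4 :> R by have := pihalf_lt2 R; lra.
have p0 := pi_ge0 R.
apply: (@le_trans _ _ (2 * (pi / 6 * `|spearman D i j - (12 * kappa - 3)|))).
  rewrite ler_wpM2l //; apply: le_trans (sin_lipschitz _ _) _.
  by rewrite -mulrBr normrM ger0_norm ?divr_ge0.
have B : `|spearman D i j - (12 * kappa - 3)| <= 12 * a + 84 / n%:R.
  move: sa sm dev k1 k2 nN'; rewrite !ler_norml ltr_norml -/stat -/q -/s -/D.
  move: (spearman _ _ _) (stat s) (prod_mean _ _) (rank_mean _ _ _) => sp g mu rm.
  have -> : 12 / n%:R = 4 * (3 / n%:R) :> R by ring.
  have -> : 84 / n%:R = 28 * (3 / n%:R) :> R by ring.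
  move: (3 / N%:R : R) (3 / n%:R : R) => e e'; rewrite /=; lra.
(* 84 / n collects the errors of [spearman_approx], [rank_stat_mean] and [bin_rank_mean_bounds] *)
have B2 : 84 / n%:R <= 12 * a :> R.
  rewrite ler_pdivrMr // /a; lra.
have : 0 <= `|spearman D i j - (12 * kappa - 3)| by [].
move: B; move: `|_| => y B y0.
have : pi * y <= 4 * y by rewrite ler_wpM2r.
by rewrite /a in B B2; lra.
Qed.

End pair_concentration.

(** * Deterministic analysis of CLIME *)

Section norms.
Context {R : realType} {p : nat}.
Implicit Types A B : 'M[R]_p.

Lemma mx_norm_leP A c : 0 <= c -> (forall i j, `|A i j| <= c) -> mx_norm A <= c.
Proof.
by move=> c0 h; rewrite mx_normrE; apply/bigmax_leP; split=> // -[i j] _; exact: h.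
Qed.

Lemma entry_le_mx_norm A i j : `|A i j| <= mx_norm A.
Proof. by rewrite mx_normrE; exact: (le_bigmax _ (fun ij => `|A ij.1 ij.2|) (i, j)). Qed.

Lemma mx_norm_ge0 A : 0 <= mx_norm A.
Proof. exact: (normr_ge0 A). Qed.

Lemma l1_norm_ge0 A : 0 <= l1_norm A.
Proof. exact: bigmax_ge_id. Qed.

Lemma l1_norm_col A j : \sum_i `|A i j| <= l1_norm A.
Proof. exact: (le_bigmax _ (fun j => \sum_i `|A i j|) j). Qed.

Lemma mulmx_entry_le_col A B a b i j : 0 <= a -> (forall k, `|A i k| <= a) -> \sum_k `|B k j| <= b ->
  `|(A *m B) i j| <= a * b.
Proof.
move=> a0 ha hb; rewrite mxE; apply: le_trans (ler_norm_sum _ _ _) _.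
apply: (@le_trans _ _ (\sum_k a * `|B k j|)).
  by apply: ler_sum => k _; rewrite normrM ler_wpM2r.
by rewrite -mulr_sumr ler_wpM2l.
Qed.

Lemma mulmx_entry_le_row A B a b i j : 0 <= a -> (forall k, `|B k j| <= a) -> \sum_k `|A i k| <= b ->
  `|(A *m B) i j| <= b * a.
Proof.
move=> a0 ha hb; rewrite mxE; apply: le_trans (ler_norm_sum _ _ _) _.
apply: (@le_trans _ _ (\sum_k `|A i k| * a)).
  by apply: ler_sum => k _; rewrite normrM ler_wpM2l.
by rewrite -mulr_suml ler_wpM2r.
Qed.

Lemma sum_norm_col A : sum_norm A = \sum_j \sum_i `|A i j|.
Proof. exact: exchange_big. Qed.

(** A column of a solution can be replaced by that of any feasible matrix, since
the constraint acts on each column separately. *)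
Lemma clime_column_optimal (Rh : 'M[R]_p) lam (Th Th' : 'M[R]_p) (k : 'I_p) :
  clime_solution Rh lam Th -> clime_feasible Rh lam Th' ->
  \sum_i `|Th i k| <= \sum_i `|Th' i k|.
Proof.
move=> [fT oT] fT'; pose W : 'M[R]_p := \matrix_(i, j) if j == k then Th' i j else Th i j.
have lam0 : 0 <= lam by exact: le_trans (mx_norm_ge0 _) fT.
have fW : clime_feasible Rh lam W.
  apply: mx_norm_leP => // i j.
  have E : (Rh *m W - 1%:M) i j = if j == k then (Rh *m Th' - 1%:M) i j else (Rh *m Th - 1%:M) i j.
    rewrite !mxE; case: ifP => jk; congr (_ + _); apply: eq_bigr => l _; by rewrite mxE jk.
  rewrite E; case: ifP => _.
    exact: le_trans (entry_le_mx_norm _ _ _) fT'.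
  exact: le_trans (entry_le_mx_norm _ _ _) fT.
have := oT W fW; rewrite !sum_norm_col (bigD1 k) //= [leRHS](bigD1 k) //=.
have -> : \sum_(j | j != k) \sum_i `|W i j| = \sum_(j | j != k) \sum_i `|Th i j|.
  by apply: eq_bigr => j /negbTE jk; apply: eq_bigr => i _; rewrite mxE jk.
rewrite lerD2r; move=> /le_trans; apply.
by apply: ler_sum => i _; rewrite mxE eqxx.
Qed.

(** The feasible matrices with objective at most that of [Th0] form a compact
set. *)
Lemma clime_exists (Rh : 'M[R]_p) lam (Th0 : 'M[R]_p) : clime_feasible Rh lam Th0 ->
  exists Th, clime_solution Rh lam Th.
Proof.
move=> f0.
have lam0 : 0 <= lam by exact: le_trans (mx_norm_ge0 _) f0.
pose V := 'rV[R]_(p * p).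
pose K : set V := [set v | (forall ij : 'I_p * 'I_p, `|(Rh *m vec_mx v - 1%:M) ij.1 ij.2| <= lam)] `&`
  [set v | sum_norm (vec_mx v) <= sum_norm Th0].
have cont_coord (i j : 'I_p) : continuous (fun v : V => (vec_mx v) i j : R).
  move=> v; rewrite (_ : (fun v => _) = (fun v : V => v 0 (mxvec_index i j))).
    exact: coord_continuous.
  by apply/funext => u; rewrite mxE.
have cont_sum : continuous (fun v : V => sum_norm (vec_mx v) : R).
  apply: continuous_big => [|i _]; first exact: add_continuous.
  apply: continuous_big => [|j _]; first exact: add_continuous.
  by move=> v; exact: (cvg_norm (cont_coord i j v)).
have cont_entry (i j : 'I_p) : continuous (fun v : V => (Rh *m vec_mx v - 1%:M) i j : R).
  have -> : (fun v : V => (Rh *m vec_mx v - 1%:M) i j) =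
      (fun v : V => \sum_k Rh i k * (vec_mx v) k j - (1%:M : 'M[R]_p) i j).
    by apply/funext => u; rewrite !mxE.
  have cs : continuous (fun v : V => \sum_k Rh i k * (vec_mx v) k j : R).
    apply: continuous_big => [|k _]; first exact: add_continuous.
    by move=> u; exact: (cvgM (cvg_cst _) (cont_coord k j u)).
  by move=> v; exact: (cvgB (cs v) (cvg_cst _)).
have cont_lin (ij : 'I_p * 'I_p) : continuous (fun v : V => `|(Rh *m vec_mx v - 1%:M) ij.1 ij.2| : R).
  by move=> v; exact: (cvg_norm (cont_entry ij.1 ij.2 v)).
have K0 : K !=set0.
  exists (mxvec Th0); split => /=; rewrite mxvecK // => ij.
  exact: le_trans (entry_le_mx_norm _ _ _) f0.
have cK : compact K.
  have box : compact [set v : V | forall k, [set` `[- sum_norm Th0, sum_norm Th0]] (v ord0 k)].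
    by apply: (@rV_compact R _ (fun=> [set` `[- sum_norm Th0, sum_norm Th0]])) => k; exact: segment_compact.
  apply: subclosed_compact box _.
    apply: closedI.
      rewrite (_ : [set v | _] = \bigcap_(ij in [set: 'I_p * 'I_p])
        ((fun v : V => `|(Rh *m vec_mx v - 1%:M) ij.1 ij.2| : R) @^-1` [set r | r <= lam])).
        apply: closed_bigI => ij _.
        by move/continuous_closedP: (cont_lin ij); apply; exact: closed_le.
      by apply/seteqP; split => v /= h ij; [move=> _|]; exact: h.
    change (closed ((fun v : V => sum_norm (vec_mx v) : R) @^-1` [set r | r <= sum_norm Th0])).
    by move/continuous_closedP: cont_sum; apply; exact: closed_le.
  move=> v [_ /= hv] k; rewrite /= in_itv /= -ler_norml.
  apply: le_trans hv; case/mxvec_indexP: k => i j.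
  have -> : v ord0 (mxvec_index i j) = vec_mx v i j by rewrite mxE.
  rewrite /sum_norm (bigD1 i) //= (bigD1 j) //= -addrA lerDl addr_ge0 // sumr_ge0 // => l _.
  exact: sumr_ge0.
have [v /set_mem[fv sv] mv] := compact_EVT_min K0 cK (continuous_subspaceT cont_sum).
exists (vec_mx v); split; first by apply: mx_norm_leP => // i j; exact: (fv (i, j)).
move=> Th' fT'; have [h|/ltW h] := leP (sum_norm Th') (sum_norm Th0); last exact: le_trans sv h.
have := mv (mxvec Th'); rewrite mxvecK; apply; apply/mem_set; split => /=; rewrite mxvecK //.
by move=> ij; exact: le_trans (entry_le_mx_norm _ _ _) fT'.
Qed.

End norms.

Section clime_deterministic.
Context {R : realType} {p : nat} (S : 'M[R]_p).
Hypotheses (uS : S \in unitmx) (SS : S^T = S).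
Notation Theta := (invmx S).
Notation M := (l1_norm Theta).

Lemma l1_norm_inv_row i : \sum_k `|Theta i k| <= M.
Proof.
have E : Theta^T = Theta by rewrite trmx_inv SS.
apply: le_trans (l1_norm_col Theta i); apply: ler_sum => k _.
by rewrite -[in leLHS]E mxE.
Qed.

Lemma clime_feasible_inv (Rh : 'M[R]_p) (t lam : R) : 0 <= t -> M * t <= lam ->
  (forall i j, `|Rh i j - S i j| <= t) -> clime_feasible Rh lam Theta.
Proof.
move=> t0 Mt h.
have lam0 : 0 <= lam by apply: le_trans Mt; rewrite mulr_ge0 ?l1_norm_ge0.
apply: mx_norm_leP => // i j.
have -> : Rh *m Theta - 1%:M = (Rh - S) *m Theta by rewrite mulmxBl mulmxV.
apply: le_trans Mt; rewrite mulrC; apply: mulmx_entry_le_col => //; last exact: l1_norm_col.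
by move=> k; rewrite !mxE.
Qed.

(** Insert [S^-1 S = 1]: the error is [S^-1] times
[(Rhat Th - 1) - (Rhat - S) Th]. The first part is at most [lam] by
feasibility of [Th]; so is the second, since the columns of [Th] have l1 norm at most [M] by
optimality. *)
Lemma clime_error (Rh : 'M[R]_p) (t lam : R) (Th : 'M[R]_p) : 0 <= t -> M * t <= lam ->
  (forall i j, `|Rh i j - S i j| <= t) -> clime_solution Rh lam Th ->
  mx_norm (Th - Theta) <= 2 * M * lam.
Proof.
move=> t0 Mt h sT.
have lam0 : 0 <= lam by apply: le_trans Mt; rewrite mulr_ge0 ?l1_norm_ge0.
have M0 := l1_norm_ge0 Theta.
have fT := clime_feasible_inv t0 Mt h.
have [fTh _] := sT.
apply: mx_norm_leP => [|i j]; first by rewrite !mulr_ge0.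
have -> : Th - Theta = Theta *m ((Rh *m Th - 1%:M) - (Rh - S) *m Th).
  have -> : Rh *m Th - 1%:M - (Rh - S) *m Th = S *m Th - 1%:M.
    by rewrite mulmxBl opprB addrC addrA subrK.
  by rewrite mulmxBr mulmx1 mulmxA mulVmx // mul1mx.
rewrite [2 * M]mulrC -mulrA; apply: mulmx_entry_le_row; last exact: l1_norm_inv_row.
  by rewrite mulr_ge0.
move=> k; rewrite mxE [X in _ + X]mxE.
have -> : 2 * lam = lam + lam by ring.
apply: le_trans (ler_normB _ _) _; apply: lerD.
  exact: le_trans (entry_le_mx_norm _ _ _) fTh.
apply: le_trans Mt; rewrite mulrC; apply: mulmx_entry_le_col => //.
  by move=> l; rewrite !mxE.
exact: le_trans (clime_column_optimal j sT fT) (l1_norm_col _ _).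
Qed.

(** A vector [v] with [v Rhat = 0] satisfies [v = v (S - Rhat) S^-1], whose sup
norm is at most half that of [v]. *)
Lemma perturbed_unitmx (Rh : 'M[R]_p) (t : R) : 0 <= t -> M * (t * p%:R) <= 1 / 2 ->
  (forall i j, `|Rh i j - S i j| <= t) -> Rh \in unitmx.
Proof.
move=> t0 Mt h; rewrite -row_free_unit -kermx_eq0; apply/rowV0P => v /sub_kermxP vR.
have M0 := l1_norm_ge0 Theta.
have E : v = v *m (S - Rh) *m Theta by rewrite mulmxBr vR subr0 mulmxK.
pose m := \big[Num.max/0]_k `|v 0 k|.
have vm k : `|v 0 k| <= m by exact: (le_bigmax _ (fun k => `|v 0 k|) k).
have m0 : 0 <= m by exact: bigmax_ge_id.
have B k : `|(v *m (S - Rh)) 0 k| <= m * (t * p%:R).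
  rewrite mxE; apply: le_trans (ler_norm_sum _ _ _) _.
  apply: (@le_trans _ _ (\sum_(l < p) m * t)).
    by apply: ler_sum => l _; rewrite normrM ler_pM // !mxE distrC.
  by rewrite sumr_const card_ord mulrA mulr_natr.
have m2 : m <= m / 2.
  apply/bigmax_leP; split => [|k _]; first by rewrite divr_ge0.
  rewrite [in leLHS]E mxE; apply: le_trans (ler_norm_sum _ _ _) _.
  apply: (@le_trans _ _ (\sum_l m * (t * p%:R) * `|Theta l k|)).
    by apply: ler_sum => l _; rewrite normrM ler_wpM2r.
  rewrite -mulr_sumr; apply: (@le_trans _ _ (m * (t * p%:R) * M)).
    by rewrite ler_wpM2l ?mulr_ge0 // l1_norm_col.
  by rewrite -mulrA ler_wpM2l // mulrC; lra.
have m00 : m = 0 by lra.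
by apply/rowP => k; apply/eqP; rewrite mxE -normr_le0 -m00.
Qed.

(** A bound that holds for every feasible [Th], even if the true precision matrix
is not feasible. In the identity of [clime_error], [Th] is split as the truth
plus the error; the contribution of the error is at most half of it and is
moved to the left-hand side. *)
Lemma clime_error_robust (Rh : 'M[R]_p) (t lam : R) (Th : 'M[R]_p) : 0 <= t -> 0 <= lam -> M * (t * p%:R) <= 1 / 2 ->
  (forall i j, `|Rh i j - S i j| <= t) -> clime_solution Rh lam Th ->
  mx_norm (Th - Theta) <= 2 * M * (lam + M * t).
Proof.
move=> t0 lam0 Mt h [fT _].
have M0 := l1_norm_ge0 Theta.
set E := Th - Theta; pose e := mx_norm E.
have e0 : 0 <= e by exact: mx_norm_ge0.
have EE : E = Theta *m ((Rh *m Th - 1%:M) - (Rh - S) *m Theta - (Rh - S) *m E).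
  have -> : (Rh *m Th - 1%:M) - (Rh - S) *m Theta - (Rh - S) *m E = S *m Th - 1%:M.
    rewrite -addrA -opprD -mulmxDr /E [invmx S + _]addrC subrK mulmxBl opprB.
    by rewrite addrC addrA subrK.
  by rewrite mulmxBr mulmx1 mulmxA mulVmx // mul1mx.
have : e <= M * (lam + M * t + t * p%:R * e).
  apply: mx_norm_leP => [|i j]; first by rewrite mulr_ge0 ?addr_ge0 ?mulr_ge0.
  rewrite EE; apply: mulmx_entry_le_row; last exact: l1_norm_inv_row.
    by rewrite ?addr_ge0 ?mulr_ge0.
  move=> k; rewrite mxE [X in _ + X]mxE mxE [X in _ + X + _]mxE.
  apply: le_trans (ler_normB _ _) _; apply: lerD.
    apply: le_trans (ler_normB _ _) _; apply: lerD.
      exact: le_trans (entry_le_mx_norm _ _ _) fT.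
    rewrite mulrC; apply: mulmx_entry_le_col => //; last exact: l1_norm_col.
    by move=> l; rewrite !mxE.
  rewrite -mulrA; apply: mulmx_entry_le_col => //; first by move=> l; rewrite !mxE.
  apply: (@le_trans _ _ (\sum_(l < p) e)); last by rewrite sumr_const card_ord mulr_natl.
  by apply: ler_sum => l _; exact: entry_le_mx_norm.
have : M * (t * p%:R) * e <= 1 / 2 * e by rewrite ler_wpM2r.
move: (l1_norm _) M0 => m m0; rewrite -/e; move: e e0 => e e0; nra.
Qed.

Lemma l1_norm_inv_ge1 : (0 < p)%N -> (forall i j, `|S i j| <= 1) -> 1 <= M.
Proof.
move=> p0 h; pose i := Ordinal p0.
have := mulmxV uS => /matrixP/(_ i i); rewrite [RHS]mxE eqxx /= => E.
rewrite -[leLHS]normr1 -[X in `|X|]E -[leRHS]mul1r.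
by apply: mulmx_entry_le_col => //; exact: l1_norm_col.
Qed.

End clime_deterministic.

(** * Probabilistic bounds and the theorem *)

Section union_bound.
Context {R : realType} {d : measure_display} {T : measurableType d} (P : probability T R).

Lemma union_bound (I : eqType) (s : seq I) (b : I -> R) (Q : I -> set T) :
  (forall i, exists A : set T,
     [/\ measurable A, (P (~` A) <= (b i)%:E)%E & A `<=` Q i]) ->
  exists A : set T, [/\ measurable A, (P (~` A) <= (\sum_(i <- s) b i)%:E)%E &
    forall i, i \in s -> A `<=` Q i].
Proof.
move=> h; elim: s => [|i s [A [mA PA QA]]].
  by exists setT; split => //; rewrite setCT measure0 big_nil.
have [B [mB PB QB]] := h i.
exists (B `&` A); split; first exact: measurableI.
  rewrite setCI big_cons EFinD; apply: le_trans (leeD PB PA).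
  by apply: measureU2; exact: measurableC.
move=> j; rewrite inE => /predU1P[->|js] w [Bw Aw]; [exact: QB|exact: (QA j)].
Qed.

Lemma with_prob_at_least_compl (q : R) (A E : set T) :
  measurable A -> (P (~` A) <= (1 - q)%:E)%E -> A `<=` E -> with_prob_at_least P q E.
Proof.
move=> mA PA AE; exists A; split => //.
have mC := measurableC mA.
have := probability_setC P mC; rewrite setCK => ->.
have fC : P (~` A) \is a fin_num by exact: fin_num_measure.
move: PA; rewrite -(fineK fC) -EFinB !lee_fin; lra.
Qed.

End union_bound.

Section model.
Context {R : realType} {n p : nat} {d : measure_display} {T : measurableType d}
  {P : probability T R} {S : 'M[R]_p} {X : {RV P >-> p.-tuple R}}
  {x : 'I_n -> {RV P >-> p.-tuple R}}.
Hypotheses (hX : nonparanormal X S) (hx : iid_copies X x).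

(** Union bound over the entries. A diagonal entry is exactly 1 as soon as the
variable has no ties, hence the factor [p^2 - p]. *)
Lemma rank_corr_mx_concentration (t eta : R) : (1 < n)%N -> 0 <= t -> 0 < eta ->
  exists A : set T, [/\ measurable A,
    (P (~` A) <= (4 * (p%:R ^+ 2 - p%:R) * expR (- (n%:R * t ^+ 2 / (72 * 32 ^+ 2))) + eta)%:E)%E &
    forall w, A w -> forall i j, `|rank_corr_mx (data_mx x w) i j - S i j| <= t].
Proof.
move=> n2 t0 eta0; have [hS hdiag [f [hf hg]]] := hX.
pose u : R := expR (- (n%:R * t ^+ 2 / (72 * 32 ^+ 2))).
pose e := eta / (p%:R ^+ 2 + 1).
have p20 : 0 < p%:R ^+ 2 + 1 :> R by rewrite ltr_wpDl ?exprn_ge0.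
have e0 : 0 < e by rewrite divr_gt0.
pose b (ij : 'I_p * 'I_p) : R := 4 * u - 4 * u * (ij.2 == ij.1)%:R + e.
have [|A [mA PA QA]] := @union_bound R d T P ('I_p * 'I_p)%type (index_enum _) b
    (fun ij => [set w | `|rank_corr_mx (data_mx x w) ij.1 ij.2 - S ij.1 ij.2| <= t]).
  move=> [i j]; rewrite /b /=; have [->|ji] := eqVneq j i.
    have [A [mA PA hA]] := distinct_col_whp hS hdiag hf hg hx i e0.
    exists A; split => //; first by rewrite mulr1 subrr add0r.
    by move=> w /hA dw /=; rewrite rank_corr_mx_diag // hdiag subrr normr0.
  have ij : i != j by rewrite eq_sym.
  have [A [mA PA hA]] := rank_corr_concentration hS hdiag hf hg hx ij n2 t0 e0.
  by exists A; split => //; rewrite mulr0 subr0.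
exists A; split => //; last first.
  by move=> w Aw i j; apply: (QA (i, j)) => //; exact: mem_index_enum.
apply: le_trans PA _; rewrite lee_fin -(pair_bigA _ (fun i j => b (i, j))) /= /b /=.
under eq_bigr do rewrite big_split /= sumrB 2!sum_cst_ord -mulr_sumr sum_eq_ord.
rewrite sum_cst_ord -/u.
have -> : p%:R * (p%:R * (4 * u) - 4 * u * 1 + p%:R * e) = 4 * (p%:R ^+ 2 - p%:R) * u + p%:R ^+ 2 * e by ring.
by rewrite lerD2l /e mulrA ler_pdivrMr // mulrC ler_wpM2l ?(ltW eta0) // lerDl.
Qed.

Lemma corr_norm_le1 i j : `|S i j| <= 1.
Proof.
have [hS hdiag _] := hX; have [->|ij] := eqVneq i j; first by rewrite hdiag normr1.
exact: ltW (pos_def_corr_lt1 hS hdiag ij).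
Qed.

Notation M := (l1_norm (invmx S)).

Lemma precision_l1_norm_ge1 : (0 < p)%N -> 1 <= M.
Proof.
have [hS _ _] := hX; move=> p0.
exact: (l1_norm_inv_ge1 (pos_def_unitmx hS) p0 corr_norm_le1).
Qed.

Context {lam : R} {Th : T -> 'M[R]_p}.
Hypothesis hTh : rank_clime x lam Th.

Lemma rank_clime_error (t : R) w : 0 <= t -> M * t <= lam ->
  (forall i j, `|rank_corr_mx (data_mx x w) i j - S i j| <= t) ->
  mx_norm (Th w - invmx S) <= 2 * M * lam.
Proof.
move=> t0 Mt ht; have [[SS pS] _ _] := hX; have uS := pos_def_unitmx (conj SS pS).
apply: (clime_error uS SS t0 Mt ht); apply: hTh.
exact: clime_exists (clime_feasible_inv uS t0 Mt ht).
Qed.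

Lemma rank_clime_error_robust (t : R) w : 0 <= t -> 0 <= lam -> M * (t * p%:R) <= 1 / 2 ->
  (forall i j, `|rank_corr_mx (data_mx x w) i j - S i j| <= t) ->
  mx_norm (Th w - invmx S) <= 2 * M * (lam + M * t).
Proof.
move=> t0 lam0 Mt ht; have [[SS pS] _ _] := hX; have uS := pos_def_unitmx (conj SS pS).
apply: (clime_error_robust uS SS t0 lam0 Mt ht); apply: hTh.
apply: (@clime_exists _ _ _ _ (invmx (rank_corr_mx (data_mx x w)))).
have uR := perturbed_unitmx uS t0 Mt ht.
rewrite /clime_feasible mulmxV //.
by rewrite subrr; apply: mx_norm_leP => // i j; rewrite mxE normr0.
Qed.

(** Take [t = lam / M], the largest deviation for which the truth stays feasible,
and let [u = exp(- c0 n t^2)]. The probability of failure is at most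
[4 (p^2 - p) u^2 + p u] for [eta = p u]. If [p^2 u >= 1] there is nothing to
prove; otherwise [4 u <= 1] for [p >= 2] and the sum is at most [p^2 u]. *)
Lemma rank_clime_error_nonasymptotic :
  12 * pi * M <= n%:R * lam ->
  with_prob_at_least P
    (1 - p%:R ^+ 2 * expR (- ((72 * 32 ^+ 2)^-1 / 2 / M ^+ 2 * n%:R * lam ^+ 2)))
    [set w | mx_norm (Th w - invmx S) <= 2 * M * lam].
Proof.
move=> hlam; have pi2 : 2 <= pi :> R := pi_ge2 R.
have [p0|p0] := posnP p.
  have M0 : M = 0.
    apply/le_anti; rewrite l1_norm_ge0 andbT /l1_norm.
    by apply/bigmax_leP; split => // j; have := ltn_ord j; rewrite {2}p0.
  apply: (@with_prob_at_least_compl _ _ _ _ _ setT) => //.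
    by rewrite setCT measure0 lee_fin subKr mulr_ge0 ?exprn_ge0 ?expR_ge0.
  move=> w _ /=; rewrite M0 mulr0 mul0r; apply: mx_norm_leP => // i.
  by have := ltn_ord i; rewrite {2}p0.
have M1 := precision_l1_norm_ge1 p0.
have M0 : 0 < M by exact: lt_le_trans M1.
have n0 : (0 < n)%N.
  case: posnP hlam => // ->; rewrite mul0r => /(lt_le_trans _)-/(_ 0).
  by rewrite ltxx => ->//; rewrite !mulr_gt0 // pi_gt0.
have nR0 : 0 < n%:R :> R by rewrite ltr0n.
pose t := lam / M.
have nt : 12 * pi <= n%:R * t by rewrite /t mulrA ler_pdivlMr.
have t0 : 0 <= t.
  by rewrite -(pmulr_rge0 _ nR0); apply: le_trans nt; rewrite mulr_ge0 ?pi_ge0.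
have Mt : M * t = lam by rewrite /t mulrC divfK ?gt_eqF.
have -> : (72 * 32 ^+ 2)^-1 / 2 / M ^+ 2 * n%:R * lam ^+ 2 = (n%:R * t ^+ 2 / (72 * 32 ^+ 2)) / 2.
  rewrite -Mt; move: M0 => /lt0r_neq0; generalize (l1_norm (invmx S)) => m m0.
  by field.
set u := expR _.
have u0 : 0 < u by exact: expR_gt0.
have uu : expR (- (n%:R * t ^+ 2 / (72 * 32 ^+ 2))) = u ^+ 2.
  by rewrite /u -expRM_natl; congr expR; field.
case: (ltnP 1 n) => [n2|n1]; last first.
  (* a single observation: the two correlations are at distance at most 3 *)
  apply: (@with_prob_at_least_compl _ _ _ _ _ setT) => //.
    by rewrite setCT measure0 lee_fin subKr mulr_ge0 ?exprn_ge0 // ltW.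
  move=> w _ /=; apply: (@rank_clime_error t) => // [|i j]; first by rewrite Mt.
  have n1' : n%:R = 1 :> R by move: n0 n1; case: (n) => [|[]].
  apply: (@le_trans _ _ 3); last by move: nt; rewrite n1' mul1r; lra.
  apply: le_trans (ler_normB _ _) _.
  have := rank_corr_mx_le2 (data_mx x w) i j; have := corr_norm_le1 i j; lra.
(* the empty event has the required probability in the first case *)
have [big|small] := leP 1 (p%:R ^+ 2 * u).
  apply: (@with_prob_at_least_compl _ _ _ _ _ set0) => //.
  by rewrite setC0 probability_setT lee_fin subKr.
have pR : 1 <= p%:R :> R by rewrite ler1n.
have pu0 : 0 < p%:R * u by rewrite mulr_gt0 // ltr0n.
have [A [mA PA hA]] := rank_corr_mx_concentration n2 t0 pu0.
apply: (with_prob_at_least_compl mA) => [|w /hA ht].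
  apply: le_trans PA _; rewrite lee_fin uu subKr.
  have [p1|p1] := leqP p 1.
    have -> : p%:R = 1 :> R by move: p0 p1; case: (p) => [|[]].
    lra.
  have pR2 : 2 <= p%:R :> R by rewrite ler_nat.
  have u4 : 4 * u <= 1.
    have p4 : 4 <= p%:R ^+ 2 :> R by move: (p%:R : R) pR2 => q q2; rewrite expr2; nra.
    by apply: le_trans (ltW small); rewrite ler_wpM2r // ltW.
  have : (p%:R ^+ 2 - p%:R) * u * (4 * u) <= (p%:R ^+ 2 - p%:R) * u * 1.
    by rewrite ler_wpM2l // mulr_ge0 ?ltW //; nra.
  lra.
by apply: (rank_clime_error t0) => //; rewrite Mt.
Qed.

(** With [t = C0 rate] the exponential is [p^-6], and
[4 (p^2 - p) p^-6 <= eps / 2] when [p >= 1 / eps]. *)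
Lemma rank_clime_error_many (eps C0 : R) : let rate := Num.sqrt (ln p%:R / n%:R) in
  (1 < n)%N -> (1 < p)%N -> 0 < eps -> 1 <= p%:R * eps ->
  0 <= C0 -> C0 ^+ 2 = 6 * (72 * 32 ^+ 2) -> C0 * M * rate <= lam ->
  with_prob_at_least P (1 - eps) [set w | mx_norm (Th w - invmx S) <= 2 * M * lam].
Proof.
move=> rate n2 p2 eps0 peps C00 C0E hlam.
have M1 := precision_l1_norm_ge1 (ltnW p2).
have M0 : 0 < M by exact: lt_le_trans M1.
have n0 : 0 < n%:R :> R by rewrite ltr0n (ltnW n2).
have pR2 : 2 <= p%:R :> R by rewrite ler_nat.
have p0 : 0 < p%:R :> R by exact: lt_le_trans pR2.
have lnp0 : 0 <= ln p%:R :> R by rewrite ln_ge0 // ler1n (ltnW p2).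
have rate0 : 0 <= rate by exact: sqrtr_ge0.
have rateE : n%:R * rate ^+ 2 = ln p%:R.
  rewrite sqr_sqrtr; last by rewrite divr_ge0 // ltW.
  by rewrite mulrC divfK ?gt_eqF.
have e20 : 0 < eps / 2 by rewrite divr_gt0.
pose t := C0 * rate.
have t0 : 0 <= t by exact: mulr_ge0.
have [A [mA PA hA]] := rank_corr_mx_concentration n2 t0 e20.
apply: (with_prob_at_least_compl mA) => [|w /hA ht]; last first.
  by apply: (rank_clime_error t0) => //; rewrite /t mulrA [M * C0]mulrC.
apply: le_trans PA _; rewrite lee_fin.
have -> : n%:R * t ^+ 2 / (72 * 32 ^+ 2) = 6%:R * ln p%:R.
  by rewrite /t exprMn C0E -rateE; field.
rewrite -mulrN expRM_natl expRN lnK ?posrE // exprVn.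
set q : R := p%:R in pR2 p0 peps *.
have q0 : q != 0 by rewrite gt_eqF.
have : 4 * (q ^+ 2 - q) / q ^+ 6 <= eps / 2.
  rewrite ler_pdivrMr ?exprn_gt0 //.
  apply: (@le_trans _ _ (q ^+ 5 / 2)).
    have q3 : 8 <= q ^+ 3 
      by rewrite (_ : 8 = 2 ^+ 3 :> R); [rewrite lerXn2r // nnegrE ltW|ring].
    have : q ^+ 2 * 8 <= q ^+ 2 * q ^+ 3 by rewrite ler_wpM2l // exprn_ge0 // ltW.
    rewrite -exprD; lra.
  rewrite (_ : eps / 2 * q ^+ 6 = (q ^+ 5 / 2) * (q * eps)); last by field.
  by rewrite ler_peMr // divr_ge0 // exprn_ge0 // ltW.
by rewrite subKr; lra.
Qed.

(** The exponential is [exp (- L) <= 1 / L], and [L >= 8 / eps^3] makes up for the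
at most [1 / eps^2] pairs. Such a [t] is of order [n^(-1/2)] and need not be
below [lam / M], whence the robust error bound. *)
Lemma rank_clime_error_few (eps L : R) :
  let t := Num.sqrt (L * (72 * 32 ^+ 2) / n%:R) in
  (1 < n)%N -> 0 < eps -> p%:R * eps <= 1 -> 8 <= L * eps ^+ 3 -> 0 <= lam ->
  M * t <= eps / 2 ->
  with_prob_at_least P (1 - eps)
    [set w | mx_norm (Th w - invmx S) <= 2 * M * (lam + M * t)].
Proof.
move=> t n2 eps0 peps hL lam0 hM.
have n0 : 0 < n%:R :> R by rewrite ltr0n (ltnW n2).
have e20 : 0 < eps / 2 by rewrite divr_gt0.
have e30 : 0 < eps ^+ 3 by rewrite exprn_gt0.
have L0 : 0 < L by rewrite -(pmulr_lgt0 _ e30); apply: lt_le_trans hL.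
have t0 : 0 <= t by exact: sqrtr_ge0.
have [A [mA PA hA]] := rank_corr_mx_concentration n2 t0 e20.
apply: (with_prob_at_least_compl mA) => [|w /hA ht]; last first.
  apply: (rank_clime_error_robust t0) => //; rewrite mulrA.
  apply: (@le_trans _ _ (eps / 2 * p%:R)); first by rewrite ler_wpM2r.
  lra.
apply: le_trans PA _; rewrite lee_fin.
have -> : n%:R * t ^+ 2 / (72 * 32 ^+ 2) = L.
  rewrite sqr_sqrtr; last by rewrite divr_ge0 ?mulr_ge0 ?exprn_ge0 // ltW.
  by move: (n%:R : R) n0 => m /lt0r_neq0 m0; field.
have eL : expR (- L) <= eps ^+ 3 / 8.
  rewrite expRN; apply: (@le_trans _ _ L^-1).
    by rewrite lef_pV2 ?posrE ?expR_gt0 //; have := expR_ge1Dx L; lra.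
  by rewrite -div1r ler_pdivrMr // -(mulrC L) mulrA ler_pdivlMr // mul1r.
have : 4 * (p%:R ^+ 2 - p%:R) * expR (- L) <= 4 * p%:R ^+ 2 * (eps ^+ 3 / 8).
  apply: (@le_trans _ _ (4 * p%:R ^+ 2 * expR (- L))).
    by rewrite ler_wpM2r ?expR_ge0 // ler_wpM2l // gerBl.
  by rewrite ler_wpM2l // mulr_ge0 ?exprn_ge0.
rewrite (_ : 4 * p%:R ^+ 2 * (eps ^+ 3 / 8) = (p%:R * eps) ^+ 2 * (eps / 2)); last by field.
have : (p%:R * eps) ^+ 2 * (eps / 2) <= 1 * (eps / 2).
  by rewrite ler_wpM2r ?(ltW e20) // exprn_ile1 // mulr_ge0 ?(ltW eps0).
by rewrite subKr; lra.
Qed.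

(** A single variable has no off-diagonal entry, so the rank correlation matrix
is exact unless there is a tie. *)
Lemma rank_clime_error_one (eps : R) : (1 < n)%N -> (p <= 1)%N -> 0 < eps -> 0 <= lam ->
  with_prob_at_least P (1 - eps) [set w | mx_norm (Th w - invmx S) <= 2 * M * lam].
Proof.
move=> n2 p1 eps0 lam0.
have [A [mA PA hA]] := rank_corr_mx_concentration n2 (lexx 0) eps0.
apply: (with_prob_at_least_compl mA) => [|w /hA ht]; last first.
  by apply: (rank_clime_error (lexx 0)) => //; rewrite mulr0.
apply: le_trans PA _; rewrite lee_fin subKr.
have -> : p%:R ^+ 2 - p%:R = 0 :> R by move: p1; case: (p) => [|[]] // _; ring.
by rewrite mulr0 mul0r add0r.
Qed.

End model.

Lemma with_prob_at_least_sub (R : realType) (d : measure_display) (T : measurableType d)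
    (P : probability T R) (q : R) (E F : set T) :
  E `<=` F -> with_prob_at_least P q E -> with_prob_at_least P q F.
Proof. by move=> EF [A [mA AE PA]]; exists A; split => //; exact: subset_trans EF. Qed.

Theorem theorem4 (R : realType) :
  exists c0 C0 : R, [/\ 0 < c0, 0 < C0,
    (forall (n p : nat) (d : measure_display) (T : measurableType d)
        (P : probability T R) (S : 'M[R]_p)
        (X : {RV P >-> p.-tuple R}) (x : 'I_n -> {RV P >-> p.-tuple R})
        (lam : R) (Th : T -> 'M[R]_p),
      let M := l1_norm (invmx S) in
      nonparanormal X S ->
      iid_copies X x ->
      rank_clime x lam Th ->
      12 * pi * M <= n%:R * lam ->
      with_prob_at_least P
        (1 - p%:R ^+ 2 * expR (- (c0 / M ^+ 2 * n%:R * lam ^+ 2)))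
        [set w | mx_norm (Th w - invmx S) <= 2 * M * lam]) &
    (forall (M : R) (p : nat -> nat) (d : nat -> measure_display)
        (T : forall n, measurableType (d n))
        (P : forall n, probability (T n) R) (S : forall n, 'M[R]_(p n))
        (X : forall n, {RV (P n) >-> (p n).-tuple R})
        (x : forall n, 'I_n -> {RV (P n) >-> (p n).-tuple R})
        (lam : nat -> R) (Th : forall n, T n -> 'M[R]_(p n)),
      let rate n := Num.sqrt (ln (p n)%:R / n%:R) in
      (forall n, nonparanormal (X n) (S n)) ->
      (forall n, iid_copies (X n) (@x n)) ->
      (forall n, rank_clime (@x n) (lam n) (@Th n)) ->
      (forall n, l1_norm (invmx (S n)) = M) ->
      (max_degree (invmx (S n)))%:R ^+ 2 * ln (p n)%:R / n%:R
        @[n --> \oo] --> (0 : R) ->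
      (\forall n \near \oo, C0 * M * rate n <= lam n) ->
      lam =O_\oo rate ->
      stochastic_bigO P (fun n w => mx_norm (Th n w - invmx (S n))) rate)].
Proof.
pose D : R := 72 * 32 ^+ 2.
have D0 : 0 < D by rewrite mulr_gt0 ?exprn_gt0.
exists (D^-1 / 2), (Num.sqrt (6 * D)); split.
- by rewrite divr_gt0 ?invr_gt0.
- by rewrite sqrtr_gt0 mulr_gt0.
- by move=> n p d T P S X x lam Th M hX hx hTh hlam; exact: (rank_clime_error_nonasymptotic hX hx hTh hlam).
move=> M p d T P S X x lam Th rate hX hx hTh hM _ hlam /eqO_exP[k k0 hk] eps eps0.
have M0 : 0 <= M by rewrite -(hM 0); exact: l1_norm_ge0.
have ln20 : 0 < ln 2 :> R by rewrite ln_gt0 // ltr1n.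
pose L := 8 / eps ^+ 3.
have L0 : 0 < L by rewrite divr_gt0 ?exprn_gt0.
have LE : 8 <= L * eps ^+ 3 by rewrite divfK ?gt_eqF ?exprn_gt0.
(* [ln 2 <= ln p] compares [n^(-1/2)] with the rate *)
pose K1 := Num.sqrt (L * D / ln 2).
have K10 : 0 <= K1 by exact: sqrtr_ge0.
pose K := 2 * M * (k + M * K1) + 1.
have K0 : 0 < K by rewrite ltr_wpDl ?mulr_ge0 ?addr_ge0 ?mulr_ge0 ?(ltW k0).
exists K => //.
have [N _ hN] := exists_nat_gt (L * D * (2 * M / eps) ^+ 2).
near=> n.
have n2 : (1 < n)%N by near: n; exact: nbhs_infty_gt.
have n0 : 0 < n%:R :> R by rewrite ltr0n (ltnW n2).
have nN : N%:R <= n%:R :> R by rewrite ler_nat; near: n; exact: nbhs_infty_ge.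
have lamn : Num.sqrt (6 * D) * M * rate n <= lam n by near: n.
have lamk : `|lam n| <= k * `|rate n| by near: n.
have rate0 : 0 <= rate n by exact: sqrtr_ge0.
have lam0 : 0 <= lam n by apply: le_trans lamn; rewrite !mulr_ge0 ?sqrtr_ge0.
rewrite (ger0_norm rate0) (ger0_norm lam0) in lamk.
have sub E : 0 <= E -> E <= (k + M * K1) * rate n ->
    with_prob_at_least (P n) (1 - eps) [set w | mx_norm (Th n w - invmx (S n)) <= 2 * M * E] ->
    with_prob_at_least (P n) (1 - eps) [set w | `|mx_norm (Th n w - invmx (S n))| <= K * `|rate n|].
  move=> E0 hE; apply: with_prob_at_least_sub => w /= h.
  rewrite (ger0_norm (mx_norm_ge0 _)) (ger0_norm rate0); apply: le_trans h _.
  apply: (@le_trans _ _ (2 * M * ((k + M * K1) * rate n))); first by rewrite ler_wpM2l ?mulr_ge0.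
  by rewrite mulrA ler_wpM2r // /K lerDl.
have lamK : lam n <= (k + M * K1) * rate n.
  by apply: le_trans lamk _; rewrite ler_wpM2r // lerDl mulr_ge0.
have [p1|p2] := leqP (p n) 1.
  by apply: (sub (lam n)) => //; rewrite -(hM n); exact: (rank_clime_error_one (hX n) (hx n) (hTh n)).
have [peps|peps] := leP 1 ((p n)%:R * eps).
  apply: (sub (lam n)) => //; rewrite -(hM n).
  apply: (rank_clime_error_many (hX n) (hx n) (hTh n) n2 p2 eps0 peps (sqrtr_ge0 (6 * D))).
    by rewrite sqr_sqrtr // mulr_ge0 ?ltW.
  by rewrite hM.
pose t := Num.sqrt (L * D / n%:R).
have t0 : 0 <= t by exact: sqrtr_ge0.
have LD0 : 0 <= L * D by rewrite mulr_ge0 // ltW.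
have tK : t <= K1 * rate n.
  rewrite -sqrtrM; last by rewrite divr_ge0 // ltW.
  rewrite ler_sqrt; last first.
    by rewrite mulr_ge0 // divr_ge0 ?(ltW ln20) ?(ltW n0) // ln_ge0 // ler1n ltnW.
  rewrite (_ : L * D / ln 2 * (ln (p n)%:R / n%:R) = L * D / n%:R * (ln (p n)%:R / ln 2)); last first.
    by rewrite mulrACA [(ln 2)^-1 * _]mulrC mulrACA.
  rewrite ler_peMr ?(divr_ge0 LD0 (ltW n0)) //.
  by rewrite ler_pdivlMr // mul1r ler_ln ?posrE ?ltr0n ?(ltnW p2) // ler_nat.
apply: (sub (lam n + M * t)).
- by rewrite addr_ge0 ?mulr_ge0.
- by rewrite mulrDl lerD // -mulrA ler_wpM2l.
rewrite -(hM n).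
apply: (rank_clime_error_few (hX n) (hx n) (hTh n) n2 eps0 (ltW peps) LE lam0).
rewrite hM -/D -/t -(ler_sqr (mulr_ge0 M0 t0)) ?nnegrE ?divr_ge0 ?(ltW eps0) //.
rewrite exprMn sqr_sqrtr; last by rewrite divr_ge0 // ltW.
have e2 : 0 < (eps / 2) ^+ 2 by rewrite exprn_gt0 ?divr_gt0.
rewrite mulrA ler_pdivrMr // -ler_pdivrMl //.
apply: le_trans (ltW (lt_le_trans hN nN)).
rewrite le_eqVlt; apply/orP; left; apply/eqP.
by have en0 := lt0r_neq0 eps0; field.
Unshelve. all: by end_near.
Qed.
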